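(* There are algebra isomorphisms $\mathrm Y^{+}(2)\cong\mathcal B(2,1)$ and $\mathrm Y^{-}(2)\cong\mathcal B(2,0)$ between the orthogonal, respectively symplectic, twisted Yangian and the reflection algebras with $n=2$.
   Context: All algebras are unital associative over $\mathbb C$. $E_{ij}$ are the matrix units, $R(u)=1-Pu^{-1}$ with $P=\sum_{i,j=1}^2E_{ij}\otimes E_{ji}\in(\mathrm{End}\,\mathbb C^2)^{\otimes2}$, and subscripts $1,2$ on a matrix show in which copy of $\mathrm{End}\,\mathbb C^2$ it lies. Relations between formal series in $u^{-1},v^{-1}$ are understood coefficientwise after multiplying by $u^2-v^2$ (or by $2u$). Reflection algebras. For $l\in\{0,1\}$ let $(\varepsilon_1,\varepsilon_2)=(1,1)$ if $l=0$ and $(1,-1)$ if $l=1$. $\mathcal B(2,l)$ has generators $b_{ij}^{(r)}$, $r\ge1$, $i,j\in\{1,2\}$; put $b_{ij}(u)=\delta_{ij}\varepsilon_i+\sum_{r\ge1}b_{ij}^{(r)}u^{-r}$ and $B(u)=(b_{ij}(u))$. The defining relations are $$R(u-v)B_1(u)R(u+v)B_2(v)=B_2(v)R(u+v)B_1(u)R(u-v),\qquad B(u)B(-u)=1.$$ Twisted Yangians. $\mathrm Y^{\pm}(2)$ has generators $s_{ij}^{(r)}$, $r\ge1$, $i,j\in\{1,2\}$; put $s_{ij}(u)=\delta_{ij}+\sum_{r\ge1}s_{ij}^{(r)}u^{-r}$ and $S(u)=(s_{ij}(u))$. The defining relations are $$R(u-v)S_1(u)R^t(-u-v)S_2(v)=S_2(v)R^t(-u-v)S_1(u)R(u-v)$$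 and $$S^t(-u)=S(u)\pm\frac{S(u)-S(-u)}{2u}.$$ Here $R^t(u)=1-Qu^{-1}$, $Q=\sum_{i,j=1}^2E_{ij}^{\,t}\otimes E_{ji}$, and the transposition $A\mapsto A^t$ of $2\times2$ matrices $A=(a_{ij})$ is $$A^t=\begin{pmatrix} a_{22} & a_{12} \\ a_{21} & a_{11} \end{pmatrix}\ \text{for }\mathrm Y^+(2),\qquad A^t=\begin{pmatrix} a_{22} & -a_{12} \\ -a_{21} & a_{11} \end{pmatrix}\ \text{for }\mathrm Y^-(2).$$ *)

(* Defs.v *)
(* Built on Mathematical Components; equality of series and of quotient classes
   uses the classical axioms of boolp. *)
From HB Require Import structures.
From mathcomp Require Import all_boot all_order all_algebra.
From mathcomp Require Import boolp classical_sets reals.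
From mathcomp Require Import finmap complex mxtens.
From mathcomp.multinomials Require Import monalg.

Set Implicit Arguments.
Unset Strict Implicit.
Unset Printing Implicit Defensive.

Import GRing.Theory.
Local Open Scope ring_scope.
Local Open Scope quotient_scope.
Local Open Scope classical_set_scope.

(* -------------------------------------------------------------------------- *)
(** Formal power series A[[z]] over a possibly non-commutative ring, given by
    their coefficients; z commutes with A.  A series in u^-1 and v^-1 is an
    element of {fps {fps A}}: the inner variable is u^-1, the outer v^-1. *)

Definition fps (A : Type) : Type := nat -> A.
Notation "{ 'fps' A }" := (fps A)
  (at level 0, A at level 2, format "{ 'fps'  A }") : type_scope.

HB.instance Definition _ (A : Type) := gen_eqMixin {fps A}.
HB.instance Definition _ (A : Type) := gen_choiceMixin {fps A}.

Section FpsZmod.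
Context (A : zmodType).
Implicit Types f g h : {fps A}.

Definition fps_zero : {fps A} := fun=> 0.
Definition fps_opp f : {fps A} := fun n => - f n.
Definition fps_add f g : {fps A} := fun n => f n + g n.

Fact fps_addA : associative fps_add.
Proof. by move=> f g h; apply/funext=> n; apply: addrA. Qed.
Fact fps_addC : commutative fps_add.
Proof. by move=> f g; apply/funext=> n; apply: addrC. Qed.
Fact fps_add0 : left_id fps_zero fps_add.
Proof. by move=> f; apply/funext=> n; apply: add0r. Qed.
Fact fps_addN : left_inverse fps_zero fps_opp fps_add.
Proof. by move=> f; apply/funext=> n; apply: addNr. Qed.

HB.instance Definition _ :=
  GRing.isZmodule.Build {fps A} fps_addA fps_addC fps_add0 fps_addN.

Lemma fps0E n : (0 : {fps A}) n = 0. Proof. by []. Qed.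
Lemma fpsNE f n : (- f) n = - f n. Proof. by []. Qed.
Lemma fpsDE f g n : (f + g) n = f n + g n. Proof. by []. Qed.

Definition fps_coef n f : A := f n.

Fact fps_coef_is_zmod_morphism n : zmod_morphism (fps_coef n).
Proof. by []. Qed.
HB.instance Definition _ n :=
  GRing.isZmodMorphism.Build {fps A} A (fps_coef n)
    (fps_coef_is_zmod_morphism n).

Definition fpsC (a : A) : {fps A} := fun n => if n == 0%N then a else 0.

End FpsZmod.

Section FpsRing.
Context (A : nzRingType).
Implicit Types f g h : {fps A}.

Definition fps_one : {fps A} := fpsC 1.
Definition fps_mul f g : {fps A} := fun n => \sum_(i < n.+1) f i * g (n - i)%N.

Lemma fps_mul_rev f g n :
  fps_mul f g n = \sum_(i < n.+1) f (n - i)%N * g i.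
Proof.
rewrite /fps_mul (reindex_inj rev_ord_inj) /=.
by apply: eq_bigr => i _; rewrite subSS subKn // -ltnS.
Qed.

Fact fps_mulA : associative fps_mul.
Proof.
move=> f g h; apply/funext=> n; rewrite [RHS]fps_mul_rev.
pose coef3 j k := f j * (g (n - j - k)%N * h k).
transitivity (\sum_(j < n.+1) \sum_(k < n.+1 | (k <= n - j)%N) coef3 j k).
  apply: eq_bigr => /= j _; rewrite fps_mul_rev big_distrr /=.
  by rewrite (big_ord_narrow_leq (leq_subr _ _)).
rewrite (exchange_big_dep predT) //=; apply: eq_bigr => k _.
transitivity (\sum_(j < n.+1 | (j <= n - k)%N) coef3 j k).
  by apply: eq_bigl => j; rewrite -ltnS -(ltnS j) -!subSn ?leq_ord // -subn_gt0
    -(subn_gt0 j) -!subnDA addnC.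
rewrite big_ord_narrow_leq ?leq_subr // => le_n_k.
rewrite /fps_mul big_distrl; apply: eq_bigr => j _.
by rewrite /coef3 mulrA -!subnDA addnC.
Qed.

Fact fps_mul1l : left_id fps_one fps_mul.
Proof.
move=> f; apply/funext=> n; rewrite /fps_mul big_ord_recl mul1r subn0.
by rewrite big1 ?addr0 // => i _; rewrite mul0r.
Qed.

Fact fps_mul1r : right_id fps_one fps_mul.
Proof.
move=> f; apply/funext=> n; rewrite fps_mul_rev big_ord_recl mulr1 subn0.
by rewrite big1 ?addr0 // => i _; rewrite mulr0.
Qed.

Fact fps_mulDl : left_distributive fps_mul +%R.
Proof.
move=> f g h; apply/funext=> n; rewrite fpsDE -big_split.
by apply: eq_bigr => i _; apply: mulrDl.
Qed.

Fact fps_mulDr : right_distributive fps_mul +%R.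
Proof.
move=> f g h; apply/funext=> n; rewrite fpsDE -big_split.
by apply: eq_bigr => i _; apply: mulrDr.
Qed.

Fact fps_one_neq0 : fps_one != 0.
Proof.
by apply/eqP => /(congr1 (fps_coef 0)) /eqP; apply/negP/oner_neq0.
Qed.

HB.instance Definition _ := GRing.Zmodule_isNzRing.Build {fps A}
  fps_mulA fps_mul1l fps_mul1r fps_mulDl fps_mulDr fps_one_neq0.

Lemma fps1E n : (1 : {fps A}) n = (n == 0%N)%:R.
Proof. by rewrite [LHS]/(fpsC 1 n) /fpsC; case: eqP. Qed.
Lemma fpsME f g n : (f * g) n = \sum_(i < n.+1) f i * g (n - i)%N.
Proof. by []. Qed.

Fact fpsC_is_zmod_morphism : zmod_morphism (@fpsC A).
Proof.
by move=> a b; apply/funext=> -[|n]; rewrite fpsDE fpsNE /fpsC //= subr0.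
Qed.
Fact fpsC_is_monoid_morphism : monoid_morphism (@fpsC A).
Proof.
split=> // a b; apply/funext=> n; rewrite fpsME big_ord_recl /= subn0.
rewrite big1 => [|i _]; last by rewrite mul0r.
by rewrite addr0 /fpsC; case: eqP => // _; rewrite mulr0.
Qed.

HB.instance Definition _ := GRing.isZmodMorphism.Build A {fps A} (@fpsC A)
  fpsC_is_zmod_morphism.
HB.instance Definition _ := GRing.isMonoidMorphism.Build A {fps A} (@fpsC A)
  fpsC_is_monoid_morphism.

Definition fpsX : {fps A} := fun n => (n == 1%N)%:R.

(* f(z) |-> f(-z); for z = u^-1 this is also the substitution u |-> -u. *)
Definition fps_neg f : {fps A} := fun n => (-1) ^+ n * f n.

End FpsRing.

Arguments fpsX {A}.

Section FpsComRing.
Context (A : comNzRingType).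

Fact fps_mulC : commutative (@GRing.mul {fps A}).
Proof.
move=> f g; apply/funext=> n; rewrite [RHS]fps_mul_rev.
by apply: eq_bigr => i _; apply: mulrC.
Qed.

HB.instance Definition _ := GRing.PzRing_hasCommutativeMul.Build {fps A} fps_mulC.

End FpsComRing.

Definition map_fps (A B : Type) (h : A -> B) (f : {fps A}) : {fps B} :=
  fun n => h (f n).

Section MapFps.
Context (A B : nzRingType) (h : {rmorphism A -> B}).

Fact map_fps_is_zmod_morphism : zmod_morphism (map_fps h).
Proof. by move=> f g; apply/funext=> n; apply: rmorphB. Qed.

Fact map_fps_is_monoid_morphism : monoid_morphism (map_fps h).
Proof.
split=> [|f g]; apply/funext=> n.
  by rewrite /map_fps !fps1E rmorph_nat.
by rewrite /map_fps !fpsME rmorph_sum; apply: eq_bigr => i _; rewrite rmorphM.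
Qed.

HB.instance Definition _ := GRing.isZmodMorphism.Build {fps A} {fps B}
  (map_fps h) map_fps_is_zmod_morphism.
HB.instance Definition _ := GRing.isMonoidMorphism.Build {fps A} {fps B}
  (map_fps h) map_fps_is_monoid_morphism.

End MapFps.

(* f(u) and f(v) as series in u^-1 and v^-1. *)
Definition in_u (A : zmodType) (f : {fps A}) : {fps {fps A}} := fpsC f.
Definition in_v (A : zmodType) (f : {fps A}) : {fps {fps A}} :=
  map_fps (@fpsC A) f.

(* -------------------------------------------------------------------------- *)
(** Algebras presented by generators and relations. *)

Fact malg_scalerAr (K : comNzRingType) (M : monomType) (c : K)
  (x y : {malg K[M]}) : c *: (x * y) = x * (c *: y).
Proof.
have cxC : c%:MP * x = x * c%:MP.
  rewrite [LHS]fgmulUg [RHS]fgmulgU; apply: eq_bigr => k _.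
  by rewrite mul1m mulm1 mulrC.
by rewrite -(mul_malgC c (x * y)) -(mul_malgC c y) mulrA cxC mulrA.
Qed.

Section FreeAlg.
Context (K : comNzRingType) (I : choiceType).

(* The algebra of the free monoid on I. *)
Definition free_alg : Type := {malg K[{fmonom I}]}.

HB.instance Definition _ := GRing.Lalgebra.on free_alg.
HB.instance Definition _ :=
  GRing.Lalgebra_isAlgebra.Build K free_alg (@malg_scalerAr K (fmonom I)).

Definition free_gen (i : I) : free_alg := << fmu i >>.

(* The character that vanishes on all generators. *)
Definition free_eps (x : free_alg) : K := mcoeff mone x.

Fact free_eps_is_zmod_morphism : zmod_morphism free_eps.
Proof. exact: (raddfB (@mcoeff (fmonom I) K mone)). Qed.
Fact free_eps_is_monoid_morphism : monoid_morphism free_eps.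
Proof.
by split; [exact: (rmorph1 (@mcoeff (fmonom I) K mone))
          | exact: (rmorphM (@mcoeff (fmonom I) K mone))].
Qed.
HB.instance Definition _ := GRing.isZmodMorphism.Build free_alg K free_eps
  free_eps_is_zmod_morphism.
HB.instance Definition _ := GRing.isMonoidMorphism.Build free_alg K free_eps
  free_eps_is_monoid_morphism.

Lemma free_eps_gen i : free_eps (free_gen i) = 0.
Proof.
rewrite /free_eps mcoeffU.
by case: eqP => // /(congr1 (fun m : {fmonom _} => size m)); rewrite fmuE fm1.
Qed.

Lemma free_eps_scalar c : free_eps c%:A = c.
Proof. by rewrite /free_eps mcoeffZ mcoeff1 eqxx mulr1. Qed.

End FreeAlg.

Definition two_sided_ideal (K : comNzRingType) (F : algType K) (J : set F) :=
  [/\ J 0, forall x y, J x -> J y -> J (x + y),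
      forall a x, J x -> J (a * x) & forall a x, J x -> J (x * a)].

Definition ideal_span (K : comNzRingType) (F : algType K) (S : set F) : set F :=
  fun x => forall J : set F, two_sided_ideal J -> (S `<=` J)%classic -> J x.

(* F / (S).  The algebra structures of the library exclude the zero ring,
   whence the side condition [proper]. *)
Section QuotientAlgebra.
Context (K : comNzRingType) (F : algType K) (S : set F).
Context (proper : ~ ideal_span S 1).

Local Notation J := (ideal_span S).

Lemma ideal_span_ideal : two_sided_ideal J.
Proof.
split=> [I [] //|x y Jx Jy I idI sI|a x Jx I idI sI|a x Jx I idI sI];
  have [I0 ID Il Ir] := idI.
- exact: ID (Jx _ _ _) (Jy _ _ _).
- exact: Il (Jx _ _ _).
- exact: Ir (Jx _ _ _).
Qed.

Lemma ideal_span0 : J 0. Proof. by case: ideal_span_ideal. Qed.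
Lemma ideal_spanD x y : J x -> J y -> J (x + y).
Proof. by case: ideal_span_ideal => _ + _ _; apply. Qed.
Lemma ideal_spanMl a x : J x -> J (a * x).
Proof. by case: ideal_span_ideal => _ _ + _; apply. Qed.
Lemma ideal_spanMr a x : J x -> J (x * a).
Proof. by case: ideal_span_ideal => _ _ _; apply. Qed.
Lemma ideal_spanN x : J x -> J (- x).
Proof. by move=> Jx; rewrite -mulN1r; exact: (ideal_spanMl _ Jx). Qed.
Lemma ideal_spanZ c x : J x -> J (c *: x).
Proof. by move=> Jx; rewrite -[x]mul1r scalerAl; exact: (ideal_spanMl _ Jx). Qed.

Definition ideal_eq (x y : F) : bool := `[< J (x - y) >].

Fact ideal_eq_refl : reflexive ideal_eq.
Proof. by move=> x; apply/asboolP; rewrite subrr; apply: ideal_span0. Qed.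
Fact ideal_eq_sym : symmetric ideal_eq.
Proof.
by move=> x y; apply/asboolP/asboolP => /ideal_spanN; rewrite opprB.
Qed.
Fact ideal_eq_trans : transitive ideal_eq.
Proof.
move=> y x z /asboolP Jxy /asboolP Jyz; apply/asboolP.
by have := ideal_spanD Jxy Jyz; rewrite addrA subrK.
Qed.

Canonical ideal_equiv : equiv_rel F :=
  EquivRel ideal_eq ideal_eq_refl ideal_eq_sym ideal_eq_trans.
Canonical ideal_encModRel := defaultEncModRel ideal_eq.

(* The argument [proper] is carried only to attach the algebra structure. *)
Definition quot_alg_of of ~ ideal_span S 1 := {eq_quot ideal_eq}.
Local Notation Q := (quot_alg_of proper).

HB.instance Definition _ : EqQuotient F ideal_eq Q := EqQuotient.on Q.
HB.instance Definition _ := Choice.on Q.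

Definition quot_zero : Q := lift_cst Q 0.
Definition quot_one : Q := lift_cst Q 1.
Definition quot_opp := lift_op1 Q -%R.
Definition quot_add := lift_op2 Q +%R.
Definition quot_mul := lift_op2 Q *%R.
Definition quot_scale (c : K) := lift_op1 Q ( *:%R c).

Canonical pi_quot_zero := PiConst quot_zero.
Canonical pi_quot_one := PiConst quot_one.

Lemma pi_quotP x y : \pi_Q x = \pi_Q y <-> J (x - y).
Proof. by split=> [/eqquotP/asboolP|/asboolP Jxy] //; apply/eqquotP. Qed.

Lemma repr_pi_ideal x : J (repr (\pi_Q x) - x).
Proof. by apply/pi_quotP; rewrite reprK. Qed.

Lemma pi_quotN : {morph \pi_Q : x / - x >-> quot_opp x}.
Proof.
move=> x; unlock quot_opp; apply/esym/pi_quotP; rewrite -opprD.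
by apply: ideal_spanN; apply: repr_pi_ideal.
Qed.
Canonical pi_quot_opp := PiMorph1 pi_quotN.

Lemma pi_quotD : {morph \pi_Q : x y / x + y >-> quot_add x y}.
Proof.
move=> x y; unlock quot_add; apply/esym/pi_quotP; rewrite opprD addrACA.
by apply: ideal_spanD; apply: repr_pi_ideal.
Qed.
Canonical pi_quot_add := PiMorph2 pi_quotD.

Lemma pi_quotM : {morph \pi_Q : x y / x * y >-> quot_mul x y}.
Proof.
move=> x y; unlock quot_mul; apply/esym/pi_quotP.
set x' := repr _; set y' := repr _.
have -> : x' * y' - x * y = (x' - x) * y' + x * (y' - y).
  by rewrite mulrBl mulrBr addrA subrK.
by apply: ideal_spanD; [apply: ideal_spanMr | apply: ideal_spanMl];
  apply: repr_pi_ideal.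
Qed.
Canonical pi_quot_mul := PiMorph2 pi_quotM.

Lemma pi_quotZ c : {morph \pi_Q : x / c *: x >-> quot_scale c x}.
Proof.
move=> x; unlock quot_scale; apply/esym/pi_quotP; rewrite -scalerBr.
by apply: ideal_spanZ; apply: repr_pi_ideal.
Qed.
Canonical pi_quot_scale c := PiMorph1 (pi_quotZ c).

Fact quot_addA : associative quot_add.
Proof.
by do 3!elim/quotW=> ?; rewrite !piE addrA.
Qed.
Fact quot_addC : commutative quot_add.
Proof. by do 2!elim/quotW=> ?; rewrite !piE addrC. Qed.
Fact quot_add0 : left_id quot_zero quot_add.
Proof. by elim/quotW=> x; rewrite !piE add0r. Qed.
Fact quot_addN : left_inverse quot_zero quot_opp quot_add.
Proof. by elim/quotW=> x; rewrite !piE addNr. Qed.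

HB.instance Definition _ :=
  GRing.isZmodule.Build Q quot_addA quot_addC quot_add0 quot_addN.

Fact quot_mulA : associative quot_mul.
Proof. by do 3!elim/quotW=> ?; rewrite !piE mulrA. Qed.
Fact quot_mul1l : left_id quot_one quot_mul.
Proof. by elim/quotW=> x; rewrite !piE mul1r. Qed.
Fact quot_mul1r : right_id quot_one quot_mul.
Proof. by elim/quotW=> x; rewrite !piE mulr1. Qed.
Fact quot_mulDl : left_distributive quot_mul quot_add.
Proof. by do 3!elim/quotW=> ?; rewrite !piE mulrDl. Qed.
Fact quot_mulDr : right_distributive quot_mul quot_add.
Proof. by do 3!elim/quotW=> ?; rewrite !piE mulrDr. Qed.
Fact quot_one_neq0 : quot_one != quot_zero.
Proof.
by apply/eqP; unlock quot_one quot_zero => /pi_quotP; rewrite subr0.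
Qed.

HB.instance Definition _ := GRing.Zmodule_isNzRing.Build Q
  quot_mulA quot_mul1l quot_mul1r quot_mulDl quot_mulDr quot_one_neq0.

Fact quot_scaleA c d x : quot_scale c (quot_scale d x) = quot_scale (c * d) x.
Proof. by elim/quotW: x => x; rewrite !piE scalerA. Qed.
Fact quot_scale1 : left_id 1 quot_scale.
Proof. by elim/quotW=> x; rewrite !piE scale1r. Qed.
Fact quot_scaleDr : right_distributive quot_scale +%R.
Proof.
move=> c; elim/quotW=> x; elim/quotW=> y.
by rewrite -[_ + _]pi_quotD -!pi_quotZ scalerDr pi_quotD.
Qed.
Fact quot_scaleDl (x : Q) : {morph quot_scale^~ x : c d / c + d}.
Proof.
move=> c d; elim/quotW: x => x.
by rewrite /= -!pi_quotZ scalerDl pi_quotD.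
Qed.

HB.instance Definition _ := GRing.Zmodule_isLmodule.Build K Q
  quot_scaleA quot_scale1 quot_scaleDr quot_scaleDl.

Fact quot_scaleAl c (x y : Q) : c *: (x * y) = (c *: x) * y.
Proof.
elim/quotW: x => x; elim/quotW: y => y.
by rewrite -[_ * _]pi_quotM -[LHS]pi_quotZ scalerAl pi_quotM pi_quotZ.
Qed.
HB.instance Definition _ := GRing.Lmodule_isLalgebra.Build K Q quot_scaleAl.

Fact quot_scaleAr c (x y : Q) : c *: (x * y) = x * (c *: y).
Proof.
elim/quotW: x => x; elim/quotW: y => y.
by rewrite -[_ * _]pi_quotM -[LHS]pi_quotZ scalerAr pi_quotM pi_quotZ.
Qed.
HB.instance Definition _ := GRing.Lalgebra_isAlgebra.Build K Q quot_scaleAr.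

Definition quot_alg : algType K := Q.

Definition quot_proj : F -> quot_alg := \pi_Q.

Fact quot_proj_is_zmod_morphism : zmod_morphism quot_proj.
Proof. by move=> x y; rewrite /quot_proj pi_quotD pi_quotN. Qed.
Fact quot_proj_is_monoid_morphism : monoid_morphism quot_proj.
Proof.
split=> [|x y]; rewrite /quot_proj ?pi_quotM //.
by rewrite -[RHS]/quot_one; unlock quot_one.
Qed.
Fact quot_proj_is_scalable : scalable quot_proj.
Proof. by move=> c x; rewrite /quot_proj pi_quotZ. Qed.

HB.instance Definition _ := GRing.isZmodMorphism.Build F quot_alg quot_proj
  quot_proj_is_zmod_morphism.
HB.instance Definition _ := GRing.isMonoidMorphism.Build F quot_alg quot_proj
  quot_proj_is_monoid_morphism.
HB.instance Definition _ := GRing.isScalable.Build K F quot_alg *:%R quot_proj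
  quot_proj_is_scalable.

Lemma quot_proj_eq0 x : quot_proj x = 0 <-> J x.
Proof.
by rewrite -(rmorph0 quot_proj); split=> [/pi_quotP|Jx]; [|apply/pi_quotP];
  rewrite subr0.
Qed.

End QuotientAlgebra.

(* -------------------------------------------------------------------------- *)
(** Matrices over series rings, and the defining relations. *)

(* Orthogonal and Symplectic stand for the superscripts + and - of Y^+(2) and
   Y^-(2). *)
Variant twist := Orthogonal | Symplectic.

Section Matrices.
Context (A : nzRingType).

(* End(C^2) (x) End(C^2) is identified with the 4 x 4 matrices through the
   Kronecker product. *)
Definition flip_mx : 'M[A]_(2 * 2) :=
  \sum_(i < 2) \sum_(j < 2) delta_mx i j *t delta_mx j i.

Definition copy1 (M : 'M[A]_2) : 'M[A]_(2 * 2) := M *t 1%:M.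
Definition copy2 (M : 'M[A]_2) : 'M[A]_(2 * 2) := 1%:M *t M.

Lemma flip_mxE (a b c d : 'I_2) :
  flip_mx (mxtens_index (a, b)) (mxtens_index (c, d)) =
  ((a == d) && (b == c))%:R.
Proof.
rewrite /flip_mx summxE (bigD1 a) //= summxE (bigD1 c) //= tensmxE !mxE !eqxx.
rewrite !big1 ?addr0 => [|i ia|j jc].
- by rewrite mul1r andbC (eq_sym d).
- rewrite summxE big1 // => j _; rewrite tensmxE !mxE.
  by rewrite eq_sym (negPf ia) mul0r.
- by rewrite tensmxE !mxE eqxx (eq_sym c) (negPf jc) mul0r.
Qed.

Lemma mul_flip_mx (M : 'M[A]_(2 * 2)) (a b : 'I_2) k :
  (flip_mx *m M) (mxtens_index (a, b)) k = M (mxtens_index (b, a)) k.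
Proof.
rewrite mxE (bigD1 (mxtens_index (b, a))) //= flip_mxE !eqxx mul1r.
rewrite big1 ?addr0 // => i; case: (mxtens_indexP i) => c d ne.
rewrite flip_mxE; case: andP => [[/eqP ad /eqP bc]|_]; last by rewrite mul0r.
by rewrite ad bc eqxx in ne.
Qed.

Lemma mulmx_flip (M : 'M[A]_(2 * 2)) k (a b : 'I_2) :
  (M *m flip_mx) k (mxtens_index (a, b)) = M k (mxtens_index (b, a)).
Proof.
rewrite mxE (bigD1 (mxtens_index (b, a))) //= flip_mxE !eqxx mulr1.
rewrite big1 ?addr0 // => i; case: (mxtens_indexP i) => c d ne.
rewrite flip_mxE; case: andP => [[/eqP ad /eqP bc]|_]; last by rewrite mulr0.
by rewrite ad bc eqxx in ne.
Qed.

Lemma tens_mx11 : 1%:M *t 1%:M = 1%:M :> 'M[A]_(2 * 2).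
Proof.
apply/matrixP=> i j; case: (mxtens_indexP i) => a b.
case: (mxtens_indexP j) => c d; rewrite tensmxE !mxE -natrM mulnb.
by rewrite (can_eq (@mxtens_indexK _ _)) xpair_eqE.
Qed.

Lemma mul_flip_copy1 M : flip_mx *m copy1 M = copy2 M *m flip_mx.
Proof.
apply/matrixP=> i j; case: (mxtens_indexP i) => a b.
case: (mxtens_indexP j) => c d; rewrite mul_flip_mx mulmx_flip !tensmxE !mxE.
by rewrite mulr_natr mulr_natl.
Qed.

Lemma mul_flip_copy2 M : flip_mx *m copy2 M = copy1 M *m flip_mx.
Proof.
apply/matrixP=> i j; case: (mxtens_indexP i) => a b.
case: (mxtens_indexP j) => c d; rewrite mul_flip_mx mulmx_flip !tensmxE !mxE.
by rewrite mulr_natr mulr_natl.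
Qed.

Lemma flip_mxK : flip_mx *m flip_mx = 1%:M.
Proof.
apply/matrixP=> i j; case: (mxtens_indexP i) => a b.
case: (mxtens_indexP j) => c d; rewrite mul_flip_mx flip_mxE !mxE.
by rewrite (can_eq (@mxtens_indexK _ _)) xpair_eqE andbC.
Qed.

Context (t : twist).

Definition twist_sign : A := if t is Orthogonal then 1 else -1.

Definition twist_tr (M : 'M[A]_2) : 'M[A]_2 :=
  \matrix_(i, j) if i == j then M (rev_ord i) (rev_ord i)
                 else twist_sign * M i j.

Definition twist_flip_mx : 'M[A]_(2 * 2) :=
  \sum_(i < 2) \sum_(j < 2) twist_tr (delta_mx i j) *t delta_mx j i.

Lemma mul_flip_twist : flip_mx *m twist_flip_mx = twist_flip_mx *m flip_mx.
Proof.
have E a b c d :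
    twist_flip_mx (mxtens_index (a, b)) (mxtens_index (c, d)) =
    if a == c then ((d == rev_ord a) && (b == rev_ord a))%:R
    else twist_sign * ((d == a) && (b == c))%:R.
  rewrite /twist_flip_mx summxE (bigD1 d) //= summxE (bigD1 b) //= tensmxE.
  rewrite [delta_mx b d b d]mxE !eqxx mulr1 !big1 ?addr0 => [|i ne|j ne].
  - by rewrite !mxE (eq_sym d) (eq_sym b) (eq_sym d) (eq_sym b).
  - rewrite summxE big1 // => j _; rewrite tensmxE [X in _ * X]mxE.
    by rewrite (eq_sym d) (negPf ne) andbF mulr0.
  - by rewrite tensmxE [X in _ * X]mxE (eq_sym b) (negPf ne) mulr0.
apply/matrixP=> i j; case: (mxtens_indexP i) => a b.
case: (mxtens_indexP j) => c d; rewrite mul_flip_mx mulmx_flip !E -!val_eqE /=.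
by case: a => [[|[|//]] ?]; case: b => [[|[|//]] ?]; case: c => [[|[|//]] ?];
  case: d => [[|[|//]] ?]; rewrite /= ?mulr0.
Qed.

End Matrices.

Arguments flip_mx {A}.

Section SeriesMatrices.
Context (A : nzRingType).
Local Notation A1 := {fps A}.
Local Notation A2 := {fps {fps A}}.

(* M(-u) *)
Definition neg_mx (M : 'M[A1]_2) : 'M[A1]_2 := map_mx (@fps_neg A) M.

Definition uV : A2 := in_u fpsX.
Definition vV : A2 := in_v fpsX.

(* M_1(u) and M_2(v) *)
Definition mx_u1 (M : 'M[A1]_2) : 'M[A2]_(2 * 2) := copy1 (map_mx (@in_u A) M).
Definition mx_v2 (M : 'M[A1]_2) : 'M[A2]_(2 * 2) := copy2 (map_mx (@in_v A) M).

(* Relations in u and v are multiplied by (u^2 - v^2) u^-2 v^-2.  The factor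
   (u - v) u^-1 v^-1 = v^-1 - u^-1 goes to R(u - v), and
   (u + v) u^-1 v^-1 = v^-1 + u^-1 goes to R(u + v) = 1 - P / (u + v),
   respectively to R^t(- u - v) = 1 + Q / (u + v). *)
Definition R_minus : 'M[A2]_(2 * 2) := (vV - uV)%:M - (uV * vV) *: flip_mx.
Definition R_plus : 'M[A2]_(2 * 2) := (vV + uV)%:M - (uV * vV) *: flip_mx.
Definition Rt_plus (t : twist) : 'M[A2]_(2 * 2) :=
  (vV + uV)%:M + (uV * vV) *: twist_flip_mx A2 t.

Definition reflection_lhs (B : 'M[A1]_2) : 'M[A2]_(2 * 2) :=
  R_minus *m mx_u1 B *m R_plus *m mx_v2 B.
Definition reflection_rhs (B : 'M[A1]_2) : 'M[A2]_(2 * 2) :=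
  mx_v2 B *m R_plus *m mx_u1 B *m R_minus.

Definition quaternary_lhs (t : twist) (S : 'M[A1]_2) : 'M[A2]_(2 * 2) :=
  R_minus *m mx_u1 S *m Rt_plus t *m mx_v2 S.
Definition quaternary_rhs (t : twist) (S : 'M[A1]_2) : 'M[A2]_(2 * 2) :=
  mx_v2 S *m Rt_plus t *m mx_u1 S *m R_minus.

(* The symmetry relation is multiplied by 2 = (2 u) u^-1. *)
Definition symmetry_lhs (t : twist) (S : 'M[A1]_2) : 'M[A1]_2 :=
  2 *: twist_tr t (neg_mx S).
Definition symmetry_rhs (t : twist) (S : 'M[A1]_2) : 'M[A1]_2 :=
  2 *: S + (twist_sign A1 t * fpsX) *: (S - neg_mx S).

End SeriesMatrices.

Section Naturality.
Context (A B : nzRingType) (h : {rmorphism A -> B}).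
Local Notation h1 := (map_fps h).
Local Notation h2 := (map_fps (map_fps h)).

Lemma map_flip_mx : map_mx h flip_mx = flip_mx.
Proof.
apply/matrixP=> i j; case: (mxtens_indexP i) => a b.
by case: (mxtens_indexP j) => c d; rewrite mxE !flip_mxE rmorph_nat.
Qed.

Lemma map_twist_tr t M : map_mx h (twist_tr t M) = twist_tr t (map_mx h M).
Proof.
apply/matrixP=> i j; rewrite !mxE; case: eqP => // _; rewrite rmorphM.
by case: t; rewrite /= ?rmorphN1 ?rmorph1.
Qed.

Lemma map_twist_flip_mx t : map_mx h (twist_flip_mx A t) = twist_flip_mx B t.
Proof.
rewrite /twist_flip_mx map_mx_sum; apply: eq_bigr => i _; rewrite map_mx_sum.
by apply: eq_bigr => j _; rewrite map_mxT map_twist_tr !map_delta_mx.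
Qed.

Lemma map_in_u f : h2 (in_u f) = in_u (h1 f).
Proof.
apply/funext=> -[//|n]; apply/funext=> m; exact: rmorph0.
Qed.
Lemma map_in_v f : h2 (in_v f) = in_v (h1 f).
Proof.
apply/funext=> n; apply/funext=> -[//|m]; exact: rmorph0.
Qed.

Lemma map_mx_u1 M : map_mx h2 (mx_u1 M) = mx_u1 (map_mx h1 M).
Proof.
rewrite /mx_u1 /copy1 map_mxT map_mx1 -!map_mx_comp.
by congr (_ *t _); apply/eq_map_mx=> f; apply: map_in_u.
Qed.
Lemma map_mx_v2 M : map_mx h2 (mx_v2 M) = mx_v2 (map_mx h1 M).
Proof.
rewrite /mx_v2 /copy2 map_mxT map_mx1 -!map_mx_comp.
by congr (_ *t _); apply/eq_map_mx=> f; apply: map_in_v.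
Qed.

Lemma map_fpsX : h1 fpsX = fpsX.
Proof. by apply/funext=> n; apply: rmorph_nat. Qed.

Lemma map_neg_mx M : map_mx h1 (neg_mx M) = neg_mx (map_mx h1 M).
Proof.
apply/matrixP=> i j; rewrite !mxE; apply/funext=> n.
by rewrite /map_fps rmorphM rmorph_sign.
Qed.

End Naturality.

Section SeriesNaturality.
Context (A B : nzRingType) (h : {rmorphism A -> B}).
Local Notation h1 := (map_fps h).
Local Notation h2 := (map_fps (map_fps h)).

Lemma map_uV : h2 (uV A) = uV B.
Proof. by rewrite map_in_u map_fpsX. Qed.
Lemma map_vV : h2 (vV A) = vV B.
Proof. by rewrite map_in_v map_fpsX. Qed.

Lemma map_R_minus : map_mx h2 (R_minus A) = R_minus B.
Proof.
by rewrite map_mxB map_scalar_mx map_mxZ map_flip_mx rmorphB rmorphM /= map_uV map_vV.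
Qed.
Lemma map_R_plus : map_mx h2 (R_plus A) = R_plus B.
Proof.
by rewrite map_mxB map_scalar_mx map_mxZ map_flip_mx rmorphD rmorphM /= map_uV map_vV.
Qed.
Lemma map_Rt_plus t : map_mx h2 (Rt_plus A t) = Rt_plus B t.
Proof.
by rewrite map_mxD map_scalar_mx map_mxZ map_twist_flip_mx rmorphD rmorphM /=
  map_uV map_vV.
Qed.

Let map_mx_mul4 n (h' : {rmorphism {fps {fps A}} -> {fps {fps B}}})
    (X Y Z T : 'M_n) :
  map_mx h' (X *m Y *m Z *m T) =
  map_mx h' X *m map_mx h' Y *m map_mx h' Z *m map_mx h' T.
Proof. by rewrite !map_mxM. Qed.

Lemma map_reflection_lhs M :
  map_mx h2 (reflection_lhs M) = reflection_lhs (map_mx h1 M).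
Proof.
rewrite /reflection_lhs [LHS](map_mx_mul4 h2).
by rewrite -map_R_minus -(map_mx_u1 h) -map_R_plus -(map_mx_v2 h).
Qed.
Lemma map_reflection_rhs M :
  map_mx h2 (reflection_rhs M) = reflection_rhs (map_mx h1 M).
Proof.
rewrite /reflection_rhs [LHS](map_mx_mul4 h2).
by rewrite -(map_mx_v2 h) -map_R_plus -(map_mx_u1 h) -map_R_minus.
Qed.
Lemma map_quaternary_lhs t M :
  map_mx h2 (quaternary_lhs t M) = quaternary_lhs t (map_mx h1 M).
Proof.
rewrite /quaternary_lhs [LHS](map_mx_mul4 h2).
by rewrite -map_R_minus -(map_mx_u1 h) -map_Rt_plus -(map_mx_v2 h).
Qed.
Lemma map_quaternary_rhs t M :
  map_mx h2 (quaternary_rhs t M) = quaternary_rhs t (map_mx h1 M).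
Proof.
rewrite /quaternary_rhs [LHS](map_mx_mul4 h2).
by rewrite -(map_mx_v2 h) -map_Rt_plus -(map_mx_u1 h) -map_R_minus.
Qed.
Lemma map_symmetry_lhs t M :
  map_mx h1 (symmetry_lhs t M) = symmetry_lhs t (map_mx h1 M).
Proof. by rewrite map_mxZ map_twist_tr map_neg_mx rmorph_nat. Qed.
Lemma map_symmetry_rhs t M :
  map_mx h1 (symmetry_rhs t M) = symmetry_rhs t (map_mx h1 M).
Proof.
rewrite map_mxD !map_mxZ map_mxB map_neg_mx rmorph_nat rmorphM /= map_fpsX.
by congr (_ + (_ * _) *: _); case: t; rewrite /= ?rmorphN1 ?rmorph1.
Qed.

End SeriesNaturality.

Lemma copy1M (C : comNzRingType) (M N : 'M[C]_2) :
  copy1 M *m copy1 N = copy1 (M *m N).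
Proof. by rewrite tensmx_mul mulmx1. Qed.
Lemma copy2M (C : comNzRingType) (M N : 'M[C]_2) :
  copy2 M *m copy2 N = copy2 (M *m N).
Proof. by rewrite tensmx_mul mulmx1. Qed.
Lemma copy12C (C : comNzRingType) (M N : 'M[C]_2) :
  copy1 M *m copy2 N = copy2 N *m copy1 M.
Proof. by rewrite !tensmx_mul !mul1mx !mulmx1. Qed.

Lemma const_reflection (C : comNzRingType) n (P D1 D2 : 'M[C]_n) (a b c : C) :
  P *m P = 1%:M -> P *m D1 = D2 *m P -> P *m D2 = D1 *m P ->
  D1 *m D1 = 1%:M -> D2 *m D2 = 1%:M -> D1 *m D2 = D2 *m D1 ->
  (a%:M - c *: P) *m D1 *m (b%:M - c *: P) *m D2 =
  D2 *m (b%:M - c *: P) *m D1 *m (a%:M - c *: P).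
Proof.
move=> PP PD1 PD2 D11 D22 D12.
have -> : (a%:M - c *: P) *m D1 *m (b%:M - c *: P) *m D2 =
    (a *: D1 - c *: (D2 *m P)) *m (b *: D2 - c *: (D1 *m P)).
  rewrite -[_ *m _ *m _ *m D2]mulmxA; congr (_ *m _).
    by rewrite mulmxBl mul_scalar_mx -scalemxAl PD1.
  by rewrite mulmxBl mul_scalar_mx -scalemxAl PD2.
have -> : D2 *m (b%:M - c *: P) *m D1 *m (a%:M - c *: P) =
    (b *: (D2 *m D1) - c *: P) *m (a%:M - c *: P).
  congr (_ *m _); rewrite mulmxBr mulmxBl mul_mx_scalar -!scalemxAl.
  by rewrite -scalemxAr -scalemxAl -mulmxA PD1 mulmxA D22 mul1mx.
rewrite !(mulmxBl, mulmxBr) !mul_mx_scalar -!(scalemxAl, scalemxAr) !scalerA.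
have -> : D1 *m (D1 *m P) = P by rewrite mulmxA D11 mul1mx.
have -> : D2 *m P *m D2 = D2 *m D1 *m P by rewrite -!mulmxA PD2.
have -> : D2 *m P *m (D1 *m P) = 1%:M.
  by rewrite mulmxA -(mulmxA D2) PD1 mulmxA D22 mul1mx.
by rewrite PP D12 (mulrC c b) !opprD !opprK !addrA; congr (_ + _); apply: addrAC.
Qed.

Lemma const_quaternary (C : comNzRingType) n (P Q : 'M[C]_n) (a b c : C) :
  P *m Q = Q *m P ->
  (a%:M - c *: P) *m (b%:M + c *: Q) = (b%:M + c *: Q) *m (a%:M - c *: P).
Proof.
move=> PQ; rewrite !(mulmxBl, mulmxBr, mulmxDl, mulmxDr).
rewrite !mul_mx_scalar !mul_scalar_mx -!(scalemxAl, scalemxAr) !scalerA PQ.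
by rewrite !scale_scalar_mx (mulrC b a).
Qed.

Lemma mulmx_unit4 (A : nzRingType) n (X Y I1 I2 : 'M[A]_n) :
  I1 = 1%:M -> I2 = 1%:M -> X *m Y = Y *m X ->
  X *m I1 *m Y *m I2 = I2 *m Y *m I1 *m X.
Proof. by move=> -> -> XY; rewrite !mulmx1 mul1mx. Qed.

Section ConstantSolutions.
Context (C : comNzRingType).
Local Notation const_mx1 := (map_mx (@fpsC C)).
Local Notation const_mx2 D := (map_mx (@fpsC _) (const_mx1 D)).

Lemma mx_u1_const D : mx_u1 (const_mx1 D) = copy1 (const_mx2 D).
Proof. by []. Qed.

Lemma mx_v2_const D : mx_v2 (const_mx1 D) = copy2 (const_mx2 D).
Proof.
congr (_ *t _); apply/matrixP=> i j; rewrite !mxE.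
by apply/funext=> -[//|n]; apply/funext=> -[].
Qed.

Lemma reflection_const D :
  D *m D = 1%:M -> reflection_lhs (const_mx1 D) = reflection_rhs (const_mx1 D).
Proof.
move=> DD; rewrite /reflection_lhs /reflection_rhs mx_u1_const mx_v2_const.
have DD2 : const_mx2 D *m const_mx2 D = 1%:M by rewrite -!map_mxM DD !map_mx1.
apply: const_reflection.
- exact: flip_mxK.
- exact: mul_flip_copy1.
- exact: mul_flip_copy2.
- by rewrite copy1M DD2; apply: tens_mx11.
- by rewrite copy2M DD2; apply: tens_mx11.
- exact: copy12C.
Qed.

Lemma quaternary_const t :
  quaternary_lhs t (const_mx1 1%:M) = quaternary_rhs t (const_mx1 1%:M).
Proof.
rewrite /quaternary_lhs /quaternary_rhs mx_u1_const mx_v2_const !map_mx1.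
apply: mulmx_unit4; [exact: tens_mx11 | exact: tens_mx11 |].
exact/const_quaternary/mul_flip_twist.
Qed.

End ConstantSolutions.

(* The generator with upper index r >= 1 and lower indices i, j is indexed by
   (r - 1, i, j). *)
Definition gen_index : Type := (nat * 'I_2 * 'I_2)%type.
HB.instance Definition _ := Countable.on gen_index.

Section Presentations.
Context (K : comNzRingType).
Local Notation F := (free_alg K gen_index).

(* The matrix with entries D_ij + \sum_(r >= 1) g_ij^(r) u^-r. *)
Definition gen_mx (D : 'M[K]_2) : 'M[{fps F}]_2 :=
  \matrix_(i, j) fun r =>
    if r is r'.+1 then free_gen K (r', i, j) else (D i j)%:A.

(* The elements that have to vanish for M = N to hold coefficientwise. *)
Definition relators1 m n (M N : 'M[{fps F}]_(m, n)) : set F :=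
  fun x => exists i j r, x = (M - N) i j r.
Definition relators2 m n (M N : 'M[{fps {fps F}}]_(m, n)) : set F :=
  fun x => exists i j r s, x = (M - N) i j s r.

(* (eps_1, eps_2) is (1, 1) for l = 0 and (1, -1) for l = 1. *)
Definition reflection_eps (l : nat) : 'M[K]_2 :=
  \matrix_(i, j) ((i == j)%:R * if (i < 2 - l)%N then 1 else -1).

Definition B_mx (l : nat) : 'M[{fps F}]_2 := gen_mx (reflection_eps l).

Definition reflection_relators (l : nat) : set F :=
  relators2 (reflection_lhs (B_mx l)) (reflection_rhs (B_mx l))
  `|` relators1 (B_mx l *m neg_mx (B_mx l)) 1%:M.

Definition S_mx : 'M[{fps F}]_2 := gen_mx 1%:M.

Definition twisted_relators (t : twist) : set F :=
  relators2 (quaternary_lhs t S_mx) (quaternary_rhs t S_mx)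
  `|` relators1 (symmetry_lhs t S_mx) (symmetry_rhs t S_mx).

(* Both presentations define non-zero algebras: mapping all generators to 0
   is a character. *)
Section Character.

Local Notation eps := (@free_eps K gen_index).
Local Notation eps1 := (map_fps eps).
Local Notation eps2 := (map_fps (map_fps eps)).

Lemma eps_proper (S : set F) : (forall x, S x -> eps x = 0) -> ~ ideal_span S 1.
Proof.
move=> epsS /(_ (fun x => eps x = 0)) eps1_0.
suff /eqP : eps 1 = 0 by rewrite rmorph1 oner_eq0.
apply: eps1_0; last exact: epsS.
split=> [|x y x0 y0|a x x0|a x x0].
- exact: rmorph0.
- by rewrite rmorphD /= x0 y0 addr0.
- by rewrite rmorphM /= x0 mulr0.
- by rewrite rmorphM /= x0 mul0r.
Qed.

Lemma eps_relators1 m n (M N : 'M_(m, n)) x :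
  map_mx eps1 M = map_mx eps1 N -> relators1 M N x -> eps x = 0.
Proof.
move=> eqMN [i [j [r ->]]].
have /(congr1 (fps_coef r)) : map_mx eps1 (M - N) i j = 0.
  by rewrite map_mxB eqMN subrr mxE.
by rewrite mxE.
Qed.

Lemma eps_relators2 m n (M N : 'M_(m, n)) x :
  map_mx eps2 M = map_mx eps2 N -> relators2 M N x -> eps x = 0.
Proof.
move=> eqMN [i [j [r [s ->]]]].
have /(congr1 (fun f => fps_coef r (fps_coef s f))) :
    map_mx eps2 (M - N) i j = 0.
  by rewrite map_mxB eqMN subrr mxE.
by rewrite mxE.
Qed.

Lemma eps_gen_mx D : map_mx eps1 (gen_mx D) = map_mx (@fpsC K) D.
Proof.
apply/matrixP=> i j; rewrite !mxE; apply/funext=> -[|r]; rewrite /map_fps.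
  exact: free_eps_scalar.
exact: free_eps_gen.
Qed.

Lemma neg_const_mx (D : 'M[K]_2) :
  neg_mx (map_mx (@fpsC K) D) = map_mx (@fpsC K) D.
Proof.
apply/matrixP=> i j; rewrite !mxE; apply/funext=> -[|r].
  by rewrite /fps_neg mul1r.
by rewrite /fps_neg mulr0.
Qed.

Lemma reflection_epsK l : reflection_eps l *m reflection_eps l = 1%:M.
Proof.
apply/matrixP=> i j; rewrite !mxE (bigD1 i) //= big1 ?addr0 => [|k ki].
  rewrite !mxE eqxx mul1r mulrCA [_ * (if _ then _ else _)](_ : _ = 1) ?mulr1 //.
  by case: ifP; rewrite ?mulrNN mulr1.
by rewrite !mxE eq_sym (negPf ki) !mul0r.
Qed.

Lemma reflection_proper l : ~ ideal_span (reflection_relators l) 1.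
Proof.
apply: eps_proper => x [rel_x|].
  apply: (eps_relators2 _ rel_x).
  apply: etrans (map_reflection_lhs eps _) _.
  apply: etrans _ (esym (map_reflection_rhs eps _)).
  by rewrite eps_gen_mx; apply/reflection_const/reflection_epsK.
apply: eps_relators1; rewrite map_mxM (map_neg_mx eps) eps_gen_mx neg_const_mx.
by rewrite -map_mxM reflection_epsK !map_mx1.
Qed.

Lemma twisted_proper t : ~ ideal_span (twisted_relators t) 1.
Proof.
apply: eps_proper => x [rel_x|rel_x].
  apply: (eps_relators2 _ rel_x).
  apply: etrans (map_quaternary_lhs eps _ _) _.
  apply: etrans _ (esym (map_quaternary_rhs eps _ _)).
  by rewrite eps_gen_mx; apply: quaternary_const.
apply: (eps_relators1 _ rel_x).
apply: etrans (map_symmetry_lhs eps _ _) _.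
apply: etrans _ (esym (map_symmetry_rhs eps _ _)); rewrite eps_gen_mx.
rewrite /symmetry_lhs /symmetry_rhs neg_const_mx subrr scaler0 addr0 map_mx1.
congr (_ *: _); apply/matrixP=> i j; rewrite !mxE eqxx.
by case: eqP => // _; rewrite mulr0.
Qed.

End Character.

(* B(2,l) *)
Definition reflection_algebra (l : nat) : algType K :=
  quot_alg (@reflection_proper l).

(* Y^+(2) and Y^-(2) *)
Definition twisted_yangian (t : twist) : algType K :=
  quot_alg (@twisted_proper t).

End Presentations.

(* Main.v *)
(* For n = 2 one has Q = 1 - P up to conjugation by K = diag(1, -1) in the orthogonal
   case (K = 1 in the symplectic one), so R^t(-u-v) is a multiple of R(u+v+1), and
   M(u) = S(u - 1/2) K satisfies the reflection equation.  That equation has two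
   degenerate points.  At v = -u it shows that M(u) M(-u) = f(u) is scalar; at
   v = u - 1 it shows that D(u) M(u - 1) = d(u) is scalar, where
   D(u) = (2 - u^-1) M(u)^t + u^-1 M(u).  Both series are central, because R(x) R(-x)
   is a scalar.  The symmetry relation for S says D(u) = sigma(u) M(1 - u) with
   sigma = 2 or 2 u^-1 - 2.

   So unitarity and symmetry only differ by a central normalization.  Given B with
   B(u) B(-u) = 1, let g(u)^2 = sigma(u) d(1 - u) / 4; since d(u) d(1 - u) = 4, the
   series g satisfies g(u) g(1 - u) = 1 and M = g B solves the symmetry relation.
   Given M, let h be the solution of h(u) = f(u - 1) h(u - 1); then h(u) h(1 - u) = 1
   and B = h M is unitary.  The two resulting morphisms are mutually inverse, because
   a series x(u) = x(u - 1) is constant and because 1 is the only square root of 1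
   with constant term 1. *)
Require Import Defs.
From HB Require Import structures.
From mathcomp Require Import all_boot all_order all_algebra reals complex.
From mathcomp Require Import boolp classical_sets ring mxtens finmap.
From mathcomp.multinomials Require Import monalg.

Set Implicit Arguments.
Unset Strict Implicit.
Unset Printing Implicit Defensive.

Import GRing.Theory Num.Theory.
Local Open Scope ring_scope.
Local Open Scope quotient_scope.

(** The algebras may have zero divisors, so the poles of R cannot be handled by dividing. R(x / p)
    is kept as the pair of scalars in x - p P, and a specialization of u and v is a ring morphism on
    [{fps {fps A}}]. The points v = - u and v = u - 1 are admissible because both send v^-1 to a
    multiple of u^-1. The specialized relation acquires common scalar factors, which cancel because
    their lowest coefficient is a nonzero number.

    A square root of the inverse of f would also make M unitary, f being even. The difference
    equation is preferred because its solution satisfies h(u) h(1 - u) = 1 as well, and the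
    comparison of the two morphisms rests on this. It is solvable only if f has no u^-1 term, which
    evenness provides. Centrality of f and d is first obtained against the coefficients of M; since
    these generate the algebra, it extends to all elements. *)

Lemma fpsM0 (A : nzRingType) (f g : {fps A}) : (f * g) 0%N = f 0%N * g 0%N.
Proof. by rewrite fpsME big_ord_recl big_ord0 addr0. Qed.

(** * Series over an algebra, with series of scalars acting on them *)

Section SeriesAlgebra.
Context (K : comNzRingType) (A : algType K).
Implicit Types (c d : {fps K}) (f g : {fps A}).

Definition fps_alg c : {fps A} := map_fps (in_alg A) c.

Lemma fps_algC c f : fps_alg c * f = f * fps_alg c.
Proof.
apply/funext=> n; rewrite [RHS]fps_mul_rev fpsME; apply: eq_bigr => i _.
by rewrite /fps_alg /map_fps /= mulr_algl mulr_algr.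
Qed.

(** This makes [{fps A}] an algebra over [{fps K}] and, applied twice, [{fps {fps A}}] an algebra
    over [{fps {fps K}}]. The coefficients of all relations thus lie in a commutative ring, where
    [ring] applies. *)
Definition fps_scale c f : {fps A} := fps_alg c * f.

Fact fps_scaleA c d f : fps_scale c (fps_scale d f) = fps_scale (c * d) f.
Proof. by rewrite /fps_scale /fps_alg rmorphM mulrA. Qed.
Fact fps_scale1 : left_id 1 fps_scale.
Proof. by move=> f; rewrite /fps_scale /fps_alg rmorph1 mul1r. Qed.
Fact fps_scaleDr : right_distributive fps_scale +%R.
Proof. by move=> c f g; rewrite /fps_scale mulrDr. Qed.
Fact fps_scaleDl f : {morph fps_scale^~ f : c d / c + d}.
Proof. by move=> c d; rewrite /fps_scale /fps_alg rmorphD mulrDl. Qed.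

HB.instance Definition _ := GRing.Zmodule_isLmodule.Build {fps K} {fps A}
  fps_scaleA fps_scale1 fps_scaleDr fps_scaleDl.

Fact fps_scaleAl c f g : c *: (f * g) = (c *: f) * g.
Proof. exact: mulrA. Qed.
HB.instance Definition _ :=
  GRing.Lmodule_isLalgebra.Build {fps K} {fps A} fps_scaleAl.

Fact fps_scaleAr c f g : c *: (f * g) = f * (c *: g).
Proof. by rewrite [LHS]mulrA fps_algC -mulrA. Qed.
HB.instance Definition _ :=
  GRing.Lalgebra_isAlgebra.Build {fps K} {fps A} fps_scaleAr.

Lemma fpsZE c f n : (c *: f) n = \sum_(i < n.+1) c i *: f (n - i)%N.
Proof.
rewrite [LHS]fpsME; apply: eq_bigr => i _.
by rewrite /fps_alg /map_fps /= mulr_algl.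
Qed.

Lemma fps_algE c : c%:A = map_fps (in_alg A) c.
Proof. exact: mulr1. Qed.

Lemma fps_alg_coef c n : (c%:A : {fps A}) n = (c n)%:A.
Proof. by rewrite fps_algE. Qed.

Lemma fpsXA : (fpsX : {fps K})%:A = fpsX :> {fps A}.
Proof. by rewrite fps_algE; apply/funext=> n; rewrite /map_fps rmorph_nat. Qed.

Lemma fpsC_scale (a : K) f n : (fpsC a *: f) n = a *: f n.
Proof.
rewrite fpsZE big_ord_recl subn0 big1 ?addr0 // => i _.
by rewrite /fpsC /= scale0r.
Qed.

Lemma fpsZ0 c f : (c *: f) 0%N = c 0%N *: f 0%N.
Proof. by rewrite fpsZE big_ord_recl big_ord0 addr0. Qed.

(** In order k + n the lowest coefficient of c meets f n, and every other term contains an earlier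
    coefficient of f. This replaces cancellation in a domain, which [A] need not be. *)
Lemma scale_inj_low c k :
  (forall j, (j < k)%N -> c j = 0) -> (forall a : A, c k *: a = 0 -> a = 0) ->
  forall f, c *: f = 0 -> f = 0.
Proof.
move=> c_low ck_inj f cf0; apply/funext=> n.
elim/ltn_ind: n => n IH; apply: ck_inj.
have /(congr1 (fps_coef (k + n)%N)) := cf0; rewrite /fps_coef fpsZE fps0E.
have ltk : (k < (k + n).+1)%N by rewrite ltnS leq_addr.
rewrite (bigD1 (Ordinal ltk)) //= addKn big1 ?addr0 // => i /negP ne.
case: (ltngtP i k) => [/c_low-> | ki | eik]; first exact: scale0r.
  rewrite IH ?scaler0 // ltn_subLR; last by rewrite -ltnS.
  by rewrite ltn_add2r.
by case: ne; apply/eqP/val_inj; exact: eik.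
Qed.

End SeriesAlgebra.

Section Filtration.
Context (A : nzRingType).
Implicit Types f g : {fps A}.

Definition fps_van k f := forall j, (j < k)%N -> f j = 0.

Lemma fps_vanM k l f g : fps_van k f -> fps_van l g -> fps_van (k + l) (f * g).
Proof.
move=> vf vg j ltj; rewrite fpsME big1 // => i _.
case: (ltnP i k) => [/vf->|le_k]; first by rewrite mul0r.
rewrite vg ?mulr0 // ltn_subLR; last by rewrite -ltnS.
by rewrite (leq_trans ltj) // leq_add2r.
Qed.

Lemma fps_vanX k f : fps_van 1 f -> fps_van k (f ^+ k).
Proof.
move=> vf; elim: k => [|k IH]; first by [].
by rewrite exprS -[k.+1]add1n; apply: fps_vanM.
Qed.

End Filtration.

(** * Substitution of one series variable into another *)

Section Evaluation.
Context (K : comNzRingType) (A : algType K) (rho : {fps K}).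
Local Notation zeta := (fpsX * rho : {fps K}).
Implicit Types F G : {fps {fps A}}.

Lemma zeta_van : fps_van 1 zeta.
Proof. by case=> // _; rewrite fpsM0 mul0r. Qed.

Lemma zetaX_van k f : fps_van k (zeta ^+ k *: f : {fps A}).
Proof.
move=> j ltj; rewrite fpsZE big1 // => i _.
by rewrite (fps_vanX zeta_van) ?scale0r // (leq_ltn_trans _ ltj) // -ltnS.
Qed.

(* v^-1 := u^-1 rho(u); the factor u^-1 makes the coefficientwise sums finite. *)
Definition fps_eval F : {fps A} :=
  fun m => \sum_(n < m.+1) (zeta ^+ n *: F n) m.

Lemma fps_eval_widen F m N : (m <= N)%N ->
  fps_eval F m = (\sum_(n < N.+1) zeta ^+ n *: F n) m.
Proof.
move=> le_mN; rewrite -[RHS]/(fps_coef m _) raddf_sum /=.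
rewrite [LHS](big_ord_widen_cond N.+1 xpredT (fun n => (zeta ^+ n *: F n) m)) //.
rewrite [LHS]big_mkcond /=; apply: eq_bigr => i _; case: ltnP => // lt_mi.
by rewrite /fps_coef zetaX_van.
Qed.

Fact fps_eval_is_zmod_morphism : zmod_morphism fps_eval.
Proof.
move=> F G; apply/funext=> m; rewrite fpsDE fpsNE -sumrB.
by apply: eq_bigr => n _; rewrite -[(F - G) n]/(F n - G n) scalerBr.
Qed.

Fact fps_eval_is_monoid_morphism : monoid_morphism fps_eval.
Proof.
split=> [|F G]; apply/funext=> m.
  rewrite /fps_eval big_ord_recl big1 ?addr0 => [|i _]; first by rewrite scale1r.
  by rewrite fps1E mulr0n scaler0.
have -> : (fps_eval F * fps_eval G) m =
    ((\sum_(n < m.+1) zeta ^+ n *: F n) *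
     (\sum_(n < m.+1) zeta ^+ n *: G n)) m.
  rewrite !fpsME; apply: eq_bigr => i _.
  by rewrite -!fps_eval_widen // ?leq_subr // -ltnS.
rewrite mulr_suml; under [X in _ = X m]eq_bigr do rewrite mulr_sumr.
pose t i k := zeta ^+ (i + k) *: (F i * G k).
(* The terms with i + k > m start beyond order m and drop out, which turns the square of summation
   into the triangle of the Cauchy product. *)
transitivity ((\sum_(i < m.+1) \sum_(k < m.+1 | (k <= m - i)%N) t i k) m); last first.
  rewrite -!/(fps_coef m _) !raddf_sum; apply: eq_bigr => i _.
  rewrite !raddf_sum big_mkcond; apply: eq_bigr => k _.
  rewrite -scalerAl -scalerAr scalerA -exprD -/(t i k).
  case: leqP => // lt_mik; apply/esym/(@zetaX_van (i + k)).
  by rewrite -ltn_subLR // -ltnS.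
rewrite (fps_eval_widen _ (leqnn m)) -!/(fps_coef m _); congr (fps_coef m _).
transitivity (\sum_(n < m.+1) \sum_(i < m.+1 | (i <= n)%N) t i (n - i)%N).
  apply: eq_bigr => n _; rewrite fpsME scaler_sumr.
  rewrite (big_ord_narrow_leq (leq_ord n)).
  by apply: eq_bigr => i _; rewrite /t /= subnKC // -ltnS.
rewrite (exchange_big_dep xpredT) //=; apply: eq_bigr => i _.
rewrite (big_ord_narrow_leq (leq_subr i m)).
have le_im : (i <= m)%N by rewrite -ltnS.
rewrite -(big_mkord (fun n => (i <= n)%N) (fun n => t i (n - i)%N)).
rewrite (big_cat_nat (n := i)) //=; last exact: leqW.
rewrite big_nat_cond big1 ?add0r => [|n /andP[/andP[_ lt] le]]; last first.
  by rewrite leqNgt lt in le.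
rewrite -{1}(add0n i) big_addn subSn // big_mkord.
by apply: eq_big => [n|n _]; rewrite ?leq_addl ?addnK.
Qed.

HB.instance Definition _ := GRing.isZmodMorphism.Build {fps {fps A}} {fps A}
  fps_eval fps_eval_is_zmod_morphism.
HB.instance Definition _ := GRing.isMonoidMorphism.Build {fps {fps A}} {fps A}
  fps_eval fps_eval_is_monoid_morphism.

Lemma fps_eval_in_u f : fps_eval (in_u f) = f.
Proof.
apply/funext=> m; rewrite /fps_eval big_ord_recl big1 ?addr0 => [|i _].
  by rewrite scale1r.
by rewrite /in_u /fpsC /= scaler0.
Qed.

Lemma fps_evalX : fps_eval fpsX = zeta%:A.
Proof.
apply/funext=> m; rewrite (fps_eval_widen _ (leqnSn m)).
rewrite big_ord_recl scaler0 add0r big_ord_recl expr1 big1 ?addr0 // => i _.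
by rewrite [fpsX _](_ : _ = 0) ?scaler0.
Qed.

(** Routed through two variables, so that multiplicativity is inherited from [fps_eval] and
    evaluating M(v) is a substitution by definition. *)
Definition fps_subst (f : {fps A}) : {fps A} := fps_eval (in_v f).

Fact fps_subst_is_zmod_morphism : zmod_morphism fps_subst.
Proof. by move=> f g; rewrite /fps_subst /in_v !rmorphB. Qed.
Fact fps_subst_is_monoid_morphism : monoid_morphism fps_subst.
Proof.
by split=> [|f g]; rewrite /fps_subst /in_v ?rmorph1 ?rmorphM.
Qed.
HB.instance Definition _ := GRing.isZmodMorphism.Build {fps A} {fps A}
  fps_subst fps_subst_is_zmod_morphism.
HB.instance Definition _ := GRing.isMonoidMorphism.Build {fps A} {fps A}
  fps_subst fps_subst_is_monoid_morphism.

Lemma fps_substX : fps_subst fpsX = zeta%:A.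
Proof. by rewrite /fps_subst /in_v -fps_evalX; congr fps_eval; exact: map_fpsX. Qed.

Lemma fps_substE f m : fps_subst f m = \sum_(n < m.+1) (zeta ^+ n) m *: f n.
Proof.
apply: eq_bigr => n _; rewrite fpsZE big_ord_recr /= subnn big1 ?add0r //.
by move=> i _; rewrite /in_v /map_fps /fpsC subn_eq0 leqNgt ltn_ord scaler0.
Qed.

Lemma fps_substC a : fps_subst (fpsC a) = fpsC a.
Proof.
apply/funext=> m; rewrite fps_substE big_ord_recl big1 ?addr0 => [|i _].
  by rewrite expr0 fps1E /fpsC; case: (m == 0%N); rewrite ?scale1r ?scale0r.
by rewrite /fpsC scaler0.
Qed.

End Evaluation.

Section EvaluationTheory.
Context (K : comNzRingType).

Lemma fps_split (A : nzRingType) (f : {fps A}) : f = fpsC (f 0%N) + fpsX * (fun n => f n.+1).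
Proof.
apply/funext=> -[|n]; rewrite fpsDE ?fpsM0 /fpsC /= ?mul0r ?addr0 //.
rewrite fpsME big_ord_recl mul0r add0r big_ord_recl mul1r subSS subn0.
by rewrite big1 ?addr0 ?add0r // => i _; rewrite mul0r.
Qed.

(** A morphism that sends u^-1 to a multiple of u^-1 is automatically continuous: writing f = f(0) +
    u^-1 f', the difference of the two morphisms vanishes to one more order at each step. *)
Lemma fps_morph_eq (B : nzRingType) (A : algType K) (rho : {fps K})
    (phi psi : {rmorphism {fps B} -> {fps A}}) :
  phi fpsX = (fpsX * rho)%:A -> psi fpsX = (fpsX * rho)%:A ->
  (forall b, phi (fpsC b) = psi (fpsC b)) -> phi =1 psi.
Proof.
move=> phiX psiX eqC f; apply/funext=> m; apply/eqP; rewrite -subr_eq0.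
suff vanN k : forall f, fps_van k (phi f - psi f).
  by apply/eqP; exact: (vanN m.+1 f m).
elim: k => [//|k IH] {}f; rewrite (fps_split f) !rmorphD !rmorphM /=.
rewrite phiX psiX eqC opprD addrACA subrr add0r -mulrBr -[k.+1]add1n.
apply: fps_vanM (IH _) => -[] // _.
by rewrite fps_alg_coef fpsM0 mul0r scale0r.
Qed.

Variable A : algType K.

Lemma fps_subst_comp (a b c : {fps K}) (f : {fps A}) :
  (fps_subst a (fpsX * b)%:A : {fps A}) = (fpsX * c)%:A ->
  fps_subst a (fps_subst b f) = fps_subst c f.
Proof.
move=> abc; apply: (@fps_morph_eq A A c (fps_subst a \o fps_subst b) (fps_subst c)).
- by rewrite /= fps_substX.
- exact: fps_substX.
- by move=> d; rewrite /= !fps_substC.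
Qed.

Lemma fps_subst1 (f : {fps A}) : fps_subst 1 f = f.
Proof.
apply: (@fps_morph_eq A A 1 (fps_subst 1) idfun).
- exact: fps_substX.
- by rewrite mulr1 fpsXA.
- by move=> d; apply: fps_substC.
Qed.

Fact fps_neg_is_zmod_morphism : zmod_morphism (@fps_neg A).
Proof. by move=> f g; apply/funext=> n; rewrite /fps_neg mulrBr. Qed.
Fact fps_neg_is_monoid_morphism : monoid_morphism (@fps_neg A).
Proof.
split=> [|f g]; apply/funext=> n; rewrite /fps_neg.
  by rewrite fps1E; case: eqP => [->|_]; rewrite ?expr0 ?mul1r ?mulr0.
rewrite !fpsME mulr_sumr; apply: eq_bigr => i _.
have le_in : (i <= n)%N by rewrite -ltnS.
rewrite -{1}(subnKC le_in) exprD -!mulrA; congr (_ * _).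
by rewrite !mulrA; congr (_ * _); apply/esym/commr_sign.
Qed.
HB.instance Definition _ := GRing.isZmodMorphism.Build {fps A} {fps A}
  (@fps_neg A) fps_neg_is_zmod_morphism.
HB.instance Definition _ := GRing.isMonoidMorphism.Build {fps A} {fps A}
  (@fps_neg A) fps_neg_is_monoid_morphism.

Lemma fps_negX : fps_neg (fpsX : {fps A}) = - fpsX.
Proof.
apply/funext=> n; rewrite fpsNE /fps_neg /fpsX.
by case: eqP => [->|_]; rewrite ?expr1 ?mulr1 ?mulr0 ?oppr0.
Qed.

Lemma fps_neg_subst (f : {fps A}) : fps_neg f = fps_subst (-1) f.
Proof.
apply: (@fps_morph_eq A A (-1) (@fps_neg A) (fps_subst (-1))).
- by rewrite [LHS]fps_negX mulrN1 scaleNr fpsXA.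
- exact: fps_substX.
- move=> a; rewrite /= fps_substC; apply/funext=> n; rewrite /= /fps_neg /fpsC.
  by case: eqP => [->|_]; rewrite ?mul1r ?mulr0.
Qed.

End EvaluationTheory.

Lemma map_fps_subst (K : comNzRingType) (A B : algType K) (h : {lrmorphism A -> B})
  rho (f : {fps A}) : map_fps h (fps_subst rho f) = fps_subst rho (map_fps h f).
Proof.
apply/funext=> m; rewrite [RHS]fps_substE /map_fps fps_substE rmorph_sum.
by apply: eq_bigr => i _; apply: linearZ_LR.
Qed.

Lemma map_fps_scale (K : comNzRingType) (A B : algType K) (h : {lrmorphism A -> B})
  (c : {fps K}) (f : {fps A}) : map_fps h (c *: f) = c *: map_fps h f.
Proof.
apply/funext=> m; rewrite [RHS]fpsZE /map_fps fpsZE rmorph_sum.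
by apply: eq_bigr => i _; apply: linearZ_LR.
Qed.

(** * A reflexive procedure for linear identities *)

Section LinearExpressions.
Context (C : comNzRingType) (V : lmodType C).

(** Entries of matrices do not commute, so [ring] cannot be used on them. The identities below are
    however linear in products of entries, and comparing the coefficient of each product leaves
    goals in the commutative ring [C]. *)
Inductive linexp :=
  Lzero | Lvar of nat | Ladd of linexp & linexp | Lopp of linexp
| Lscale of C & linexp.

Fixpoint lin_eval (s : seq V) e : V :=
  match e with
  | Lzero => 0
  | Lvar i => nth 0 s i
  | Ladd e1 e2 => lin_eval s e1 + lin_eval s e2
  | Lopp e1 => - lin_eval s e1
  | Lscale c e1 => c *: lin_eval s e1
  end.

Fixpoint lin_coef e (i : nat) : C :=
  match e with
  | Lzero => 0
  | Lvar j => if Nat.eqb i j then 1 else 0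
  | Ladd e1 e2 => lin_coef e1 i + lin_coef e2 i
  | Lopp e1 => - lin_coef e1 i
  | Lscale c e1 => c * lin_coef e1 i
  end.

Lemma lin_evalE s e : lin_eval s e = \sum_(i < size s) lin_coef e i *: nth 0 s i.
Proof.
elim: e => [|j|e1 IH1 e2 IH2|e1 IH1|c e1 IH1] /=.
- by rewrite big1 // => i _; rewrite scale0r.
- have [ltj|lej] := ltnP j (size s); last first.
    rewrite nth_default // big1 // => i _; case: PeanoNat.Nat.eqb_spec => [ij|_].
      by rewrite -ij leqNgt ltn_ord in lej.
    by rewrite scale0r.
  rewrite (bigD1 (Ordinal ltj)) //= PeanoNat.Nat.eqb_refl scale1r.
  rewrite big1 ?addr0 // => i /eqP ne.
  case: PeanoNat.Nat.eqb_spec => [ij|_]; last by rewrite scale0r.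
  by case: ne; apply: val_inj.
- by rewrite IH1 IH2 -big_split; apply: eq_bigr => i _; rewrite scalerDl.
- by rewrite IH1 -sumrN; apply: eq_bigr => i _; rewrite scaleNr.
- by rewrite IH1 scaler_sumr; apply: eq_bigr => i _; rewrite scalerA.
Qed.

Fixpoint lin_same n e1 e2 : Prop :=
  if n is n'.+1 then lin_coef e1 n' = lin_coef e2 n' /\ lin_same n' e1 e2
  else True.

Lemma lin_evalP s e1 e2 : lin_same (size s) e1 e2 -> lin_eval s e1 = lin_eval s e2.
Proof.
move=> same; rewrite !lin_evalE; apply: eq_bigr => i _; congr (_ *: _).
elim: (size s) same i => [_ []//|n IH /= [eqn /IH{}IH]] i.
have := ltn_ord i; rewrite ltnS leq_eqVlt => /orP[/eqP-> //|lti].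
exact: (IH (Ordinal lti)).
Qed.

End LinearExpressions.

Arguments Lzero {C}.
Arguments Lvar {C}.

(* Atoms are compared up to unification: the same product may be built from
   different projections of the structure of V. *)
Ltac lin_index x s :=
  match s with
  | ?y :: _ => let _ := match goal with _ => unify x y end in constr:(0%N)
  | _ :: ?s' => let i := lin_index x s' in constr:(S i)
  end.

Ltac lin_mem x s :=
  match s with
  | nil => constr:(false)
  | ?y :: _ => let _ := match goal with _ => unify x y end in constr:(true)
  | _ :: ?s' => lin_mem x s'
  end.

Ltac lin_atoms e s :=
  lazymatch e with
  | 0 => s
  | ?a + ?b => let s1 := lin_atoms a s in lin_atoms b s1
  | - ?a => lin_atoms a s
  | ?c *: ?a => lin_atoms a s
  | _ => lazymatch lin_mem e s with true => s | false => constr:(e :: s) end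
  end.

Ltac lin_reify C e s :=
  lazymatch e with
  | 0 => constr:(@Lzero C)
  | ?a + ?b => let r1 := lin_reify C a s in let r2 := lin_reify C b s in
               constr:(Ladd r1 r2)
  | - ?a => let r := lin_reify C a s in constr:(Lopp r)
  | ?c *: ?a => let r := lin_reify C a s in constr:(@Lscale C c r)
  | _ => let i := lin_index e s in constr:(@Lvar C i)
  end.

(* Equality of two C-linear combinations of the same atoms. *)
Ltac lin C :=
  lazymatch goal with
  | |- ?a = ?b :> ?T =>
    let s0 := lin_atoms a (@nil T) in
    let s := lin_atoms b s0 in
    let ra := lin_reify C a s in
    let rb := lin_reify C b s in
    apply: (@lin_evalP C _ s ra rb);
    cbn [lin_same lin_coef size PeanoNat.Nat.eqb];
    repeat (split; first by ring); exact I
  end.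

(** * The reflection equation for two matrices over an algebra *)

Notation i0 := (ord0 : 'I_2).
Notation i1 := (lift ord0 ord0 : 'I_2).

Lemma I2_ind (P : 'I_2 -> Prop) : P i0 -> P i1 -> forall i, P i.
Proof.
move=> P0 P1 [[|[|//]] lti].
- by rewrite (_ : Ordinal lti = i0) //; apply: val_inj.
- by rewrite (_ : Ordinal lti = i1) //; apply: val_inj.
Qed.

Lemma sum_I2 (V : nmodType) (F : 'I_2 -> V) : \sum_i F i = F i0 + F i1.
Proof. by rewrite !big_ord_recl big_ord0 addr0. Qed.

Section TensorEntries.
Context (E : nzRingType).
Implicit Types (x p : E) (M N : 'M[E]_2) (X Y : 'M[E]_(2 * 2)).
Local Notation ix a b := (mxtens_index (a, b)).

(** This is x R(x / p). Keeping numerator and denominator apart allows x = 0, the pole of R, where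
    the matrix becomes - p P. *)
Definition lincomb_flip x p : 'M[E]_(2 * 2) := x%:M - p *: flip_mx.

Lemma tens4P X Y :
  (forall a b c d, X (ix a b) (ix c d) = Y (ix a b) (ix c d)) -> X = Y.
Proof.
move=> eqXY; apply/matrixP => i j.
by case: (mxtens_indexP i) => a b; case: (mxtens_indexP j) => c d.
Qed.

Lemma mul_lincombl x p X a b k :
  (lincomb_flip x p *m X) (ix a b) k = x * X (ix a b) k - p * X (ix b a) k.
Proof.
rewrite mulmxBl mul_scalar_mx -scalemxAl !mxE; congr (_ - p * _).
by rewrite -mul_flip_mx !mxE.
Qed.

Lemma mul_lincombr x p X k c d :
  (X *m lincomb_flip x p) k (ix c d) = X k (ix c d) * x - X k (ix d c) * p.
Proof.
rewrite mulmxBr 2!mxE; congr (_ + _).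
  rewrite (bigD1 (ix c d)) //= mxE eqxx mulr1n big1 ?addr0 // => i ne.
  by rewrite mxE (negPf ne) mulr0.
rewrite 2!mxE; congr (- _); rewrite (bigD1 (ix d c)) //= mxE flip_mxE !eqxx mulr1.
rewrite big1 ?addr0 // => i; case: (mxtens_indexP i) => a b ne.
rewrite mxE flip_mxE; case: andP => [[/eqP ad /eqP bc]|_]; last by rewrite !mulr0.
by rewrite ad bc eqxx in ne.
Qed.

Lemma copy1E M a b c d : copy1 M (ix a b) (ix c d) = M a c *+ (b == d).
Proof. by rewrite tensmxE mxE mulr_natr. Qed.

Lemma copy2E M a b c d : copy2 M (ix a b) (ix c d) = M b d *+ (a == c).
Proof. by rewrite tensmxE mxE mulr_natl. Qed.

Lemma sum_ix (F : 'I_(2 * 2) -> E) : \sum_i F i = \sum_a \sum_b F (ix a b).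
Proof.
rewrite pair_big (reindex (fun x : 'I_2 * 'I_2 => mxtens_index x)).
  by apply: eq_bigr => -[a b].
exists (@mxtens_unindex 2 2) => x _; first exact: mxtens_indexK.
exact: mxtens_unindexK.
Qed.

Lemma mul_copy1l M X a b k : (copy1 M *m X) (ix a b) k = \sum_e M a e * X (ix e b) k.
Proof.
rewrite mxE sum_ix; apply: eq_bigr => e _; rewrite (bigD1 b) //= copy1E eqxx.
by rewrite big1 ?addr0 // => f /negPf; rewrite copy1E eq_sym => ->; rewrite mul0r.
Qed.

Lemma mul_copy2l M X a b k : (copy2 M *m X) (ix a b) k = \sum_e M b e * X (ix a e) k.
Proof.
rewrite mxE sum_ix (bigD1 a) //= [X in _ + X]big1 ?addr0 => [|f nf].
  by apply: eq_bigr => e _; rewrite copy2E eqxx.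
by rewrite big1 // => e _; rewrite copy2E eq_sym (negPf nf) mul0r.
Qed.

Lemma mul_copy2r M X k c d : (X *m copy2 M) k (ix c d) = \sum_e X k (ix c e) * M e d.
Proof.
rewrite mxE sum_ix (bigD1 c) //= [X in _ + X]big1 ?addr0 => [|f nf].
  by apply: eq_bigr => e _; rewrite copy2E eqxx.
by rewrite big1 // => e _; rewrite copy2E (negPf nf) mulr0.
Qed.

Lemma copy1_mul M N : copy1 M *m copy1 N = copy1 (M *m N).
Proof.
apply: tens4P => a b c d; rewrite mul_copy1l copy1E [X in _ = X *+ _]mxE -sumrMnl.
by apply: eq_bigr => e _; rewrite copy1E mulrnAr.
Qed.

Lemma copy2_mul M N : copy2 M *m copy2 N = copy2 (M *m N).
Proof.
apply: tens4P => a b c d; rewrite mul_copy2l copy2E [X in _ = X *+ _]mxE -sumrMnl.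
by apply: eq_bigr => e _; rewrite copy2E mulrnAr.
Qed.

Lemma copy12_comm M N : (forall i j k l, GRing.comm (M i j) (N k l)) ->
  copy1 M *m copy2 N = copy2 N *m copy1 M.
Proof.
move=> MN; apply: tens4P => a b c d; rewrite mul_copy1l mul_copy2l.
rewrite (bigD1 c) //= big1 ?addr0 => [|e ne]; last by rewrite copy2E (negPf ne) mulr0.
rewrite (bigD1 d) //= big1 ?addr0 => [|e ne]; last by rewrite copy1E (negPf ne) mulr0.
by rewrite copy1E copy2E !eqxx; apply: MN.
Qed.

Lemma copy1_scalar x : copy1 x%:M = x%:M.
Proof.
apply: tens4P => a b c d; rewrite copy1E !mxE (can_eq (@mxtens_indexK _ _)) xpair_eqE.
by case: (a == c); case: (b == d).
Qed.

(** M and N stand for M(u) and M(v), x / p for u - v and y / q for u + v up to a shift. Since they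
    are unrelated here, the relations for M(-u), M(u - 1) and D(u) against M(v) are instances
    too. *)
Definition reflection_eq x p y q M N :=
  lincomb_flip x p *m copy1 M *m lincomb_flip y q *m copy2 N =
  copy2 N *m lincomb_flip y q *m copy1 M *m lincomb_flip x p.

End TensorEntries.

Lemma map_lincomb_flip (E F : nzRingType) (phi : {rmorphism E -> F}) x p :
  map_mx phi (lincomb_flip x p) = lincomb_flip (phi x) (phi p).
Proof. by rewrite map_mxB map_scalar_mx map_mxZ map_flip_mx. Qed.

Lemma map_reflection_eq (E F : nzRingType) (phi : {rmorphism E -> F}) x p y q M N :
  reflection_eq x p y q M N ->
  reflection_eq (phi x) (phi p) (phi y) (phi q) (map_mx phi M) (map_mx phi N).
Proof.
move=> /(congr1 (map_mx phi)); rewrite /reflection_eq !map_mxM.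
by rewrite !map_lincomb_flip /copy1 /copy2 !map_mxT !map_mx1.
Qed.

Section AbstractReflection.
Context (C : comNzRingType) (E : algType C).
Implicit Types (x p y q : C) (M N D T : 'M[E]_2) (X Y : 'M[E]_(2 * 2)).
Local Notation ix a b := (mxtens_index (a, b)).
Local Notation refl x p y q M N :=
  (reflection_eq (x%:A : E) (p%:A : E) (y%:A : E) (q%:A : E) M N).
Local Notation lc x p := (lincomb_flip (x%:A : E) (p%:A : E)).

Definition scale_reg (c : C) := forall v : E, c *: v = 0 -> v = 0.

Lemma scale_regM (c d : C) : scale_reg c -> scale_reg d -> scale_reg (c * d).
Proof. by move=> rc rd v; rewrite -scalerA => /rc/rd. Qed.

Lemma scale_reg_eq (c : C) (u v : E) : scale_reg c -> c *: u = c *: v -> u = v.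
Proof.
by move=> rc /eqP; rewrite -subr_eq0 -scalerBr => /eqP/rc/eqP; rewrite subr_eq0 => /eqP.
Qed.

Definition refl_entry x p y q M (a b c d : 'I_2) : E :=
  (x * y) *: (M a c *+ (b == d)) - (x * q) *: (M a d *+ (b == c))
  - (p * y) *: (M b c *+ (a == d)) + (p * q) *: (M b d *+ (a == c)).

Lemma lc_copy1_lc x p y q M a b c d :
  (lc x p *m copy1 M *m lc y q) (ix a b) (ix c d) = refl_entry x p y q M a b c d.
Proof.
rewrite mul_lincombr !mul_lincombl !copy1E /refl_entry.
rewrite !mulr_algl !mulr_algr.
by case: (b == d); case: (a == d); case: (b == c); case: (a == c);
  rewrite ?mulr0n ?mulr1n; lin C.
Qed.

Lemma reflection_eqP x p y q M N :
  refl x p y q M N <->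
  forall a b c d,
    \sum_e refl_entry x p y q M a b c e * N e d =
    \sum_e N b e * refl_entry y q x p M a e c d.
Proof.
have Lent a b c d : (lc x p *m copy1 M *m lc y q *m copy2 N) (ix a b) (ix c d) =
    \sum_e refl_entry x p y q M a b c e * N e d.
  by rewrite mul_copy2r; apply: eq_bigr => e _; rewrite lc_copy1_lc.
have Rent a b c d : (copy2 N *m lc y q *m copy1 M *m lc x p) (ix a b) (ix c d) =
    \sum_e N b e * refl_entry y q x p M a e c d.
  by rewrite -!mulmxA mul_copy2l !mulmxA; apply: eq_bigr => e _; rewrite lc_copy1_lc.
split=> [eqR a b c d|eqR]; first by rewrite -Lent -Rent eqR.
by apply: tens4P => a b c d; rewrite Lent Rent.
Qed.

Lemma refl_entry_scale (c d : C) x p y q M i j k l :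
  refl_entry (c * x) (c * p) (d * y) (d * q) M i j k l =
  (c * d) *: refl_entry x p y q M i j k l.
Proof. by rewrite /refl_entry; lin C. Qed.

Lemma reflection_eq_scale (c d : C) x p y q M N : scale_reg c -> scale_reg d ->
  refl (c * x) (c * p) (d * y) (d * q) M N <-> refl x p y q M N.
Proof.
move=> rc rd; split=> /reflection_eqP eqR; apply/reflection_eqP => i j k l.
  apply: (@scale_reg_eq (c * d)); first exact: scale_regM.
  have := eqR i j k l; rewrite !sum_I2 !refl_entry_scale (mulrC d).
  by rewrite -!scalerAl -!scalerAr -!scalerDr.
rewrite !sum_I2 !refl_entry_scale (mulrC d) -!scalerAl -!scalerAr -!scalerDr.
by have := eqR i j k l; rewrite !sum_I2 => ->.
Qed.

End AbstractReflection.
Lemma rev_i0 : rev_ord i0 = i1. Proof. exact: val_inj. Qed.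
Lemma rev_i1 : rev_ord i1 = i0. Proof. exact: val_inj. Qed.

(** * The degenerate points of the reflection equation, and centrality *)

Section ReflectionIdentities.
Context (C : comNzRingType) (E : algType C).
Implicit Types (x p y q : C) (M N D T : 'M[E]_2) (X Y : 'M[E]_(2 * 2)).
Local Notation ix a b := (mxtens_index (a, b)).
Local Notation refl x p y q M N :=
  (reflection_eq (x%:A : E) (p%:A : E) (y%:A : E) (q%:A : E) M N).
Local Notation lc x p := (lincomb_flip (x%:A : E) (p%:A : E)).
Local Notation reg := (@scale_reg C E).

Let i01 : (i0 == i1) = false. Proof. by []. Qed.
Let i10 : (i1 == i0) = false. Proof. by []. Qed.
Let i00 : (i0 == i0) = true. Proof. by []. Qed.
Let i11 : (i1 == i1) = true. Proof. by []. Qed.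
Let entryE := (i01, i10, i00, i11, mulr0n, mulr1n).
Let expandE := (mulrDl, mulrDr, mulrBl, mulrBr, mulNr, mulrN).
Let zeroE := (mulr0, mul0r).

Ltac solve_entry rules :=
  rewrite ?sum_I2 /refl_entry ?rules !entryE ?expandE -?scalerAl -?scalerAr ?zeroE;
  lin C.

(* The relation at v = - u, where R(u + v) has its pole. *)
Lemma reflection_eq_unitary z M N : reg 2 -> reg (2 - z) -> refl 2 z 0 1 M N ->
  exists f : E, M *m N = f%:M /\ N *m M = f%:M.
Proof.
move=> r2 r2z /reflection_eqP eqR.
set F := M *m N; set G := N *m M.
have FE a d : F a d = M a i0 * N i0 d + M a i1 * N i1 d by rewrite [LHS]mxE sum_I2.
have GE a d : G a d = N a i0 * M i0 d + N a i1 * M i1 d by rewrite [LHS]mxE sum_I2.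
have H a b c d w : w = \sum_e N b e * refl_entry 0 1 2 z M a e c d -
    \sum_e refl_entry 2 z 0 1 M a b c e * N e d -> w = 0.
  by move=> ->; rewrite eqR subrr.
(* With y = 0 and q = 1 the middle R-matrix is - P, and the relation amounts to 2 (F_1 - G_2) = z
   (F_2 - G_2) P. Suitable entries of it give the claims one by one. *)
have F01 : F i0 i1 = 0 by apply: r2; apply: (H i0 i1 i1 i1); solve_entry (FE, GE).
have F10 : F i1 i0 = 0 by apply: r2; apply: (H i1 i0 i0 i0); solve_entry (FE, GE).
have FG00 : F i0 i0 = G i0 i0.
  by apply/eqP; rewrite -subr_eq0; apply/eqP/r2z/(H i0 i0 i0 i0); solve_entry (FE, GE).
have FG11 : F i1 i1 = G i1 i1.
  by apply/eqP; rewrite -subr_eq0; apply/eqP/r2z/(H i1 i1 i1 i1); solve_entry (FE, GE).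
have FG01 : F i0 i0 = G i1 i1.
  by apply/eqP; rewrite -subr_eq0; apply/eqP/r2/(H i0 i1 i1 i0); solve_entry (FE, GE).
have G01 : G i0 i1 = 0.
  have : (z - 2) *: G i0 i1 - z *: F i0 i1 = 0.
    by apply: (H i1 i0 i1 i1); solve_entry (FE, GE).
  by rewrite F01 scaler0 subr0 -opprB scaleNr => /eqP; rewrite oppr_eq0 => /eqP/r2z.
have G10 : G i1 i0 = 0.
  have : (z - 2) *: G i1 i0 - z *: F i1 i0 = 0.
    by apply: (H i0 i1 i0 i0); solve_entry (FE, GE).
  by rewrite F10 scaler0 subr0 -opprB scaleNr => /eqP; rewrite oppr_eq0 => /eqP/r2z.
exists (F i0 i0); split; apply/matrixP; do 2!elim/I2_ind;
  by rewrite [RHS]mxE !entryE // FG11.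
Qed.

(** The symplectic transpose of a 2 x 2 matrix is its adjugate tr(M) - M, so this is a quantum
    version of the adjugate, and its product with a shifted M is a quantum determinant. *)
Definition sklyanin_mx (a g : C) M : 'M[E]_2 :=
  a%:A *: twist_tr Symplectic M + g%:A *: M.

Lemma sklyanin_mxE (a g : C) M :
  [/\ sklyanin_mx a g M i0 i0 = a *: M i1 i1 + g *: M i0 i0,
      sklyanin_mx a g M i0 i1 = g *: M i0 i1 - a *: M i0 i1,
      sklyanin_mx a g M i1 i0 = g *: M i1 i0 - a *: M i1 i0 &
      sklyanin_mx a g M i1 i1 = a *: M i0 i0 + g *: M i1 i1].
Proof.
split; rewrite !mxE !entryE ?rev_i0 ?rev_i1 !mulr_algl // mulN1r scalerN addrC //.
Qed.

(* The relation at v = u - 1, where R(u - v) degenerates to 1 - P. *)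
Lemma reflection_eq_fusion (a g : C) M N : reg 2 -> refl 1 1 a g M N ->
  exists d : E, sklyanin_mx a g M *m N = d%:M.
Proof.
move=> r2 /reflection_eqP eqR.
have [D00 D01 D10 D11] := sklyanin_mxE a g M.
(* The right-hand side ends with 1 - P, so its entries in the columns (k, l) and (l, k) cancel. *)
have H k l : \sum_e refl_entry 1 1 a g M i0 i1 k e * N e l +
             \sum_e refl_entry 1 1 a g M i0 i1 l e * N e k = 0.
  rewrite !eqR -big_split big1 // => e _; rewrite /= -mulrDr.
  rewrite [X in _ * X](_ : _ = 0) ?mulr0 // /refl_entry.
  by case: (e == l); case: (e == k); case: (i0 == k); case: (i0 == l);
    rewrite ?entryE; lin C.
set X := _ *m N.
have XE k l : X k l = sklyanin_mx a g M k i0 * N i0 l + sklyanin_mx a g M k i1 * N i1 l.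
  by rewrite [LHS]mxE sum_I2.
have X10 : X i1 i0 = 0.
  by apply: r2; rewrite -[RHS](H i0 i0); solve_entry (XE, D10, D11).
have X01 : X i0 i1 = 0.
  apply: r2; rewrite -[LHS]opprK; apply/eqP; rewrite oppr_eq0; apply/eqP.
  by rewrite -[RHS](H i1 i1); solve_entry (XE, D00, D01).
have X11 : X i1 i1 = X i0 i0.
  apply/eqP; rewrite -subr_eq0; apply/eqP.
  by rewrite -[RHS](H i0 i1); solve_entry (XE, D00, D01, D10, D11).
by exists (X i0 i0); apply/matrixP; do 2!elim/I2_ind; rewrite [RHS]mxE !entryE.
Qed.

(** Partial symplectic transposition in the first factor turns P into 1 - P. The combination [tw] of
    it with the identity touches the first factor only, hence passes through N, and it carries R M_1
    R to R' D_1 R'. The new parameters (y - p) / (- p) and (x - p) / (- p) are 1 - (u + v) and 1 -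
    (u - v): with respect to M(v), the matrix D(u) behaves like M(1 - u). *)
Lemma reflection_eq_sklyanin x p y M N : refl x p y p M N ->
  refl (y - p) (- p) (x - p) (- p) (sklyanin_mx (x + y - p) p M) N.
Proof.
move=> /reflection_eqP eqR; apply/reflection_eqP.
set D := sklyanin_mx _ _ M.
have [D00 D01 D10 D11] := sklyanin_mxE (x + y - p) p M.
pose tw (T : 'I_2 -> 'I_2 -> 'I_2 -> 'I_2 -> E) a b c d :=
  (x + y - p) *: (if a == c then T (rev_ord a) b (rev_ord a) d else - T a b c d) +
  p *: T a b c d.
have key a b c d :
    refl_entry (y - p) (- p) (x - p) (- p) D a b c d = tw (refl_entry x p y p M) a b c d.
  elim/I2_ind: a; elim/I2_ind: b; elim/I2_ind: c; elim/I2_ind: d;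
  rewrite /tw /refl_entry ?D00 ?D01 ?D10 ?D11 !entryE ?rev_i0 ?rev_i1 ?entryE; lin C.
have key' a b c d :
    refl_entry (x - p) (- p) (y - p) (- p) D a b c d = tw (refl_entry y p x p M) a b c d.
  elim/I2_ind: a; elim/I2_ind: b; elim/I2_ind: c; elim/I2_ind: d;
  rewrite /tw /refl_entry ?D00 ?D01 ?D10 ?D11 !entryE ?rev_i0 ?rev_i1 ?entryE; lin C.
have twl (W : 'I_2 -> 'I_2 -> 'I_2 -> 'I_2 -> E) a b c d : \sum_e tw W a b c e * N e d =
    tw (fun a b c d => \sum_e W a b c e * N e d) a b c d.
  rewrite /tw !sum_I2; case: (a == c);
  by rewrite !expandE -!scalerAl ?mulNr; lin C.
have twr (W : 'I_2 -> 'I_2 -> 'I_2 -> 'I_2 -> E) a b c d : \sum_e N b e * tw W a e c d =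
    tw (fun a b c d => \sum_e N b e * W a e c d) a b c d.
  rewrite /tw !sum_I2; case: (a == c);
  by rewrite !expandE -!scalerAr ?mulrN; lin C.
move=> a b c d; under eq_bigr do rewrite key; under [RHS]eq_bigr do rewrite key'.
by rewrite twl twr /tw !eqR.
Qed.

End ReflectionIdentities.
(** The product X D Y Y' T X' N is evaluated twice: collapsing Y Y', D T and X X' gives xi eta d N,
    and moving N to the left through both relations first gives xi eta N d. *)
Lemma fused_ring_comm (R : pzRingType) (X D Y N X' T Y' d xi eta : R) :
  X * D * Y * N = N * Y * D * X -> Y' * T * X' * N = N * X' * T * Y' ->
  X * X' = xi -> Y * Y' = eta -> D * T = d ->
  GRing.comm d X -> GRing.comm d Y ->
  (forall r, GRing.comm xi r) -> (forall r, GRing.comm eta r) ->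
  xi * eta * (d * N) = xi * eta * (N * d).
Proof.
move=> eq1 eq2 XX YY DT dX dY xiC etaC.
have L : X * D * Y * (Y' * T * X' * N) = xi * eta * (d * N).
  transitivity (X * D * eta * T * X' * N); first by rewrite -YY !mulrA.
  rewrite -[X * D * eta]etaC.
  have -> : eta * (X * D) * T * X' * N = eta * (X * (D * T) * X') * N by rewrite !mulrA.
  by rewrite DT -dX -(mulrA d) XX -(xiC d) !mulrA (etaC xi).
have -> : xi * eta * (N * d) = X * D * Y * N * X' * T * Y'.
  rewrite eq1.
  have -> : N * Y * D * X * X' * T * Y' = N * Y * D * (X * X') * T * Y' by rewrite !mulrA.
  rewrite XX -[N * Y * D * xi]xiC.
  have -> : xi * (N * Y * D) * T * Y' = xi * (N * (Y * (D * T) * Y')) by rewrite !mulrA.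
  by rewrite DT -dY -(mulrA d) YY (mulrA N) -[N * d * eta]etaC !mulrA.
by rewrite -L eq2 !mulrA.
Qed.

Section FusedScalar.
Context (C : comNzRingType) (E : algType C).
Implicit Types (x p y q : C) (M N D T : 'M[E]_2) (X Y : 'M[E]_(2 * 2)).
Local Notation ix a b := (mxtens_index (a, b)).
Local Notation refl x p y q M N :=
  (reflection_eq (x%:A : E) (p%:A : E) (y%:A : E) (q%:A : E) M N).
Local Notation lc x p := (lincomb_flip (x%:A : E) (p%:A : E)).
Local Notation reg := (@scale_reg C E).

Let scalar_ixE (d : E) a b c e :
  (d%:M : 'M[E]_(2 * 2)) (ix a b) (ix c e) = d *+ ((a == c) && (b == e)).
Proof. by rewrite mxE (can_eq (@mxtens_indexK _ _)) xpair_eqE. Qed.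

Let lc_scalar x p (d : E) : d%:M *m lc x p = lc x p *m d%:M.
Proof.
apply: tens4P => a b c e; rewrite mul_lincombr mul_lincombl !mulr_algl !mulr_algr.
by rewrite !scalar_ixE [(b == c) && _]andbC.
Qed.

Let lcE x p a b c d : lc x p (ix a b) (ix c d) =
  x *: (1 *+ ((a == c) && (b == d))) - p *: (1 *+ ((a == d) && (b == c))).
Proof. by rewrite mxE [X in _ + X]mxE [X in _ - X]mxE scalar_ixE flip_mxE mulr_algl
  scalerMnr. Qed.

Lemma lincomb_flip_mul x p x' p' :
  lc x p *m lc x' p' = lc (x * x' + p * p') (x * p' + p * x').
Proof.
apply: tens4P => a b c d; rewrite mul_lincombl !mulr_algl !lcE.
case: (a == c); case: (a == d); case: (b == c); case: (b == d);
  rewrite /= ?mulr0n ?mulr1n; lin C.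
Qed.

Lemma lincomb_flipN x p : lc x p *m lc x (- p) = (x ^+ 2 - p ^+ 2)%:A%:M.
Proof.
rewrite lincomb_flip_mul (_ : x * - p + p * x = 0); last by ring.
rewrite /lincomb_flip !scale0r subr0; congr (_%:A%:M); ring.
Qed.


Lemma mulmx_scalarE (A : nzRingType) m n (X : 'M[A]_(m, n)) (a : A) k l :
  (X *m a%:M) k l = X k l * a.
Proof.
rewrite mxE (bigD1 l) //= mxE eqxx mulr1n big1 ?addr0 // => i ne.
by rewrite mxE (negPf ne) mulr0.
Qed.

Lemma scalar_algC n (c : C) (X : 'M[E]_n) : c%:A%:M *m X = X *m c%:A%:M.
Proof.
rewrite mul_scalar_mx; apply/matrixP => k l.
by rewrite mulmx_scalarE mxE mulr_algl mulr_algr.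
Qed.

(* This gives the centrality both of the scalar at v = - u and of the one at v = u - 1. *)
Lemma fused_scalar_comm x p y q D T N (d : E) :
  reg (x ^+ 2 - p ^+ 2) -> reg (y ^+ 2 - q ^+ 2) ->
  refl x p y q D N -> refl y (- q) x (- p) T N -> D *m T = d%:M ->
  forall i j, d * N i j = N i j * d.
Proof.
move=> rx ry eq1 eq2 DT i j.
have DT1 : copy1 D *m copy1 T = d%:M by rewrite copy1_mul DT copy1_scalar.
have : ((x ^+ 2 - p ^+ 2)%:A * (y ^+ 2 - q ^+ 2)%:A)%:M *m (d%:M *m copy2 N) =
    ((x ^+ 2 - p ^+ 2)%:A * (y ^+ 2 - q ^+ 2)%:A)%:M *m (copy2 N *m d%:M).
  rewrite scalar_mxM.
  exact: (@fused_ring_comm 'M[E]_(2 * 2) _ _ _ _ _ _ _ _ _ _ eq1 eq2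
    (lincomb_flipN x p) (lincomb_flipN y q) DT1 (lc_scalar x p d) (lc_scalar y q d)
    (scalar_algC _) (scalar_algC _)).
move=> /(congr1 (fun X : 'M_(2 * 2) => X (ix i0 i) (ix i0 j))).
rewrite !mul_scalar_mx mxE [X in _ * X]mxE [RHS]mxE mulmx_scalarE.
rewrite !copy2E eqxx !mulr1n => eqN; apply: scale_reg_eq (scale_regM rx ry) _.
have sE (a b : C) (u : E) : a%:A * b%:A * u = (a * b) *: u.
  by rewrite -mulrA !mulr_algl scalerA.
exact: etrans (esym (sE _ _ _)) (etrans eqN (sE _ _ _)).
Qed.

Lemma fused_scalar_commN x p y q D T N (d : E) :
  reg (x ^+ 2 - p ^+ 2) -> reg (y ^+ 2 - q ^+ 2) ->
  refl x (- p) y (- q) D N -> refl y q x p T N -> D *m T = d%:M ->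
  forall i j, d * N i j = N i j * d.
Proof.
by move=> rx ry eq1 eq2; apply: (fused_scalar_comm _ _ eq1); rewrite ?sqrrN ?opprK.
Qed.

End FusedScalar.

(** * From the quaternary relation to the reflection equation *)

Lemma twisted_ring_eq (R : pzRingType) (X S1 S2 L k1 k2 : R) :
  k1 * k1 = 1 -> k2 * k2 = 1 -> GRing.comm k1 k2 -> GRing.comm k1 S2 ->
  GRing.comm k2 S1 -> GRing.comm (k1 * k2) X -> GRing.comm (k1 * k2) L ->
  X * S1 * (k1 * L * k1) * S2 = S2 * (k1 * L * k1) * S1 * X <->
  X * (S1 * k1) * L * (S2 * k2) = S2 * k2 * L * (S1 * k1) * X.
Proof.
move=> k11 k22 k12 kS2 kS1 kX kL.
(* Both sides are multiplied on the right by the involution k1 k2. The product commutes with X and L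
   even when k1 and k2 separately do not. *)
have lhsE : X * S1 * (k1 * L * k1) * S2 * (k1 * k2) = X * (S1 * k1) * L * (S2 * k2).
  by rewrite !mulrA -(mulrA _ S2 k1) -kS2 mulrA -(mulrA _ k1 k1) k11 mulr1.
have rhsE : S2 * (k1 * L * k1) * S1 * X * (k1 * k2) = S2 * k2 * L * (S1 * k1) * X.
  rewrite -(mulrA _ X) -kX !mulrA -(mulrA _ S1 k1) -(mulrA _ (S1 * k1)) -(mulrA S1) k12.
  rewrite (mulrA S1) -kS1 !mulrA; congr (_ * _ * _ * _).
  rewrite -!mulrA; congr (_ * _); rewrite -kL !mulrA k11 mul1r //.
have kk : k1 * k2 * (k1 * k2) = 1 by rewrite mulrA -(mulrA k1) -k12 mulrA k11 mul1r.
rewrite -lhsE -rhsE; split=> [-> //|eqk].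
rewrite -[LHS]mulr1 -[RHS]mulr1 -kk [LHS](mulrA _ (k1 * k2)).
by rewrite [RHS](mulrA _ (k1 * k2)) eqk.
Qed.

(** The matrix K of the overview. It is also the constant term of B(u), which decides which l goes
    with which twist. *)
Definition twist_diag (E : nzRingType) (t : twist) : 'M[E]_2 :=
  \matrix_(i, j) ((if t is Orthogonal then (-1) ^+ (i == i1) else 1) *+ (i == j)).

Lemma map_twist_diag (E F : nzRingType) (g : {rmorphism E -> F}) t :
  map_mx g (twist_diag E t) = twist_diag F t.
Proof.
apply/matrixP=> i j; rewrite !mxE rmorphMn.
by case: t => //; rewrite ?rmorph_sign ?rmorph1.
Qed.

Section TwistedFlip.
Context (E : nzRingType) (t : twist).
Local Notation ix a b := (mxtens_index (a, b)).
Local Notation k := (twist_diag E t).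

Lemma twist_diagK : k *m k = 1%:M.
Proof.
apply/matrixP; do 2!elim/I2_ind; rewrite !mxE sum_I2 !mxE /=;
  case: t; rewrite ?mulr0n ?mulr1n ?(mul0r, mulr0) ?mulrNN ?mulr1 ?addr0 ?add0r //.
Qed.

Lemma twist_diag_comm i j (a : E) : GRing.comm (k i j) a.
Proof.
rewrite mxE; apply/commr_sym/commrMn.
by case: t; [apply: commr_sign | apply: commr1].
Qed.

Lemma twist_flip_mxE : twist_flip_mx E t = 1%:M - copy1 k *m flip_mx *m copy1 k.
Proof.
have QE a b c d : twist_flip_mx E t (ix a b) (ix c d) = twist_tr t (delta_mx d b) a c.
  rewrite /twist_flip_mx summxE (bigD1 d) //= summxE (bigD1 b) //= tensmxE.
  rewrite [delta_mx b d b d]mxE !eqxx mulr1 !big1 ?addr0 => [//|i ne|j ne].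
  - rewrite summxE big1 // => j _; rewrite tensmxE [X in _ * X]mxE.
    by rewrite (eq_sym d) (negPf ne) andbF mulr0.
  - by rewrite tensmxE [X in _ * X]mxE (eq_sym b) (negPf ne) mulr0.
apply: tens4P => a b c d; rewrite QE [RHS]mxE [X in X + _]mxE [X in _ + X]mxE (can_eq
  (@mxtens_indexK _ _)) xpair_eqE.
rewrite -mulmxA [X in _ - X]mul_copy1l sum_I2 !mul_flip_mx !copy1E !mxE.
case: t; elim/I2_ind: a; elim/I2_ind: b; elim/I2_ind: c; elim/I2_ind: d => /=;
rewrite ?rev_i0 ?rev_i1 /= ?(mulr0n, mulr1n, mul0r, mulr0, addr0, add0r, mulr1, mulrNN,
  subr0, subrr, mulN1r, oppr0) //;
by rewrite ?expr0 ?mul1r expr1 opprK.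
Qed.

End TwistedFlip.

Section TwistedReflection.
Context (C : comNzRingType) (E : algType C) (t : twist).
Implicit Types (x p y : C) (S T : 'M[E]_2).
Local Notation lc x p := (lincomb_flip (x%:A : E) (p%:A : E)).
Local Notation k := (twist_diag E t).

(** Inserting Q = 1 - K_1 P K_1 into y + p Q gives y + p - p K_1 P K_1; the extra p is the shift of
    u + v by 1. *)
Lemma quaternary_eqP x p y S T :
  lc x p *m copy1 S *m (y%:A%:M + p%:A *: twist_flip_mx E t) *m copy2 T =
  copy2 T *m (y%:A%:M + p%:A *: twist_flip_mx E t) *m copy1 S *m lc x p <->
  reflection_eq (x%:A : E) (p%:A : E) ((y + p)%:A : E) (p%:A : E) (S *m k) (T *m k).
Proof.
have comm_lc x' p' : (copy1 k *m copy2 k) *m lc x' p' = lc x' p' *m (copy1 k *m copy2 k).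
  rewrite mulmxBr mulmxBl -scalar_algC; congr (_ - _).
  rewrite -!mul_scalar_mx mulmxA -scalar_algC -!mulmxA; congr (_ *m _).
  rewrite [RHS]mulmxA mul_flip_copy1 -[RHS]mulmxA mul_flip_copy2 !mulmxA; congr (_ *m _).
  by rewrite -copy12_comm // => *; apply: twist_diag_comm.
have k11 : copy1 k *m copy1 k = 1%:M by rewrite copy1_mul twist_diagK copy1_scalar.
have k22 : copy2 k *m copy2 k = 1%:M by rewrite copy2_mul twist_diagK; apply: tens_mx11.
have -> : y%:A%:M + p%:A *: twist_flip_mx E t =
    copy1 k *m lc (y + p) p *m copy1 k :> 'M[E]_(2 * 2).
  rewrite mulmxBr mulmxBl -scalar_algC -(mulmxA _%:M) k11 mulmx1.
  rewrite -[_ *: flip_mx]mul_scalar_mx mulmxA -scalar_algC -!mulmxA mul_scalar_mx.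
  rewrite twist_flip_mxE -mulmxA scalerBr addrA; congr (_ - _).
  by rewrite -mul_scalar_mx mulmx1 scalerDl raddfD.
rewrite /reflection_eq -!copy1_mul -!copy2_mul.
apply: (@twisted_ring_eq 'M[E]_(2 * 2)) => //.
- by apply: copy12_comm => *; apply: twist_diag_comm.
- by apply: copy12_comm => *; apply: twist_diag_comm.
- by apply/esym/copy12_comm => *; apply/commr_sym/twist_diag_comm.
- exact: comm_lc.
- exact: comm_lc.
Qed.

End TwistedReflection.

(** * Translations of the variable u *)

Definition geometric (K : comNzRingType) (c : K) : {fps K} := fun n => c ^+ n.

Lemma geometricE (K : comNzRingType) (c : K) :
  (1 - fpsC c * fpsX) * geometric c = 1.
Proof.
rewrite mulrBl mul1r -mulrA; apply/funext=> n; rewrite fpsDE fpsNE fps1E.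
rewrite [(fpsC c * _) n](_ : _ = c * (fpsX * geometric c) n); last first.
  rewrite fpsME big_ord_recl subn0 big1 ?addr0 // => i _.
  by rewrite /fpsC /= mul0r.
case: n => [|n]; first by rewrite fpsM0 !mul0r mulr0 subr0.
rewrite [(fpsX * _) _](_ : _ = geometric c n); first by rewrite -exprS subrr.
rewrite fpsME big_ord_recl mul0r add0r big_ord_recl mul1r subSS subn0.
by rewrite big1 ?addr0 // => i _; rewrite mul0r.
Qed.

Section Shift.
Context (K : comNzRingType) (A : algType K).
Implicit Types (c a b : K) (f : {fps A}).

(* f(u) |-> f(u - c) *)
Definition fps_shift c f : {fps A} := fps_subst (geometric c) f.

HB.instance Definition _ c :=
  GRing.RMorphism.copy (fps_shift c) (fps_subst (geometric c)).

(** The expansion of (u - c)^-1, that is, the image of u^-1 under u -> u - c. *)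
Definition zeta c : {fps K} := fpsX * geometric c.

Lemma zetaE c : (1 - fpsC c * fpsX) * zeta c = fpsX.
Proof. by rewrite /zeta mulrCA geometricE mulr1. Qed.

Lemma fps_shiftX c : fps_shift c fpsX = (zeta c)%:A.
Proof. exact: fps_substX. Qed.

Lemma fps_shiftC c (a : A) : fps_shift c (fpsC a) = fpsC a.
Proof. exact: fps_substC. Qed.

Lemma fpsC_alg c : (fpsC c)%:A = fpsC c%:A :> {fps A}.
Proof. by apply/funext=> n; rewrite fps_alg_coef /fpsC; case: eqP => //; rewrite scale0r. Qed.

Lemma fps_algM (c d : {fps K}) : (c * d)%:A = c%:A * d%:A :> {fps A}.
Proof. by rewrite mulr_algl scalerA. Qed.

Lemma fps_algB (c d : {fps K}) : (c - d)%:A = c%:A - d%:A :> {fps A}.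
Proof. exact: scalerBl. Qed.

Lemma fps_shift_zeta a b : fps_shift a (zeta b)%:A = (zeta (a + b))%:A.
Proof.
have : fps_shift a ((1 - fpsC b * fpsX)%:A * (zeta b)%:A) = (zeta a)%:A.
  by rewrite -fps_algM zetaE fpsXA fps_shiftX.
rewrite rmorphM fps_algB fps_algM scale1r fpsC_alg fpsXA rmorphB rmorphM rmorph1.
rewrite /= fps_shiftC fps_shiftX => eqS.
have : ((1 - fpsC a * fpsX) * (1 - fpsC b * zeta a)) *: fps_shift a (zeta b)%:A =
    (1 - fpsC (a + b) * fpsX) *: (zeta (a + b))%:A.
  rewrite -scalerA -[X in _ *: X]mulr_algl fps_algB fps_algM scale1r fpsC_alg eqS.
  by rewrite !scalerA !zetaE.
have -> : (1 - fpsC a * fpsX) * (1 - fpsC b * zeta a) = 1 - fpsC (a + b) * fpsX.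
  rewrite mulrBr mulr1 [fpsC b * _]mulrC mulrA zetaE raddfD mulrDl opprD addrA.
  by rewrite (mulrC fpsX).
move=> /(congr1 (fun h => geometric (a + b) *: h)).
by rewrite 2!scalerA mulrC geometricE !scale1r.
Qed.

Lemma fps_shift_shift a b f : fps_shift a (fps_shift b f) = fps_shift (a + b) f.
Proof. by apply: fps_subst_comp; exact: fps_shift_zeta. Qed.

Lemma fps_shift0 f : fps_shift 0 f = f.
Proof.
rewrite /fps_shift (_ : geometric 0 = 1) ?fps_subst1 //.
by apply/funext=> n; rewrite fps1E /geometric expr0n.
Qed.

Lemma fps_negK : involutive (@fps_neg A).
Proof. by move=> f; apply/funext=> n; rewrite /fps_neg mulrA -exprMn_comm ?mulrNN ?mulr1
  ?expr1n ?mul1r //; exact: commrN1. Qed.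

Lemma fps_neg_alg (c : {fps K}) : fps_neg (c%:A : {fps A}) = (fps_neg c)%:A.
Proof.
apply/funext=> n; rewrite fps_alg_coef /fps_neg fps_alg_coef.
by rewrite -[RHS]/(in_alg A _) rmorphM rmorph_sign.
Qed.

Lemma fps_neg_zeta c : fps_neg (zeta c) = - zeta (- c).
Proof.
apply/funext=> -[|n]; rewrite fpsNE /fps_neg /zeta ?fpsM0 ?mul0r ?mulr0 ?oppr0 //.
have XE (f : {fps K}) : (fpsX * f) n.+1 = f n.
  rewrite fpsME big_ord_recl mul0r add0r big_ord_recl mul1r subSS subn0.
  by rewrite big1 ?addr0 // => i _; rewrite mul0r.
by rewrite !XE /geometric exprS mulN1r mulNr -exprMn mulN1r.
Qed.

Lemma fps_neg_shift c f : fps_neg (fps_shift c f) = fps_shift (- c) (fps_neg f).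
Proof.
apply: (@fps_morph_eq K A A (- geometric (- c)) (@fps_neg A \o fps_shift c)
  (fps_shift (- c) \o @fps_neg A)).
- by rewrite /= fps_shiftX fps_neg_alg fps_neg_zeta mulrN.
- by rewrite /= fps_negX rmorphN /= fps_shiftX mulrN scaleNr.
- have negC (b : A) : fps_neg (fpsC b) = fpsC b.
    by apply/funext=> n; rewrite /fps_neg /fpsC; case: eqP => [->|_]; rewrite ?mul1r ?mulr0.
  by move=> b; rewrite /= negC !fps_shiftC negC.
Qed.

End Shift.

(** * The reflection equation for series *)

Lemma fpsC_mull (A : nzRingType) (a : A) (f : {fps A}) n : (fpsC a * f) n = a * f n.
Proof.
rewrite fpsME big_ord_recl subn0 big1 ?addr0 // => i _.
by rewrite /fpsC /= mul0r.
Qed.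

Lemma fpsC_mulr (A : nzRingType) (a : A) (f : {fps A}) n : (f * fpsC a) n = f n * a.
Proof.
rewrite [LHS]fps_mul_rev big_ord_recl subn0 big1 ?addr0 // => i _.
by rewrite /fpsC /= mulr0.
Qed.

Section SeriesReflection.
Context (K : comNzRingType) (A : algType K).
Local Notation E1 := {fps A}.
Local Notation E2 := {fps {fps A}}.
Local Notation z := (fpsX : {fps K}).
Local Notation U := (uV K).
Local Notation V := (vV K).
Implicit Types (M : 'M[E1]_2) (f : E1).

Lemma uV_alg : uV A = U%:A.
Proof.
rewrite fps_algE; apply/funext=> n; rewrite /uV /in_u /map_fps /fpsC /=.
by case: (n == 0%N); rewrite ?scale0r ?fpsXA.
Qed.

Lemma vV_alg : vV A = V%:A.
Proof.
rewrite fps_algE; apply/funext=> n; rewrite /vV /in_v /map_fps /=.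
by rewrite fpsC_alg; congr fpsC; rewrite -fpsXA fps_alg_coef.
Qed.

(* R(u - v) M_1(u) R(u + v + a) M_2(v) = M_2(v) R(u + v + a) M_1(u) R(u - v), with
   its denominators cleared.  For n = 2 the twisted relation is the case a = 1, up to
   the factor [twist_diag]. *)
Definition reflection_series (a : bool) M :=
  reflection_eq (V - U)%:A (U * V)%:A (V + U + (U * V) *+ a)%:A (U * V)%:A
    (map_mx (@in_u A) M) (map_mx (@in_v A) M).

Lemma reflection_seriesP M :
  reflection_lhs M = reflection_rhs M <-> reflection_series false M.
Proof.
rewrite /reflection_series mulr0n addr0 fps_algB fps_algM scalerDl -uV_alg -vV_alg.
rewrite /reflection_lhs /reflection_rhs /R_minus /R_plus /mx_u1 /mx_v2.
rewrite /reflection_eq /lincomb_flip.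
exact: iff_refl.
Qed.

Lemma quaternary_seriesP t (S : 'M[E1]_2) :
  quaternary_lhs t S = quaternary_rhs t S <->
  reflection_series true (S *m twist_diag _ t).
Proof.
rewrite /reflection_series mulr1n.
rewrite (map_mxM (@fpsC E1)) (map_mxM (map_fps (@fpsC A))) !map_twist_diag -quaternary_eqP.
rewrite fps_algB fps_algM scalerDl -uV_alg -vV_alg.
rewrite /quaternary_lhs /quaternary_rhs /R_minus /Rt_plus /mx_u1 /mx_v2.
rewrite /lincomb_flip.
exact: iff_refl.
Qed.

Lemma in_u_alg (c : {fps K}) : in_u (c%:A : E1) = (fpsC c)%:A.
Proof. by rewrite /in_u -fpsC_alg. Qed.

Lemma in_u_shift c f : map_fps (fps_shift c) (in_u f) = in_u (fps_shift c f).
Proof. by apply/funext=> -[//|n]; apply: (rmorph0 (fps_shift c)). Qed.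

Lemma in_v_shift c f : map_fps (@fps_shift K A c) (in_v f) = in_v f.
Proof. by apply/funext=> n; apply: fps_shiftC. Qed.

(** One statement for all changes of variables: v = - u and v = u - 1, where [E] consists of series
    in u alone, and u -> - u, u -> u - 1 or a translation of both variables, where u and v are
    kept. *)
Lemma reflection_series_morph (C : comNzRingType) (E : algType C)
    (phi : {rmorphism E2 -> E}) (u v : C) a M :
  phi (uV A) = u%:A -> phi (vV A) = v%:A -> reflection_series a M ->
  reflection_eq ((v - u)%:A : E) ((u * v)%:A : E) ((v + u + (u * v) *+ a)%:A : E) ((u *
    v)%:A : E)
    (map_mx (phi \o (@in_u A)) M) (map_mx (phi \o (@in_v A)) M).
Proof.
move=> phiU phiV /(map_reflection_eq phi).
rewrite -!map_mx_comp.
rewrite (_ : phi (V - U)%:A = (v - u)%:A); last first.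
  by rewrite fps_algB -uV_alg -vV_alg rmorphB /= phiU phiV scalerBl.
have phiUV : phi (U * V)%:A = (u * v)%:A.
  by rewrite fps_algM -uV_alg -vV_alg rmorphM /= phiU phiV mulr_algl scalerA.
rewrite (_ : phi (V + U + (U * V) *+ a)%:A = (v + u + (u * v) *+ a)%:A) ?phiUV //.
rewrite scalerDl rmorphD /= [RHS]scalerDl; congr (_ + _).
  by rewrite scalerDl -uV_alg -vV_alg rmorphD /= phiU phiV [RHS]scalerDl.
by case: a; rewrite ?mulr1n ?mulr0n // !scale0r rmorph0.
Qed.

End SeriesReflection.

Section ScaleRegularity.
Context (K : numFieldType) (A : algType K).
Local Notation E1 := {fps A}.
Local Notation E2 := {fps {fps A}}.
Local Notation z := (fpsX : {fps K}).
Implicit Types (M : 'M[E1]_2) (f : E1).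

Lemma scale_reg0 (c : {fps K}) : c 0%N != 0 -> scale_reg E1 c.
Proof.
move=> c0 f; apply: (@scale_inj_low K A c 0) => // a /eqP.
by rewrite scaler_eq0 (negPf c0) => /eqP.
Qed.

Lemma scale_regX : scale_reg E1 z.
Proof.
move=> f; apply: (@scale_inj_low K A z 1) => [[]//|a].
by rewrite scale1r.
Qed.

Lemma scale_reg2 (c : {fps {fps K}}) : scale_reg E1 (c 0%N) -> scale_reg E2 c.
Proof. by move=> rc f; apply: (@scale_inj_low _ E1 c 0). Qed.

Lemma in_uv_comm f (g : E1) : in_u f * in_v g = in_v g * in_u f ->
  forall m n, f m * g n = g n * f m.
Proof.
move=> fg m n; have := congr1 (fun h : E2 => h n m) fg.
by rewrite fpsC_mull fpsC_mulr fpsC_mulr fpsC_mull.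
Qed.

End ScaleRegularity.

(** * Specialization at v = - u and at v = u - 1 *)

Section SeriesFusion.
Context (K : numFieldType) (A : algType K).
Local Notation E1 := {fps A}.
Local Notation E2 := {fps {fps A}}.
Local Notation z := (fpsX : {fps K}).
Local Notation U := (uV K).
Local Notation V := (vV K).
Implicit Types (M : 'M[E1]_2) (f : E1).

(** For the matrices of generators this already implies centrality of f; see [coef_comm_central]. *)
Definition coef_comm f M := forall i j m n, f m * M i j n = M i j n * f m.

Lemma two0 : (2 : {fps K}) 0%N != 0.
Proof. by rewrite -[(2 : {fps K}) 0%N]/(fps_coef 0 2%:R) raddfMn /= pnatr_eq0. Qed.

Lemma scale_reg_two : scale_reg E1 (2 : {fps K}).
Proof. exact/scale_reg0/two0. Qed.

Lemma scale_reg_twoB : scale_reg E1 (2 - z : {fps K}).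
Proof. by apply: scale_reg0; rewrite fpsDE fpsNE subr0; apply: two0. Qed.

Lemma scale_regN (c : {fps K}) : scale_reg E1 c -> scale_reg E1 (- c).
Proof. by move=> rc v /eqP; rewrite scaleNr oppr_eq0 => /eqP/rc. Qed.

(* The coefficient of v^0 is u^-2. *)
Lemma scale_reg_quadric (c d : {fps {fps K}}) : c 0%N = z \/ c 0%N = - z -> d 0%N = 0 ->
  scale_reg E2 (c ^+ 2 - d ^+ 2).
Proof.
move=> c0 d0; apply: scale_reg2.
rewrite fpsDE fpsNE !expr2 !fpsM0 d0 mulr0 subr0.
by case: c0 => ->; rewrite ?mulrNN; apply: scale_regM; apply: scale_regX.
Qed.

Lemma uV0 : U 0%N = z. Proof. by []. Qed.
Lemma vV0 : V 0%N = 0. Proof. by apply/funext=> -[]. Qed.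

Lemma in_u_neg f : map_fps (@fps_neg A) (in_u f) = in_u (fps_neg f).
Proof. by apply/funext=> -[//|n]; apply: (rmorph0 (@fps_neg A)). Qed.

Lemma in_v_neg f : map_fps (@fps_neg A) (in_v f) = in_v f.
Proof.
apply/funext=> n; apply/funext=> m; rewrite /map_fps /in_v /map_fps /fps_neg /fpsC.
by case: eqP => [->|_]; rewrite ?mul1r ?mulr0.
Qed.

Lemma reflection_unitary M : reflection_series false M ->
  exists f, [/\ M *m neg_mx M = f%:M, neg_mx M *m M = f%:M & coef_comm f M].
Proof.
move=> rM.
(* The substitution v = - u. The common factors - z and - z ^+ 2 of the two R-matrices are cancelled
   afterwards. *)
have rM1 : reflection_eq ((- z * 2)%:A : E1) (- z * z)%:A (- z ^+ 2 * 0)%:A (- z ^+ 2 *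
  1)%:A M (neg_mx M).
  have evU : fps_eval (-1) (uV A) = z%:A by rewrite fps_eval_in_u fpsXA.
  have evV : fps_eval (-1) (vV A) = (- z)%:A.
    by rewrite -[LHS]/(fps_subst (-1) fpsX) fps_substX mulrN1.
  have := reflection_series_morph evU evV rM.
  rewrite mulr0n addr0 addNr mulr0 mulr1 (_ : - z - z = - z * 2); last by ring.
  rewrite (_ : z * - z = - z * z); last by ring.
  rewrite (_ : - z * z = - z ^+ 2); last by ring.
  rewrite (_ : map_mx _ _ = M); last by apply/matrixP=> i j; rewrite mxE /= fps_eval_in_u.
  rewrite (_ : map_mx (_ \o @in_v A) _ = neg_mx M) //.
  by apply/matrixP=> i j; rewrite !mxE fps_neg_subst.
have rX2 : scale_reg E1 (- z ^+ 2).
  by apply: scale_regN; apply: scale_regM; apply: scale_regX.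
have rNX : scale_reg E1 (- z) by apply/scale_regN/scale_regX.
have [f [Mf fM]] := reflection_eq_unitary scale_reg_two scale_reg_twoB
  ((reflection_eq_scale _ _ _ _ _ _ rNX rX2).1 rM1).
exists f; split=> // i j; apply: in_uv_comm.
have negU : map_fps (@fps_neg A) (uV A) = (- U)%:A.
  by rewrite in_u_neg fps_negX scaleNr -uV_alg /uV /in_u raddfN.
have negV : map_fps (@fps_neg A) (vV A) = V%:A by rewrite in_v_neg -vV_alg.
have rN := reflection_series_morph negU negV rM.
rewrite /reflection_series !mulr0n !addr0 in rM rN.
(* Under u -> - u the differences u - v and u + v are exchanged up to sign, so M(-u) satisfies the
   second relation required by [fused_scalar_comm]. *)
have rN' : reflection_eq ((V + U)%:A : E2) (- (U * V))%:A (V - U)%:A (- (U * V))%:A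
    (map_mx (@in_u A) (neg_mx M)) (map_mx (@in_v A) M).
  move: rN; rewrite opprK mulNr.
  rewrite (_ : map_mx (_ \o @in_u A) M = map_mx (@in_u A) (neg_mx M)); last first.
    by apply/matrixP=> k l; rewrite !mxE /= in_u_neg.
  by rewrite (_ : map_mx (_ \o @in_v A) M = map_mx (@in_v A) M) //;
    apply/matrixP=> k l; rewrite !mxE /= in_v_neg.
have DT : map_mx (@in_u A) M *m map_mx (@in_u A) (neg_mx M) = (in_u f)%:M.
  by rewrite -(map_mxM (@fpsC E1)) Mf map_scalar_mx.
have := fused_scalar_comm _ _ rM rN' DT i j; rewrite !mxE; apply.
- apply: scale_reg_quadric; last by rewrite fpsM0 vV0 mulr0.
  by right; rewrite fpsDE fpsNE uV0 vV0 sub0r.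
- apply: scale_reg_quadric; last by rewrite fpsM0 vV0 mulr0.
  by left; rewrite fpsDE uV0 vV0 add0r.
Qed.

End SeriesFusion.
Lemma map_sklyanin_mx (C C' : comNzRingType) (E : algType C) (E' : algType C')
    (phi : {rmorphism E -> E'}) (a g : C) (a' g' : C') M :
  phi a%:A = a'%:A -> phi g%:A = g'%:A ->
  map_mx phi (sklyanin_mx a g M) = sklyanin_mx a' g' (map_mx phi M).
Proof. by move=> phia phig; rewrite map_mxD !map_mxZ map_twist_tr phia phig. Qed.

Lemma sklyanin_mx_scale (C : comNzRingType) (E : algType C) (c a g : C) (M : 'M[E]_2) :
  sklyanin_mx (c * a) (c * g) M = c%:A *: sklyanin_mx a g M.
Proof. by rewrite scalerDr !scalerA !mulr_algl !scalerA. Qed.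

Section SeriesFusionOne.
Context (K : numFieldType) (A : algType K).
Local Notation E1 := {fps A}.
Local Notation E2 := {fps {fps A}}.
Local Notation z := (fpsX : {fps K}).
Local Notation U := (uV K).
Local Notation V := (vV K).
Local Notation shift_mx c := (map_mx (@fps_shift K A c)).
Implicit Types (M : 'M[E1]_2) (f : E1).

Lemma zeta1 : zeta 1 - z * zeta 1 = z.
Proof. by have := zetaE (1 : K); rewrite rmorph1 mul1r mulrBl mul1r. Qed.

Lemma scale_reg_zeta (c : K) : scale_reg E1 (zeta c).
Proof.
apply: scale_regM; first exact: scale_regX.
by apply: scale_reg0; rewrite /geometric expr0 oner_eq0.
Qed.

(** The matrix D(u) of the overview: at v = u - 1 one has u + v = 2 u - 1 = (2 - z) / z. *)
Definition fusion_mx M : 'M[E1]_2 := sklyanin_mx (2 - z) z M.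

Lemma reflection_fusion M : reflection_series false M ->
  exists d, fusion_mx M *m shift_mx 1 M = d%:M /\ coef_comm d M.
Proof.
move=> rM; set w := zeta (1 : K).
have wE : w - z * w = z := zeta1.
(* The substitution v = u - 1, with w = (u - 1)^-1. Since u - v = 1, one has w - z = z w; the
   factors z w and w are cancelled afterwards. *)
have rM1 : reflection_eq ((z * w * 1)%:A : E1) (z * w * 1)%:A (w * (2 - z))%:A (w * z)%:A
    M (shift_mx 1 M).
  have evU : fps_eval (geometric 1) (uV A) = z%:A by rewrite fps_eval_in_u fpsXA.
  have evV : fps_eval (geometric 1) (vV A) = w%:A by exact: fps_shiftX.
  have := reflection_series_morph evU evV rM.
  rewrite mulr0n addr0 mulr1 (mulrC w z).
  rewrite (_ : w - z = z * w); last by rewrite -{1}wE; ring.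
  rewrite (_ : w + z = w * (2 - z)); last by rewrite -{1}wE; ring.
  rewrite (_ : map_mx _ _ = M); last by apply/matrixP=> i j; rewrite mxE /= fps_eval_in_u.
  by rewrite (_ : map_mx (_ \o @in_v A) _ = shift_mx 1 M) //.
have rw : scale_reg E1 w by apply: scale_reg_zeta.
have rzw : scale_reg E1 (z * w) by apply: scale_regM => //; apply: scale_regX.
have [d Dd] := reflection_eq_fusion (@scale_reg_two _ A)
  ((reflection_eq_scale _ _ _ _ _ _ rzw rw).1 rM1).
exists d; split=> // i j; apply: in_uv_comm.
have shU : map_fps (@fps_shift K A 1) (uV A) = (fpsC w)%:A.
  by rewrite in_u_shift fps_shiftX in_u_alg.
have shV : map_fps (@fps_shift K A 1) (vV A) = V%:A by rewrite in_v_shift -vV_alg.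
have rT := reflection_series_morph shU shV rM.
rewrite /reflection_series !mulr0n !addr0 in rM rT.
have UwE : (1 - U) * fpsC w = U.
  rewrite mulrBl mul1r; transitivity (fpsC (w - z * w)); last by rewrite wE.
  by rewrite raddfB /= (rmorphM (@fpsC {fps K}) z w).
(* The factor 1 - U clears the denominator that u -> u - 1 introduces. *)
have r1U : scale_reg E2 (1 - U).
  apply: scale_reg2; apply: scale_reg0.
  by rewrite !fpsDE !fpsNE uV0 subr0 -[X in X != 0]/(1 : K) oner_eq0.
have rT' : reflection_eq ((V - U - U * V)%:A : E2) (U * V)%:A (V + U - U * V)%:A (U * V)%:A
    (map_mx (@in_u A) (shift_mx 1 M)) (map_mx (@in_v A) M).
  have := (reflection_eq_scale _ _ _ _ _ _ r1U r1U).2 rT.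
  rewrite !mulrDr !mulrN !mulrA UwE.
  rewrite (_ : (1 - U) * V - U = V - U - U * V); last by ring.
  rewrite (_ : (1 - U) * V + U = V + U - U * V); last by ring.
  rewrite (_ : map_mx (_ \o @in_u A) M = map_mx (@in_u A) (shift_mx 1 M)); last first.
    by apply/matrixP=> k l; rewrite !mxE /= in_u_shift.
  by rewrite (_ : map_mx (_ \o @in_v A) M = map_mx (@in_v A) M) //;
    apply/matrixP=> k l; rewrite !mxE /= in_v_shift.
have rD := reflection_eq_sklyanin rM.
(* Both coefficients, 2 V - U V and U V, are multiples of V, so the adjugate in two variables is V
   times one that involves u only. The factor V is cancelled at the end. *)
rewrite (_ : V - U + (V + U) - U * V = V * (2 - U)) in rD; last by ring.
rewrite (_ : sklyanin_mx _ _ _ = V%:A *: map_mx (@in_u A) (fusion_mx M)) in rD; last first.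
  rewrite (mulrC U) sklyanin_mx_scale; congr (_ *: _); apply/esym.
  apply: (@map_sklyanin_mx _ _ _ _ (@fpsC E1)); last exact: in_u_alg.
  by rewrite [LHS]in_u_alg raddfB /= rmorph_nat.
have DT : (V%:A *: map_mx (@in_u A) (fusion_mx M)) *m map_mx (@in_u A) (shift_mx 1 M) =
    (V *: in_u d)%:M.
  rewrite -scalemxAl -(map_mxM (@fpsC E1)) Dd map_scalar_mx scale_scalar_mx.
  by rewrite mulr_algl.
have rV : scale_reg E2 V.
  move=> f; apply: (@scale_inj_low _ E1 V 1) => [[] // _|g]; first exact: vV0.
  rewrite (_ : V 1%N = 1) ?scale1r //.
have := fused_scalar_commN _ _ rD rT' DT i j; rewrite !mxE => comm.
apply: (scale_reg_eq rV); rewrite scalerAl scalerAr; apply: comm.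
- apply: scale_reg_quadric; last by rewrite fpsM0 vV0 mulr0.
  by left; rewrite !fpsDE fpsNE uV0 fpsM0 vV0 mulr0 add0r subr0.
- apply: scale_reg_quadric; last by rewrite fpsM0 vV0 mulr0.
  by right; rewrite !fpsDE !fpsNE uV0 fpsM0 vV0 mulr0 add0r subr0.
Qed.

End SeriesFusionOne.

(** * Translation by 1/2 and the symmetry relation *)

Lemma shift_scalars (R : comNzRingType) (k u v u' v' : R) :
  (1 - k * u) * u' = u -> (1 - k * v) * v' = v ->
  let m := (1 - k * u) * (1 - k * v) in
  [/\ m * (v' - u') = v - u, m * (u' * v') = u * v &
      forall a b, k + k + b = a -> m * (v' + u' + a * (u' * v')) = v + u + b * (u * v)].
Proof.
move=> uE vE m; have pE : m * (u' * v') = u * v by rewrite mulrACA uE vE.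
split=> // [|a b <-].
  have -> : m * (v' - u') = (1 - k * u) * ((1 - k * v) * v') - (1 - k * v) * ((1 - k * u)
    * u').
    by rewrite /m; ring.
  by rewrite uE vE; ring.
rewrite mulrDr mulrCA pE.
have -> : m * (v' + u') = (1 - k * u) * ((1 - k * v) * v') + (1 - k * v) * ((1 - k * u) * u').
  by rewrite /m; ring.
by rewrite uE vE; ring.
Qed.

Section TwistedShift.
Context (K : comNzRingType) (A : algType K).
Local Notation E1 := {fps A}.
Local Notation E2 := {fps {fps A}}.
Local Notation z := (fpsX : {fps K}).
Local Notation U := (uV K).
Local Notation V := (vV K).
Local Notation shift_mx c := (map_mx (@fps_shift K A c)).
Local Notation cst c := (fpsC (fpsC (c : K))).
Implicit Types (M S : 'M[E1]_2) (f : E1).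

(** The coefficientwise map translates the inner variable u. The outer variable v is translated by a
    substitution over [{fps K}] whose parameter is [geometric c] in v. *)
Definition shift_uv (c : K) : E2 -> E2 :=
  @fps_subst {fps K} E1 (in_v (geometric c)) \o map_fps (fps_shift c).
HB.instance Definition _ c := GRing.RMorphism.copy (shift_uv c)
  (@fps_subst {fps K} E1 (in_v (geometric c)) \o map_fps (fps_shift c)).

Lemma shift_uv_in_u c f : shift_uv c (in_u f) = in_u (fps_shift c f).
Proof. by rewrite /shift_uv /= in_u_shift /in_u fps_substC. Qed.

Lemma shift_uv_in_v c f : shift_uv c (in_v f) = in_v (fps_shift c f).
Proof.
rewrite /shift_uv /= in_v_shift; apply/funext=> m; rewrite fps_substE.
have -> : (fpsX : {fps {fps K}}) * in_v (geometric c) = in_v (zeta c).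
  by rewrite /zeta /in_v rmorphM /= map_fpsX.
rewrite [RHS]/in_v /map_fps /fps_shift fps_substE raddf_sum; apply: eq_bigr => i _.
rewrite -(rmorphXn (map_fps (@fpsC K))) /= /map_fps.
by apply/funext=> n; rewrite fpsC_scale /in_v /map_fps /fpsC /=; case: eqP; rewrite ?scaler0.
Qed.

Lemma in_v_alg (c : {fps K}) : in_v (c%:A : E1) = (in_v c)%:A.
Proof.
apply/funext=> n; rewrite fps_alg_coef /in_v /map_fps fps_alg_coef.
exact: (esym (fpsC_alg _ _)).
Qed.

(** A translation of both variables by c fixes u - v and turns u + v + a into u + v + a - 2 c. The
    denominators are cleared by (1 - c u^-1) (1 - c v^-1). *)
Lemma reflection_series_shift_reg (c : K) (a b : bool) M :
  scale_reg E2 ((1 - cst c * U) * (1 - cst c * V)) ->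
  c + c + b%:R = a%:R -> reflection_series a M -> reflection_series b (shift_mx c M).
Proof.
move=> rm cab rM; set u' := fpsC (zeta c); set v' := in_v (zeta c).
have shU : shift_uv c (uV A) = u'%:A by rewrite shift_uv_in_u fps_shiftX in_u_alg.
have shV : shift_uv c (vV A) = v'%:A by rewrite shift_uv_in_v fps_shiftX in_v_alg.
have := reflection_series_morph shU shV rM.
rewrite (_ : map_mx (_ \o @in_u A) M = map_mx (@in_u A) (shift_mx c M)); last first.
  by apply/matrixP=> k l; rewrite !mxE /= shift_uv_in_u.
rewrite (_ : map_mx (_ \o @in_v A) M = map_mx (@in_v A) (shift_mx c M)); last first.
  by apply/matrixP=> k l; rewrite !mxE /= shift_uv_in_v.
have uE : (1 - cst c * U) * u' = U.
  rewrite -[RHS]/(fpsC z) -(zetaE c) rmorphM; congr (_ * _).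
  by rewrite rmorphB rmorphM rmorph1.
have vE : (1 - cst c * V) * v' = V.
  transitivity (in_v ((1 - fpsC c * z) * zeta c)); last by rewrite zetaE.
  rewrite /in_v rmorphM rmorphB rmorphM rmorph1; congr ((1 - _ * _) * _).
  by apply/funext=> -[//|n]; exact: (esym (rmorph0 (@fpsC K))).
have [xE pE yE] := shift_scalars uE vE.
set m := (1 - cst c * U) * (1 - cst c * V) in xE pE yE rm.
move/(reflection_eq_scale _ _ _ _ _ _ rm rm).2.
have cE : cst c + cst c + b%:R = a%:R.
  by rewrite -(rmorph_nat (@fpsC {fps K}) b) -(rmorph_nat (@fpsC K) b)
    -!rmorphD cab !rmorph_nat.
by rewrite xE pE -[(u' * v') *+ a]mulr_natl (yE _ _ cE) mulr_natl.
Qed.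

End TwistedShift.

(** Used with c = 1/2 and c = - 1/2 to pass from [true] to [false] and back. *)
Lemma reflection_series_shift (K : numFieldType) (A : algType K) (c : K) (a b : bool)
    (M : 'M[{fps A}]_2) :
  c + c + b%:R = a%:R -> reflection_series a M ->
  reflection_series b (map_mx (fps_shift c) M).
Proof.
apply: reflection_series_shift_reg; apply: scale_regM; apply: scale_reg2.
  by apply: scale_reg0; rewrite fpsDE fpsNE fpsC_mull uV0 !fpsDE !fpsNE fpsC_mull mulr0 subr0
    -[X in X != 0]/(1 : K) oner_eq0.
by rewrite fpsDE fpsNE fpsC_mull vV0 mulr0 subr0 => f; rewrite scale1r.
Qed.

(** The series sigma of the overview. In both cases it is z + det(K) (2 - z). *)
Definition symmetry_scalar (C : comNzRingType) (t : twist) (z : C) : C :=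
  if t is Orthogonal then z - (2 - z) else 2.

(** Here Y, X and h stand for S(u - 1/2), S(1/2 - u) and (u - 1/2)^-1. Entry by entry the defects of
    the two relations are proportional, with the regular factors 2 and (2 - z) up to sign. *)
Lemma symmetry_entriesP (C : comNzRingType) (E : algType C) t (z h : C) (X Y : 'M[E]_2) :
  scale_reg E (2 : C) -> scale_reg E (2 - z) -> (2 - z) * h = 2 * z ->
  (forall i j, 2 *: twist_tr t Y i j =
               2 *: X i j - (twist_sign C t * h) *: (X i j - Y i j)) <->
  sklyanin_mx (2 - z) z (Y *m twist_diag E t) =
    (symmetry_scalar t z)%:A *: (X *m twist_diag E t).
Proof.
move=> r2 r2z hE; set s := twist_sign C t.
pose k (j : 'I_2) : C := if t is Orthogonal then (-1) ^+ (j == i1) else 1.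
have kE (W : 'M[E]_2) i j : (W *m twist_diag E t) i j = k j *: W i j.
  rewrite mxE (bigD1 j) //= big1 ?addr0 => [|l ne]; rewrite mxE.
    rewrite eqxx mulr1n /k; case: (t) => /=; last by rewrite mulr1 scale1r.
    by case: (_ == _); rewrite ?expr0 ?expr1 ?mulrN1 ?mulr1 ?scaleN1r ?scale1r.
  by rewrite (negPf ne) mulr0n mulr0.
pose e (j : 'I_2) : C := if t is Orthogonal then - k j else 1.
have key i j : 2 *: (sklyanin_mx (2 - z) z (Y *m twist_diag E t) i j
      - symmetry_scalar t z *: (X *m twist_diag E t) i j) =
    (e j * (2 - z)) *: (2 *: twist_tr t Y i j - (2 *: X i j - (s * h) *: (X i j - Y i j))).
  have -> : (e j * (2 - z)) *: (2 *: twist_tr t Y i j - (2 *: X i j - (s * h) *: (X i j -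
    Y i j)))
     = e j *: ((2 * (2 - z)) *: twist_tr t Y i j - ((2 * (2 - z)) *: X i j - (s * (2 *
       z)) *: (X i j - Y i j))).
    by rewrite -hE; lin C.
  have [D00 D01 D10 D11] := sklyanin_mxE (2 - z) z (Y *m twist_diag E t).
  rewrite !kE in D00 D01 D10 D11 *.
  rewrite [twist_tr t Y i j]mxE /e /k /s /symmetry_scalar /twist_sign.
  elim/I2_ind: i; elim/I2_ind: j; rewrite ?D00 ?D01 ?D10 ?D11 /k ?rev_i0 ?rev_i1;
    case: (t) => /=; rewrite ?mul1r ?mulN1r ?expr0 ?expr1; lin C.
have scE i j : ((symmetry_scalar t z)%:A *: (X *m twist_diag E t)) i j =
    symmetry_scalar t z *: (X *m twist_diag E t) i j by rewrite mxE mulr_algl.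
have ee j : e j * e j = 1.
  by rewrite /e /k; case: (t); rewrite ?mulrNN ?mulr1 // -expr2 sqrr_sign.
split=> [eqS|eqF i j].
  apply/matrixP=> i j; rewrite scE; apply/eqP; rewrite -subr_eq0; apply/eqP/r2.
  by rewrite key eqS subrr scaler0.
have := key i j; rewrite eqF scE subrr scaler0 => /(congr1 (fun v => e j *: v)).
rewrite scaler0 !scalerA mulrA ee mul1r => /esym/r2z/eqP.
by rewrite subr_eq0 => /eqP.
Qed.

Section TwistedSymmetry.
Context (K : numFieldType) (A : algType K) (t : twist).
Local Notation E1 := {fps A}.
Local Notation z := (fpsX : {fps K}).
Local Notation shift_mx c := (map_mx (@fps_shift K A c)).
Implicit Types (M S : 'M[E1]_2) (f : E1).

(* f(u) |-> f(c - u) *)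
Definition fps_reflect (c : K) : E1 -> E1 := fps_shift c \o @fps_neg A.
HB.instance Definition _ c :=
  GRing.RMorphism.copy (fps_reflect c) (fps_shift c \o @fps_neg A).

Local Notation reflect_mx c := (map_mx (fps_reflect c)).

Lemma fps_reflect_shift a b f : fps_reflect a (fps_shift b f) = fps_reflect (a - b) f.
Proof. by rewrite /fps_reflect /= fps_neg_shift fps_shift_shift. Qed.

Lemma fps_reflectK c : involutive (fps_reflect c).
Proof.
move=> f; rewrite {1}/fps_reflect /= fps_neg_shift fps_negK fps_shift_shift.
by rewrite subrr fps_shift0.
Qed.

(** The symmetry relation is taken at 1/2 - u, where S(-u) and S(u) become S(u - 1/2) = M(u) K and
    S(1/2 - u) = M(1 - u) K. This is the origin of the reflection u -> 1 - u. *)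
Lemma symmetry_seriesP S :
  let M := shift_mx 2^-1 S *m twist_diag _ t in
  symmetry_lhs t S = symmetry_rhs t S <->
  fusion_mx M = (symmetry_scalar t z)%:A *: reflect_mx 1 M.
Proof.
move=> M; set Y := shift_mx 2^-1 S; set X := reflect_mx 2^-1 S.
set s : {fps K} := twist_sign {fps K} t; set h := zeta (2^-1 : K).
have hE : (2 - z) * h = 2 * z.
  transitivity (2 * ((1 - fpsC (2^-1) * z) * h)); last by rewrite zetaE.
  rewrite mulrA; congr (_ * h).
  rewrite mulrBr mulr1; congr (_ - _); rewrite mulrA -[2 * _](_ : 1 = _) ?mul1r //.
  by rewrite -(rmorph_nat (@fpsC K) 2) -rmorphM /= divff ?pnatr_eq0 // rmorph1.
have XE : reflect_mx 1 M = X *m twist_diag _ t.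
  rewrite map_mxM map_twist_diag; congr (_ *m _); apply/matrixP=> i j; rewrite /X /Y !mxE.
  rewrite /= fps_reflect_shift; congr (fps_reflect _ _).
  by apply/eqP; rewrite subr_eq -[2^-1]mul1r -splitr.
have twoA : (2 : {fps K})%:A = 2 :> E1 by rewrite scaler_nat.
have symE : symmetry_lhs t S = symmetry_rhs t S <->
    forall i j, 2 *: twist_tr t Y i j = 2 *: X i j - (s * h) *: (X i j - Y i j).
  have YE : reflect_mx 2^-1 (neg_mx S) = Y.
    by apply/matrixP=> i j; rewrite !mxE /fps_reflect /= fps_negK.
  have lE : reflect_mx 2^-1 (symmetry_lhs t S) = 2%:A *: twist_tr t Y.
    by rewrite map_mxZ map_twist_tr YE rmorph_nat twoA.
  have rE : reflect_mx 2^-1 (symmetry_rhs t S) = 2%:A *: X - (s * h)%:A *: (X - Y).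
    rewrite map_mxD !map_mxZ map_mxB YE rmorph_nat twoA -scaleNr.
    congr (_ + _ *: _); rewrite rmorphM /= [fps_reflect _ fpsX]/fps_reflect /= fps_negX
      rmorphN.
    rewrite /= fps_shiftX mulrN; congr (- _); rewrite [(s * h)%:A]fps_algM; congr (_ * h%:A).
    by rewrite /s; case: t; rewrite /= ?rmorph1 ?rmorphN1 ?scale1r ?scaleN1r.
  have inj : injective (reflect_mx 2^-1 : 'M[E1]_2 -> 'M[E1]_2).
    by apply: (can_inj (g := reflect_mx 2^-1)) => W; apply/matrixP=> i j; rewrite !mxE
      fps_reflectK.
  split=> [eqS i j|eqS].
    have := congr1 (fun W => reflect_mx 2^-1 W i j) eqS; rewrite lE rE.
    by rewrite [LHS]mxE [RHS]mxE [X in _ = X + _]mxE [X in _ = _ + X]mxE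
       [X in _ = _ - X]mxE [(X - Y) _ _]mxE [(- Y) _ _]mxE !mulr_algl.
  apply: inj; rewrite lE rE; apply/matrixP=> i j; have := eqS i j.
  by rewrite [X in _ -> X = _]mxE [X in _ -> _ = X]mxE [X in _ -> _ = X + _]mxE [X in _
    -> _ = _ + X]mxE
       [X in _ -> _ = _ - X]mxE [(X - Y) _ _]mxE [(- Y) _ _]mxE !mulr_algl.
rewrite symE XE; apply: symmetry_entriesP => //.
- exact: scale_reg_two.
- exact: scale_reg_twoB.
Qed.

End TwistedSymmetry.

(** * Central series: square roots and a difference equation *)

Lemma series_rec (T : Type) (x0 : T) (F : nat -> (nat -> T) -> T) :
  (forall n g g', (forall i, (i < n)%N -> g i = g' i) -> F n g = F n g') ->
  exists g : nat -> T, forall n, g n = F n g.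
Proof.
move=> Floc.
(* [G n] is correct at the indices below [n], and these are the only ones that [F n] inspects. *)
pose G := fix G n := if n is n'.+1 then
  fun i => if (i < n')%N then G n' i else F i (G n') else fun=> x0.
have GE n i : (i < n)%N -> G n i = G i.+1 i.
  elim: n => [//|n IH]; rewrite ltnS leq_eqVlt => /orP[/eqP->//|lt_in].
  by rewrite /= lt_in IH.
exists (fun n => G n.+1 n) => n; rewrite [LHS]/= ltnn; apply: Floc => i.
exact: GE.
Qed.

Definition fps_trunc (A : zmodType) n (f : {fps A}) : {fps A} :=
  fun i => if (i < n)%N then f i else 0.

Lemma fps_trunc_eq (A : zmodType) n (f g : {fps A}) :
  (forall i, (i < n)%N -> f i = g i) -> fps_trunc n f = fps_trunc n g.
Proof. by move=> fg; apply/funext=> i; rewrite /fps_trunc; case: ltnP => // /fg. Qed.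

Lemma fps_sub_trunc (A : nzRingType) n (f : {fps A}) : fps_van n (f - fps_trunc n f).
Proof. by move=> i lt_in; rewrite fpsDE fpsNE /fps_trunc lt_in subrr. Qed.

Section LeadingCoefficients.
Context (A : nzRingType).
Implicit Types f r : {fps A}.

Lemma fps_van_mulr n f r : fps_van n r -> (f * r) n = f 0%N * r n.
Proof.
move=> vr; rewrite fpsME big_ord_recl subn0 big1 ?addr0 // => i _.
by rewrite vr ?mulr0 // lift0 ltn_subrL /= (leq_ltn_trans _ (ltn_ord i)).
Qed.

Lemma fps_van_mull n f r : fps_van n r -> (r * f) n = r n * f 0%N.
Proof.
move=> vr; rewrite [LHS]fps_mul_rev big_ord_recl subn0 big1 ?addr0 // => i _.
by rewrite vr ?mul0r // lift0 ltn_subrL /= (leq_ltn_trans _ (ltn_ord i)).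
Qed.

Lemma fps_van_mulSl n f r : fps_van n r ->
  (r * f) n.+1 = r n.+1 * f 0%N + r n * f 1%N.
Proof.
move=> vr; rewrite [LHS]fps_mul_rev 2!big_ord_recl subn0 subSS subn0.
rewrite big1 ?addr0 // => i _.
by rewrite vr ?mul0r // !lift0 !subSS ltn_subrL /= (leq_ltn_trans _ (ltn_ord i)).
Qed.

End LeadingCoefficients.

Section CentralSeries.
Context (K : comNzRingType) (A : algType K).
Implicit Types f g : {fps A}.

Definition central f := forall m (a : A), f m * a = a * f m.

Lemma central_comm f g : central f -> f * g = g * f.
Proof.
move=> cf; apply/funext=> n; rewrite fpsME [RHS]fps_mul_rev.
by apply: eq_bigr => i _; rewrite cf.
Qed.

Lemma centralM f g : central f -> central g -> central (f * g).
Proof.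
move=> cf cg m a; rewrite fpsME mulr_suml mulr_sumr; apply: eq_bigr => i _.
by rewrite -mulrA cg !mulrA cf.
Qed.

Lemma centralB f g : central f -> central g -> central (f - g).
Proof. by move=> cf cg m a; rewrite fpsDE fpsNE mulrBl mulrBr cf cg. Qed.

Lemma central_scale (c : {fps K}) f : central f -> central (c *: f).
Proof.
move=> cf m a; rewrite fpsZE mulr_suml mulr_sumr; apply: eq_bigr => i _.
by rewrite -scalerAl cf scalerAr.
Qed.

Lemma central1 : central 1.
Proof. by move=> m a; rewrite fps1E mulr_natl mulr_natr. Qed.

Lemma central_subst rho f : central f -> central (fps_subst rho f).
Proof.
move=> cf m a; rewrite fps_substE mulr_suml mulr_sumr; apply: eq_bigr => i _.
by rewrite -scalerAl cf scalerAr.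
Qed.

Lemma central_shift c f : central f -> central (fps_shift c f).
Proof. exact: central_subst. Qed.

Lemma central_neg f : central f -> central (fps_neg f).
Proof. by rewrite fps_neg_subst; apply: central_subst. Qed.

Lemma central_trunc n f : (forall i, (i < n)%N -> forall a, f i * a = a * f i) ->
  central (fps_trunc n f).
Proof.
by move=> cf m a; rewrite /fps_trunc; case: ltnP => [/cf->|]; rewrite ?mul0r ?mulr0.
Qed.

End CentralSeries.

Section ScalarSeries.
Context (K : numFieldType) (A : algType K).
Local Notation E1 := {fps A}.
Implicit Types (f g h x y : E1).

(** The coefficient of order n > 0 in g g is 2 g n plus a polynomial in earlier coefficients;
    solving for g n keeps it central. *)
Lemma central_sqrt f : central f -> f 0%N = 1 ->
  exists g, [/\ central g, g 0%N = 1 & g * g = f].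
Proof.
move=> cf f0.
pose F n (g : nat -> A) : A := if n == 0%N then 1 else
  2^-1 *: (f - fps_trunc n g * fps_trunc n g) n.
have [g gE] : exists g : nat -> A, forall n, g n = F n g.
  by apply: (series_rec 0) => n g g' gg'; rewrite /F (fps_trunc_eq gg').
have g0 : g 0%N = 1 by rewrite gE.
exists g; split=> //.
  move=> m; elim/ltn_ind: m => m IH a; rewrite gE /F.
  case: eqP => _; first by rewrite mul1r mulr1.
  rewrite -scalerAl -scalerAr; congr (_ *: _); apply: centralB => //.
  by apply: centralM; apply: central_trunc.
apply/funext=> -[|n]; first by rewrite fpsM0 g0 mulr1 f0.
set t := fps_trunc n.+1 g; have t0 : t 0%N = 1 by [].
have [r vr gtr] : exists2 r, fps_van n.+1 r & (g : E1) = t + r.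
  by exists ((g : E1) - t); [exact: fps_sub_trunc | rewrite addrC subrK].
have rn : r n.+1 = g n.+1 by rewrite gtr fpsDE /t /fps_trunc ltnn add0r.
rewrite {1 2}gtr mulrDl !mulrDr !fpsDE (fps_van_mulr t vr) (fps_van_mull t vr) t0 mulr1 mul1r.
rewrite (fps_van_mulr r vr) (vr 0%N) // mul0r addr0 rn gE /F /= fpsDE fpsNE -/t.
by rewrite -addrA -scalerDl -[2^-1 in X in _ + X]mul1r -splitr scale1r addrC subrK.
Qed.

(** In (x - 1) (x + 1) = 0 the second factor has the invertible constant term 2. *)
Lemma sqrt1_unique x : x 0%N = 1 -> x * x = 1 -> x = 1.
Proof.
move=> x0 xx; apply/eqP; rewrite -subr_eq0; apply/eqP/funext=> n.
have prod0 : (x - 1) * (x + 1) = 0.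
  by rewrite mulrDr mulrBl xx mulr1 mul1r addrA subrK subrr.
elim/ltn_ind: n => n IH; have /(congr1 (fun f : E1 => f n)) := prod0.
rewrite (fps_van_mull (x + 1) (IH : fps_van n (x - 1))) [(x + 1) _]fpsDE x0 fps1E -mulr2n
  mulr_natr -scaler_nat => /eqP.
by rewrite scaler_eq0 pnatr_eq0 => /eqP.
Qed.

Lemma zetaX_lead (c : K) n :
  (zeta c ^+ n) n = 1 /\ (zeta c ^+ n) n.+1 = c *+ n.
Proof.
elim: n => [|n [IH0 IH1]]; first by rewrite expr0 !fps1E mulr0n.
have XE (f : {fps K}) m : (fpsX * f) m.+1 = f m.
  rewrite fpsME big_ord_recl mul0r add0r big_ord_recl mul1r subSS subn0.
  by rewrite big1 ?addr0 // => i _; rewrite mul0r.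
have vz : fps_van n (zeta c ^+ n) by apply: fps_vanX; apply: zeta_van.
rewrite exprS {1 3}/zeta -mulrA !XE mulrC fps_van_mull // fps_van_mulSl // IH0 IH1.
by rewrite /geometric expr0 expr1 mulr1 mul1r mulr1 mulrSr.
Qed.

(** This comes from (u - c)^-n = u^-n + n c u^-(n+1) + ... . The term n c is what makes difference
    equations solvable in characteristic 0. *)
Lemma fps_shift_lead c n f : fps_van n f ->
  (fps_shift c f) n = f n /\ (fps_shift c f) n.+1 = f n.+1 + (c *+ n) *: f n.
Proof.
move=> vf; have [z0 z1] := zetaX_lead c n; have [z2 _] := zetaX_lead c n.+1.
rewrite /fps_shift !fps_substE; split.
  rewrite big_ord_recr /= big1 => [|i _]; last by rewrite vf ?scaler0.
  by rewrite add0r -/(zeta c) z0 scale1r.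
rewrite 2!big_ord_recr /= big1 => [|i _]; last by rewrite vf ?scaler0.
by rewrite add0r -/(zeta c) z1 z2 scale1r addrC.
Qed.

Lemma fps_shift_van c n f : fps_van n f -> fps_van n (fps_shift c f).
Proof.
move=> vf m lt_mn; rewrite /fps_shift fps_substE big1 // => i _.
by rewrite vf ?scaler0 // (leq_ltn_trans _ lt_mn) // -ltnS.
Qed.

(** A leading coefficient of order n > 0 would be added n times to the next coefficient by the
    shift. *)
Lemma shift_invariant x : fps_shift 1 x = x -> x = fpsC (x 0%N).
Proof.
move=> xT; set y := x - fpsC (x 0%N).
have yT : fps_shift 1 y = y by rewrite rmorphB /= xT fps_shiftC.
have vy n : fps_van n.+1 y.
  elim: n => [[]// _|n IH m]; first by rewrite /y fpsDE fpsNE /fpsC subrr.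
  rewrite ltnS leq_eqVlt => /orP[/eqP->|/IH//].
  have [_] := fps_shift_lead 1 IH; rewrite yT => /eqP.
  by rewrite -subr_eq0 opprD addNKr oppr_eq0 scaler_eq0 pnatr_eq0 => /eqP.
apply/eqP; rewrite -subr_eq0; apply/eqP/funext=> n; exact: (vy n).
Qed.

(* The solution is the product of f(u - k) over k >= 1. *)
Lemma shift_equation f : central f -> f 0%N = 1 -> f 1%N = 0 ->
  exists h, [/\ central h, h 0%N = 1 & fps_shift 1 f * fps_shift 1 h = h].
Proof.
move=> cf f0 f1; set T := @fps_shift K A 1.
have v0 x : fps_van 0 x by [].
have T0 x : T x 0%N = x 0%N := (fps_shift_lead 1 (v0 x)).1.
have Tf1 : T f 1%N = 0.
  by rewrite [LHS](fps_shift_lead 1 (v0 f)).2 f1 mulr0n scale0r addr0.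
(* The coefficient h n is read off in order n + 1: there h (n + 1) cancels between the two sides and
   the shift contributes n times h n. In order 1 what remains is the condition f 1 = 0. *)
pose F n (g : nat -> A) : A := if n == 0%N then 1 else
  - (n%:R^-1 *: (T (fps_trunc n g) * T f) n.+1).
have [h hE] : exists g : nat -> A, forall n, g n = F n g.
  by apply: (series_rec 0) => n g g' gg'; rewrite /F (fps_trunc_eq gg').
have h0 : h 0%N = 1 by rewrite hE.
have ch : central h.
  move=> m; elim/ltn_ind: m => m IH a; rewrite hE /F.
  case: eqP => _; first by rewrite mul1r mulr1.
  rewrite mulNr mulrN -scalerAl -scalerAr; congr (- (_ *: _)); apply: centralM.
    by apply/central_shift/central_trunc.
  exact: central_shift.
exists h; split=> //; rewrite central_comm; last exact: central_shift.
apply/funext=> -[|m].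
  by rewrite fpsM0 !T0 f0 mulr1.
set t := fps_trunc m h.
have [r vr htr] : exists2 r, fps_van m r & (h : E1) = t + r.
  by exists ((h : E1) - t); [exact: fps_sub_trunc | rewrite addrC subrK].
have rm k : (m <= k)%N -> r k = h k.
  by rewrite leqNgt htr fpsDE /t /fps_trunc => /negPf->; rewrite add0r.
have vTr : fps_van m (T r) by apply: fps_shift_van.
have [Tr0 Tr1] := fps_shift_lead 1 vr.
have TD : T (t + r) = T t + T r by exact: rmorphD.
rewrite -/T in Tr0 Tr1.
rewrite {1}htr TD mulrDl fpsDE (fps_van_mulSl (T f) vTr) T0 f0 Tf1 mulr0 addr0 mulr1.
rewrite Tr1 !rm // addrCA -[RHS]addr0; congr (_ + _).
rewrite hE /F -/t; case: eqP => [m0|/eqP m0].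
  rewrite m0 mulr0n scale0r addr0 /t m0 (_ : fps_trunc 0 h = 0) //.
  by rewrite [T 0](rmorph0 (fps_shift 1)) mul0r.
by rewrite scalerN scalerA divff ?pnatr_eq0 // scale1r subrr.
Qed.

End ScalarSeries.

(** * Universal properties of the presentations *)

Section FreeAlgebra.
Context (K : comNzRingType) (I : choiceType).
Local Notation F := (free_alg K I).

Lemma free_alg_ind (P : F -> Prop) :
  P 1 -> (forall x y, P x -> P y -> P (x + y)) -> (forall c x, P x -> P (c *: x)) ->
  (forall i x, P x -> P (free_gen K i * x)) -> forall x, P x.
Proof.
move=> P1 PD PZ Pgen x.
have P0 : P 0 by rewrite -(scale0r 1); apply: PZ.
have Pm (m : fmonom I) : P << m >>.
  case: m => s; elim: s => [|i s IH].
    by rewrite (_ : FMonom [::] = mone) //; apply/eqP; rewrite fmP fm1.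
  have -> : << FMonom (i :: s) >> = free_gen K i * << FMonom s >> :> F.
    rewrite /free_gen [RHS]fgmulUU mulr1; congr mkmalgU.
    by apply/eqP; rewrite fmP fmM fmU.
  exact: Pgen.
rewrite [x](monalgE (x : {malg K[{fmonom I}]})).
elim/big_ind: _ => // m _.
have -> : << x@_m *g m >> = x@_m *: << m >> :> F.
  by apply/malgP=> k; rewrite [RHS]fgscaleE !mcoeffU mulrnAr mulr1.
exact: PZ.
Qed.

Variables (A : algType K) (v : I -> A).

Definition monomial_value (m : fmonom I) : A := \prod_(i <- (m : seq I)) v i.

Fact monomial_value_morph : mmorphism monomial_value.
Proof.
by split=> [m n|]; rewrite /monomial_value ?fm1 ?big_nil // fmM big_cat.
Qed.
HB.instance Definition _ :=
  isMultiplicative.Build {fmonom I} A monomial_value monomial_value_morph.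

Definition free_eval : F -> A := mmap (in_alg A) monomial_value.

Fact free_eval_is_zmod_morphism : zmod_morphism free_eval.
Proof. exact: (raddfB (mmap (in_alg A) monomial_value)). Qed.
Fact free_eval_is_monoid_morphism : monoid_morphism free_eval.
Proof.
have [mM m1] := @commr_mmap_is_multiplicative _ _ _ (in_alg A) monomial_value
  (fun (g : {malg K[{fmonom I}]}) m m' => etrans (mulr_algl _ _) (esym (mulr_algr _ _))).
by split.
Qed.
Fact free_eval_is_scalable : scalable free_eval.
Proof.
move=> c x; rewrite /free_eval [LHS](@mmapZ _ _ _ (in_alg A) monomial_value).
exact: mulr_algl.
Qed.
HB.instance Definition _ := GRing.isZmodMorphism.Build F A free_eval
  free_eval_is_zmod_morphism.
HB.instance Definition _ := GRing.isMonoidMorphism.Build F A free_eval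
  free_eval_is_monoid_morphism.
HB.instance Definition _ := GRing.isScalable.Build K F A *:%R free_eval
  free_eval_is_scalable.

Lemma free_eval_gen i : free_eval (free_gen K i) = v i.
Proof.
rewrite /free_eval /free_gen mmapU /= scale1r mul1r /monomial_value fmU.
by rewrite big_seq1.
Qed.

End FreeAlgebra.

Section QuotientLift.
Context (K : comNzRingType) (F : algType K) (S : set F) (proper : ~ ideal_span S 1).
Context (A : algType K) (phi : {lrmorphism F -> A}) (phiS : forall x, S x -> phi x = 0).
Local Notation Q := (quot_alg proper).

Lemma ideal_span_kernel x : ideal_span S x -> phi x = 0.
Proof.
move=> Jx; apply: (Jx (fun y => phi y = 0)) => //.
split=> [|a b a0 b0|a b b0|a b b0]; first exact: rmorph0.
- by rewrite rmorphD /= a0 b0 addr0.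
- by rewrite rmorphM /= b0 mulr0.
- by rewrite rmorphM /= b0 mul0r.
Qed.

Definition quot_lift (q : Q) : A := phi (repr q).

Lemma quot_lift_proj x : quot_lift (quot_proj proper x) = phi x.
Proof.
apply/eqP; rewrite -subr_eq0 -rmorphB; apply/eqP/ideal_span_kernel.
exact: repr_pi_ideal.
Qed.

Lemma quot_projP (q : Q) : exists x, q = quot_proj proper x.
Proof. by exists (repr q); rewrite /quot_proj reprK. Qed.

Fact quot_lift_is_zmod_morphism : zmod_morphism quot_lift.
Proof.
move=> x y; have [{}x ->] := quot_projP x; have [{}y ->] := quot_projP y.
by rewrite -rmorphB !quot_lift_proj rmorphB.
Qed.
Fact quot_lift_is_monoid_morphism : monoid_morphism quot_lift.
Proof.
split=> [|x y]; first by rewrite -(rmorph1 (quot_proj proper)) quot_lift_proj rmorph1.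
have [{}x ->] := quot_projP x; have [{}y ->] := quot_projP y.
by rewrite -rmorphM !quot_lift_proj rmorphM.
Qed.
Fact quot_lift_is_scalable : scalable quot_lift.
Proof.
move=> c x; have [{}x ->] := quot_projP x.
by rewrite -linearZ !quot_lift_proj linearZ.
Qed.
HB.instance Definition _ := GRing.isZmodMorphism.Build Q A quot_lift
  quot_lift_is_zmod_morphism.
HB.instance Definition _ := GRing.isMonoidMorphism.Build Q A quot_lift
  quot_lift_is_monoid_morphism.
HB.instance Definition _ := GRing.isScalable.Build K Q A *:%R quot_lift
  quot_lift_is_scalable.

Lemma quot_liftP : exists psi : {lrmorphism Q -> A},
  forall x, psi (quot_proj proper x) = phi x.
Proof. by exists quot_lift; apply: quot_lift_proj. Qed.

End QuotientLift.
Section Relators.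
Context (K : comNzRingType) (A : nzRingType).
Local Notation F := (free_alg K gen_index).
Variable h : {rmorphism F -> A}.

Lemma relators1P m n (M N : 'M[{fps F}]_(m, n)) :
  (forall x, relators1 M N x -> h x = 0) <->
  map_mx (map_fps h) M = map_mx (map_fps h) N.
Proof.
split=> [relh|eqMN x [i [j [r ->]]]].
  apply/matrixP=> i j; apply/funext=> r; rewrite !mxE /map_fps; apply/eqP.
  by rewrite -subr_eq0 -rmorphB; apply/eqP/relh; exists i, j, r; rewrite !mxE.
have : map_mx (map_fps h) (M - N) i j r = 0 by rewrite map_mxB eqMN subrr mxE.
by rewrite mxE.
Qed.

Lemma relators2P m n (M N : 'M[{fps {fps F}}]_(m, n)) :
  (forall x, relators2 M N x -> h x = 0) <->
  map_mx (map_fps (map_fps h)) M = map_mx (map_fps (map_fps h)) N.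
Proof.
split=> [relh|eqMN x [i [j [r [s ->]]]]].
  apply/matrixP=> i j; apply/funext=> s; apply/funext=> r; rewrite !mxE /map_fps.
  apply/eqP; rewrite -subr_eq0 -rmorphB; apply/eqP/relh.
  by exists i, j, r, s; rewrite !mxE.
have : map_mx (map_fps (map_fps h)) (M - N) i j s r = 0.
  by rewrite map_mxB eqMN subrr mxE.
by rewrite mxE.
Qed.

Lemma reflection_relatorsP l :
  (forall x, reflection_relators l x -> h x = 0) <->
  let B := map_mx (map_fps h) (B_mx K l) in
  reflection_lhs B = reflection_rhs B /\ B *m neg_mx B = 1%:M.
Proof.
rewrite /= -(map_reflection_lhs h) -(map_reflection_rhs h) -(map_neg_mx h).
rewrite -(map_mxM (map_fps h)) -[1%:M](map_mx1 (map_fps h)) -relators1P -relators2P.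
split=> [relh|[rel2 rel1] x [/rel2|/rel1] //].
by split=> x relx; apply: relh; [left | right].
Qed.

Lemma twisted_relatorsP t :
  (forall x, twisted_relators t x -> h x = 0) <->
  let S := map_mx (map_fps h) (S_mx K) in
  quaternary_lhs t S = quaternary_rhs t S /\ symmetry_lhs t S = symmetry_rhs t S.
Proof.
rewrite /= -(map_quaternary_lhs h) -(map_quaternary_rhs h) -(map_symmetry_lhs h).
rewrite -(map_symmetry_rhs h) -relators1P -relators2P.
split=> [relh|[rel2 rel1] x [/rel2|/rel1] //].
by split=> x relx; apply: relh; [left | right].
Qed.

End Relators.

Section PresentedAlgebra.
Context (K : comNzRingType).
Local Notation F := (free_alg K gen_index).
Context (S : set F) (proper : ~ ideal_span S 1) (D : 'M[K]_2).
Local Notation Q := (quot_alg proper).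
Local Notation G := (map_mx (map_fps (quot_proj proper)) (gen_mx D)).
Implicit Type A : algType K.

Lemma gen_mxE i j r : (gen_mx D i j : {fps F}) r.+1 = free_gen K (r, i, j).
Proof. by rewrite mxE. Qed.

Lemma quot_ind (P : Q -> Prop) :
  P 1 -> (forall x y, P x -> P y -> P (x + y)) -> (forall c x, P x -> P (c *: x)) ->
  (forall i j r x, P x -> P (G i j r.+1 * x)) -> forall x, P x.
Proof.
move=> P1 PD PZ PG q; have [x ->] := quot_projP q.
elim/free_alg_ind: x => [|x y Px Py|c x Px|[[r i] j] x Px].
- by rewrite rmorph1.
- by rewrite rmorphD; apply: PD.
- by rewrite linearZ; apply: PZ.
- by rewrite rmorphM; have := PG i j r _ Px; rewrite mxE /map_fps gen_mxE.
Qed.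

Lemma gen_const i j : G i j 0%N = (D i j)%:A.
Proof. by rewrite !mxE /map_fps linearZ /= rmorph1. Qed.

Lemma quot_morph_eq A (f g : {lrmorphism Q -> A}) :
  map_mx (map_fps f) G = map_mx (map_fps g) G -> f =1 g.
Proof.
move=> eqfg; elim/quot_ind=> [|x y|c x|i j r x]; rewrite ?rmorph1 //.
- by move=> fx fy; rewrite !rmorphD /= fx fy.
- by move=> fx; rewrite !linearZ /= fx.
move=> fx; rewrite !rmorphM /= fx; congr (_ * _).
have := congr1 (fun M : 'M[{fps A}]_2 => M i j) eqfg.
by rewrite [LHS]mxE [RHS]mxE => /(congr1 (fun s : {fps A} => s r.+1)).
Qed.

Lemma coef_comm_central (f : {fps Q}) :
  (forall i j m n, f m * G i j n = G i j n * f m) -> forall m a, f m * a = a * f m.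
Proof.
move=> fG m; elim/quot_ind=> [|x y IHx IHy|c x IH|i j r x IH].
- by rewrite mulr1 mul1r.
- by rewrite mulrDr mulrDl IHx IHy.
- by rewrite -scalerAr -scalerAl IH.
- by rewrite mulrA fG -!mulrA IH.
Qed.

Lemma quot_morph_ex A (M : 'M[{fps A}]_2) :
  (forall i j, M i j 0%N = (D i j)%:A) ->
  (forall h : {lrmorphism F -> A}, map_mx (map_fps h) (gen_mx D) = M ->
     forall x, S x -> h x = 0) ->
  exists f : {lrmorphism Q -> A}, map_mx (map_fps f) G = M.
Proof.
move=> M0 relM; pose h : {lrmorphism F -> A} := free_eval (fun x : gen_index => M x.1.2
  x.2 x.1.1.+1).
have hM : map_mx (map_fps h) (gen_mx D) = M.
  apply/matrixP=> i j; rewrite mxE; apply/funext=> -[|r]; rewrite /map_fps.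
    by rewrite mxE /= linearZ /= rmorph1 M0.
  by rewrite gen_mxE /h /= free_eval_gen.
have [f fE] := quot_liftP proper (relM h hM).
exists f; rewrite -[RHS]hM -map_mx_comp; apply: eq_map_mx => s.
by apply/funext=> n; apply: fE.
Qed.

End PresentedAlgebra.

(** * Central normalizations *)

Lemma mulmx_centralr (E : nzRingType) (c : E) m n p (X : 'M[E]_(m, n)) (Y : 'M[E]_(n, p)) :
  (forall e, c * e = e * c) -> X *m (c *: Y) = c *: (X *m Y).
Proof.
move=> cC; apply/matrixP=> i j; rewrite !mxE mulr_sumr; apply: eq_bigr => k _.
by rewrite mxE !mulrA cC.
Qed.

Lemma reflection_eq_central (E : nzRingType) (x p y q c d : E) M N :
  (forall e, c * e = e * c) -> (forall e, d * e = e * d) ->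
  reflection_eq x p y q M N -> reflection_eq x p y q (c *: M) (d *: N).
Proof.
move=> cC dC; rewrite /reflection_eq.
have copyc : copy1 (c *: M) = c *: copy1 M.
  by apply: tens4P => i j k l; rewrite [RHS]mxE !copy1E mxE mulrnAr.
have copyd : copy2 (d *: N) = d *: copy2 N.
  by apply: tens4P => i j k l; rewrite [RHS]mxE !copy2E mxE mulrnAr.
move=> eqMN; rewrite copyc copyd !(mulmx_centralr _ _ cC, mulmx_centralr _ _ dC, =^~
  scalemxAl) eqMN.
by rewrite !scalerA cC.
Qed.

Lemma central_product (R : pzRingType) (q s s' d e : R) :
  (forall r, q * r = r * q) -> (forall r, s * r = r * s) -> (forall r, e * r = r * e) ->
  q * s * e * (q * s' * d) = q * (q * (s' * s * (d * e))).
Proof.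
move=> qC sC eC; rewrite -!mulrA eC -!mulrA; congr (q * _).
by rewrite mulrA -qC -mulrA; congr (q * _); rewrite mulrA sC -!mulrA.
Qed.

Section SklyaninIterate.
Context (C : comNzRingType) (E : algType C).
Implicit Types (a g : C) (y : E) (M : 'M[E]_2).

Lemma sklyanin_mxZ a g y M : sklyanin_mx a g (y *: M) = y *: sklyanin_mx a g M.
Proof.
have algC (c : C) : c%:A * y = y * c%:A by rewrite mulr_algl mulr_algr.
have trZ : twist_tr Symplectic (y *: M) = y *: twist_tr Symplectic M.
  by apply/matrixP=> i j; rewrite !mxE /=; case: ifP => _; rewrite // !mulN1r mulrN.
by rewrite /sklyanin_mx trZ scalerDr !scalerA !algC.
Qed.

(** Symplectic transposition is an involution t, and (a' t + g') (a t + g) = (a' a + g' g) + (a' g +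
    g' a) t. *)
Lemma sklyanin_mxK a g a' g' e M : a' * a + g' * g = e -> a' * g + g' * a = 0 ->
  sklyanin_mx a' g' (sklyanin_mx a g M) = e%:A *: M.
Proof.
move=> eE zE; apply/matrixP=> i j; rewrite [RHS]mxE mulr_algl -eE.
have [D00 D01 D10 D11] := sklyanin_mxE a g M.
have [D00' D01' D10' D11'] := sklyanin_mxE a' g' (sklyanin_mx a g M).
have z0 (v : E) : (a' * g + g' * a) *: v = 0 by rewrite zE scale0r.
elim/I2_ind: i; elim/I2_ind: j; rewrite ?D00' ?D01' ?D10' ?D11' ?D00 ?D01 ?D10 ?D11.
- by rewrite -[RHS]addr0 -(z0 (M i1 i1)); lin C.
- by rewrite -[RHS]subr0 -(z0 (M i0 i1)); lin C.
- by rewrite -[RHS]subr0 -(z0 (M i1 i0)); lin C.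
- by rewrite -[RHS]addr0 -(z0 (M i0 i0)); lin C.
Qed.

End SklyaninIterate.

Lemma reflection_series_central (K : comNzRingType) (A : algType K) a
    (g : {fps A}) (M : 'M[{fps A}]_2) :
  central g -> reflection_series a M -> reflection_series a (g *: M).
Proof.
move=> cg rM; rewrite /reflection_series.
rewrite [map_mx (@in_u A) (_ *: _)](map_mxZ (@fpsC {fps A})).
rewrite [map_mx (@in_v A) (_ *: _)](map_mxZ (map_fps (@fpsC A))).
apply: reflection_eq_central rM => F.
  apply/funext=> n; rewrite fpsC_mull fpsC_mulr; exact: central_comm.
apply/funext=> n; rewrite fpsME [RHS]fps_mul_rev; apply: eq_bigr => i _.
apply: central_comm => m b; change (fpsC (g i) m * b = b * fpsC (g i) m).
rewrite /fpsC.
by case: (m == 0%N); rewrite ?cg ?mul0r ?mulr0.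
Qed.

Section SeriesSolutions.
Context (K : numFieldType) (t : twist) (A : algType K).
Local Notation E1 := {fps A}.
Local Notation z := (fpsX : {fps K}).
Local Notation T := (@fps_shift K A 1).
Local Notation J := (@fps_reflect K A 1).
Local Notation shift_mx c := (map_mx (@fps_shift K A c)).
Local Notation reflect_mx := (map_mx J).
Local Notation sig := (symmetry_scalar t z).
Implicit Types (M B : 'M[E1]_2) (f g h x y : E1).

(** The relations of the twisted Yangian expressed through M(u) = S(u - 1/2) K. They differ from
    [unitary_series] in the last clause only. *)
Definition twisted_series M :=
  [/\ reflection_series false M,
      forall i j, M i j 0%N = (twist_diag K t i j)%:A &
      fusion_mx M = sig%:A *: reflect_mx M].

Definition unitary_series B :=
  [/\ reflection_series false B,
      forall i j, B i j 0%N = (twist_diag K t i j)%:A & B *m neg_mx B = 1%:M].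

Lemma fps_shift_coef0 (c : K) f : fps_shift c f 0%N = f 0%N.
Proof. by have v0 : fps_van 0 f by []; rewrite (fps_shift_lead c v0).1. Qed.

Lemma fps_neg_coef0 f : fps_neg f 0%N = f 0%N.
Proof. by rewrite /fps_neg mul1r. Qed.

Lemma fps_reflect_coef0 (c : K) f : fps_reflect c f 0%N = f 0%N.
Proof. by rewrite /fps_reflect /= fps_shift_coef0 fps_neg_coef0. Qed.

Lemma central_reflect (c : K) f : central f -> central (fps_reflect c f).
Proof. by move=> cf; apply/central_shift/central_neg. Qed.

Lemma mulr_unit0_inj w x y : w 0%N = 1 -> x * w = y * w -> x = y.
Proof.
move=> w0 xyw; apply/eqP; rewrite -subr_eq0; apply/eqP/funext=> n.
elim/ltn_ind: n => n IH; have /(congr1 (fun s : E1 => s n)) : (x - y) * w = 0.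
  by rewrite mulrBl xyw subrr.
by rewrite (fps_van_mull w (IH : fps_van n (x - y))) w0 mulr1.
Qed.

Lemma scalar_mx_inj x y : x%:M = y%:M :> 'M[E1]_2 -> x = y.
Proof. by move=> /matrixP/(_ i0 i0); rewrite !mxE eqxx !mulr1n. Qed.

Lemma coefM0 (M N : 'M[E1]_2) i j : (M *m N) i j 0%N = \sum_k M i k 0%N * N k j 0%N.
Proof.
by rewrite mxE -[LHS]/(fps_coef 0 _) raddf_sum; apply: eq_bigr => k _; rewrite /=
  /fps_coef fpsM0.
Qed.

Lemma reflect_mxK M : reflect_mx (reflect_mx M) = M.
Proof. by apply/matrixP=> i j; rewrite !mxE fps_reflectK. Qed.

Lemma fps_reflect_alg_z : J (z%:A) = (- zeta 1)%:A.
Proof. by rewrite fpsXA /fps_reflect /= fps_negX rmorphN /= fps_shiftX scaleNr. Qed.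

Lemma central_alg (c : {fps K}) : central (c%:A : E1).
Proof. exact: (@central_scale K A c 1 (@central1 K A)). Qed.

Lemma symmetry_scalar0 : sig 0%N = 2 * (twist_diag K t i0 i0 * twist_diag K t i1 i1).
Proof.
rewrite !mxE /symmetry_scalar /=; case: t; rewrite /= ?mulr1n ?expr0 ?expr1 ?mul1r ?mulr1.
  by rewrite mulrN1 !fpsDE !fpsNE fpsDE fpsNE subr0 sub0r.
by [].
Qed.

(** In the orthogonal case sigma is 2 (1 - u) / u, so u -> 1 - u inverts sigma / 2. *)
Lemma symmetry_scalarK : J (sig%:A) * sig%:A = 4%:R.
Proof.
have Jz := fps_reflect_alg_z; have w := @zeta1 K.
have two : (2 : {fps K})%:A = 2 :> E1 by rewrite scaler_nat.
rewrite /symmetry_scalar; case: t; last first.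
  by rewrite scaler_nat rmorph_nat -natrM.
have -> : J ((z - (2 - z))%:A) = (- zeta 1 - (2 + zeta 1))%:A.
  have JB (c d : {fps K}) : J (c - d)%:A = J c%:A - J d%:A by rewrite fps_algB rmorphB.
  have J2 : J 2%:A = (2 : {fps K})%:A by rewrite two rmorph_nat.
  by rewrite !JB Jz J2 -!fps_algB opprK.
rewrite -fps_algM (_ : _ * _ = 4%:R) ?scaler_nat //.
have -> : (- zeta 1 - (2 + zeta 1)) * (z - (2 - z)) =
   4%:R * (zeta 1 - z * zeta 1) - 4%:R * z + 4%:R :> {fps K} by ring.
by rewrite w addrN add0r.
Qed.

Lemma unitary_twisted B : unitary_series B ->
  (forall f, coef_comm f B -> central f) ->
  exists g, [/\ central g, g 0%N = 1, g * J g = 1 & twisted_series (g *: B)].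
Proof.
move=> [rB B0 BB] genB.
have [d [Dd /genB cd]] := reflection_fusion rB.
have DB : fusion_mx B = d *: reflect_mx B.
  (* Unitarity at u - 1: B(1 - u) is the inverse of B(u - 1), which turns the fusion identity into
     D(u) = d(u) B(1 - u). *)
  have TJ : shift_mx 1 B *m reflect_mx B = 1%:M.
    transitivity (shift_mx 1 (B *m neg_mx B)); last by rewrite BB map_mx1.
    by rewrite map_mxM; congr (_ *m _); apply/matrixP=> i j; rewrite !mxE.
  by rewrite -[LHS]mulmx1 -TJ mulmxA Dd mul_scalar_mx.
(* Reflecting D(u) = d(u) B(1 - u) and inserting it into itself composes two adjugate maps, which
   multiply B by 4 according to [sklyanin_mxK]. *)
have dJd : d * J d = 4%:R.
  have JDB : reflect_mx (fusion_mx B) =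
      sklyanin_mx (2 + zeta 1) (- zeta 1) (reflect_mx B).
    apply: map_sklyanin_mx; last exact: fps_reflect_alg_z.
    by rewrite fps_algB rmorphB /= fps_reflect_alg_z scaler_nat rmorph_nat scalerDl
      scaleNr opprK scaler_nat.
  rewrite DB map_mxZ reflect_mxK in JDB.
  have wE : zeta 1 - z * zeta 1 = z := @zeta1 K.
  have : (d * J d) *: B = (4%:R : {fps K})%:A *: B.
    rewrite -scalerA JDB -sklyanin_mxZ -DB; apply: sklyanin_mxK.
      by transitivity (4%:R + 2%:R * (zeta 1 - z * zeta 1) - 2%:R * z : {fps K});
        [ring | rewrite wE; ring].
    by transitivity (2%:R * z - 2%:R * (zeta 1 - z * zeta 1) : {fps K});
      [ring | rewrite wE; ring].
  move=> /(congr1 (mulmxr (neg_mx B))) /=; rewrite -!scalemxAl BB !scale_scalar_mx !mulr1.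
  by move/scalar_mx_inj; rewrite scaler_nat.
have cJd : central (J d) by apply: central_reflect.
have d0 : d 0%N = 2 *: (twist_diag K t i0 i0 * twist_diag K t i1 i1)%:A.
  have [D00 D01 _ _] := sklyanin_mxE (2 - z) z B.
  have /(congr1 (fun M : 'M[E1]_2 => M i0 i0 0%N)) := Dd; rewrite [in RHS]mxE eqxx mulr1n
    => <-.
  rewrite coefM0 sum_I2 /fusion_mx D00 D01 !fpsDE fpsNE !fpsZ0 !B0.
  have -> : (twist_diag K t i0 i1) = 0 by rewrite mxE mulr0n.
  have -> : (2 - z) 0%N = 2 by rewrite fpsDE fpsNE subr0.
  rewrite !scale0r !scaler0 subr0 mul0r !addr0 [map_mx _ B _ _]mxE /= fps_shift_coef0 B0.
  by rewrite -scalerAl mulr_algl !scalerA -[in LHS]mulrA (mulrC (twist_diag K t i1 i1)).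
set q : {fps K} := fpsC 4^-1.
have q4 : q * 4%:R = 1.
  by rewrite /q -(rmorph_nat (@fpsC K) 4) -rmorphM /= mulVf ?pnatr_eq0 // rmorph1.
have Q4 : (q%:A : E1) * 4%:R = 1 by rewrite mulr_algl -scaler_nat scalerA q4 scale1r.
have Jq : J q%:A = q%:A.
  rewrite fpsC_alg /fps_reflect /= [fps_neg _](_ : _ = fpsC 4^-1%:A) ?fps_shiftC //.
  by apply/funext=> -[|n]; rewrite /fps_neg /fpsC /= ?expr0 ?mul1r ?mulr0.
pose c : E1 := (q * sig) *: J d.
have cc : central c by apply: central_scale.
(* Both d and sigma have constant term 2 det(K), and det(K)^2 = 1. *)
have c0 : c 0%N = 1.
  rewrite /c fpsZ0 fps_reflect_coef0 d0 fpsM0 symmetry_scalar0 /q.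
  rewrite [fpsC _ _](_ : _ = 4^-1) // scalerA.
  have kk i : twist_diag K t i i * twist_diag K t i i = 1.
    rewrite mxE eqxx mulr1n; case: t; last exact: mulr1.
    by rewrite -expr2 sqrr_sign.
  set a := twist_diag K t i0 i0; set b := twist_diag K t i1 i1.
  have ab : (a * b) * (a * b) = 1 by rewrite mulrACA !kk mulr1.
  rewrite scalerA (_ : 4^-1 * (2 * (a * b)) * (2 * (a * b)) = 4^-1 * 4%:R * ((a * b) * (a
    * b))); last by ring.
  by rewrite ab mulr1 mulVf ?pnatr_eq0 // scale1r.
have [g [cg g0 gg]] := central_sqrt cc c0.
(* The square of [g * J g] is c(u) c(1 - u), in which sigma and d each contribute 4 against the
   factor 1/16. *)
have gJg : g * J g = 1.
  apply: sqrt1_unique; first by rewrite fpsM0 fps_reflect_coef0 g0 mulr1.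
  have -> : g * J g * (g * J g) = c * J c.
    rewrite -gg rmorphM /= -!mulrA; congr (_ * _); rewrite !mulrA; congr (_ * _).
    exact: esym (central_comm _ cg).
  have cE : c = q%:A * sig%:A * J d by rewrite /c -fps_algM mulr_algl.
  have -> : J c = q%:A * J (sig%:A) * d.
    have JM x y : J (x * y) = J x * J y by exact: rmorphM.
    by rewrite cE (JM (q%:A * sig%:A)) (JM q%:A) Jq fps_reflectK.
  rewrite cE central_product ?symmetry_scalarK ?dJd.
  - by rewrite (mulrA q%:A 4%:R) Q4 mul1r Q4.
  - by move=> r; apply: central_comm; apply: central_alg.
  - by move=> r; apply: central_comm; apply: central_alg.
  - by move=> r; apply: central_comm.
exists g; split; [exact: cg | exact: g0 | exact: gJg | split=> [|i j|]].
- exact: reflection_series_central.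
- by rewrite mxE fpsM0 g0 mul1r.
rewrite [LHS]sklyanin_mxZ -/(fusion_mx B) DB map_mxZ !scalerA; congr (_ *: _).
(* The remaining claim g d = sigma J(g) is this identity multiplied by J(g). *)
have ggd : g * g * d = sig%:A.
  rewrite gg /c -scalerAl (central_comm _ cJd) dJd -scaler_nat.
  rewrite -[X in _ *: X]/((4%:R : {fps K}) *: 1).
  by rewrite scalerA mulrAC q4 mul1r.
transitivity (g * d * (g * J g)); first by rewrite gJg mulr1.
rewrite -ggd -!mulrA; congr (_ * _).
by rewrite (mulrA d) -(central_comm d cg) -mulrA.
Qed.

End SeriesSolutions.
Section SeriesInverse.
Context (K : numFieldType) (t : twist) (A : algType K).
Local Notation E1 := {fps A}.
Local Notation z := (fpsX : {fps K}).
Local Notation T := (@fps_shift K A 1).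
Local Notation J := (@fps_reflect K A 1).
Local Notation reflect_mx := (map_mx J).
Local Notation sig := (symmetry_scalar t z).
Implicit Types (M B : 'M[E1]_2) (f g h x y : E1).

Lemma unitary_scalar0 M f : (forall i j, M i j 0%N = (twist_diag K t i j)%:A) ->
  M *m neg_mx M = f%:M -> f 0%N = 1.
Proof.
move=> M0 /(congr1 (fun M : 'M[E1]_2 => M i0 i0 0%N)); rewrite [in RHS]mxE eqxx mulr1n => <-.
rewrite coefM0 sum_I2 !M0 (_ : twist_diag K t i0 i1 = 0); last by rewrite mxE mulr0n.
rewrite scale0r mul0r addr0 [neg_mx M _ _]mxE fps_neg_coef0 M0 mulr_algl scalerA.
rewrite mxE eqxx mulr1n; case: t; last by rewrite mulr1 scale1r.
by rewrite expr0 mulr1 scale1r.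
Qed.

Lemma fps_shift_neg f : T (fps_neg f) = J f. Proof. by []. Qed.

Lemma twisted_unitary M : twisted_series t M ->
  (forall f, coef_comm f M -> central f) ->
  exists f h, [/\ M *m neg_mx M = f%:M, T f * T h = h, central h /\ h 0%N = 1,
                  h * J h = 1 & unitary_series t (h *: M)].
Proof.
move=> [rM M0 DM] genM.
have [f [Mf fM /genM cf]] := reflection_unitary rM.
have f0 := unitary_scalar0 M0 Mf.
(* Since M(-u) M(u) is the same scalar, f is even; this gives f 1 = 0 for [shift_equation]. *)
have nf : fps_neg f = f.
  apply: scalar_mx_inj; rewrite -[RHS]fM.
  transitivity (neg_mx (M *m neg_mx M)); first by rewrite Mf [RHS]map_scalar_mx.
  rewrite [LHS]map_mxM; congr (_ *m _); apply/matrixP=> i j; rewrite !mxE.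
  exact: fps_negK.
have f1 : f 1%N = 0.
  have := congr1 (fun s : E1 => s 1%N) nf; rewrite {1}/fps_neg expr1 mulN1r => /eqP.
  by rewrite -subr_eq0 -opprD oppr_eq0 -mulr2n -scaler_nat scaler_eq0 pnatr_eq0 => /eqP.
have [h [ch h0 hT]] := shift_equation cf f0 f1.
(* The equation for h at 1 - u, with f(-u) = f(u). *)
have JhE : f * fps_neg h = J h.
  rewrite -[in RHS]hT -!fps_shift_neg rmorphM /= !fps_neg_shift nf rmorphM /=.
  by rewrite !fps_shift_shift subrr !fps_shift0.
(* Translating h(u) h(1 - u) by 1 moves the factor f(u - 1) from one factor to the other, so the
   product is constant. *)
have hJh : h * J h = 1.
  rewrite (shift_invariant (x := h * J h)).
    by rewrite fpsM0 fps_reflect_coef0 h0 mulr1.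
  have TJh : T (J h) = T f * J h by rewrite -{1}JhE [LHS]rmorphM.
  rewrite rmorphM /= TJh mulrA; congr (_ * _); rewrite -[RHS]hT.
  by apply/esym/central_comm/central_shift.
exists f, h; split; [exact: Mf | exact: hT | split; [exact: ch | exact: h0] | exact: hJh
  | split].
- exact: reflection_series_central.
- by move=> i j; rewrite mxE fpsM0 h0 mul1r.
rewrite [neg_mx _](map_mxZ (@fps_neg A)) -scalemxAl.
rewrite mulmx_centralr; last by move=> e; apply: central_comm; apply: central_neg.
(* The scalar to be computed is h(u) h(-u) f(u), that is, h(u) h(1 - u). *)
rewrite -[map_mx _ M]/(neg_mx M) Mf !scale_scalar_mx; congr (_%:M).
by rewrite -hJh -JhE (central_comm _ cf).
Qed.

(** Here x is the image of h, and g(u) g(-u) that of f. As g(1 - u) inverts g(u), the equation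
    becomes x(u) g(u) = x(u - 1) g(u - 1). *)
Lemma unitary_twistedK g x : central g -> g 0%N = 1 -> g * J g = 1 -> x 0%N = 1 ->
  T (g * fps_neg g) * T x = x -> x * g = 1.
Proof.
move=> cg g0 gJg x0 xT; have cTg : central (T g) by apply: central_shift.
have cJg : central (J g) by apply: central_reflect.
rewrite (shift_invariant (x := x * g)); first by rewrite fpsM0 x0 g0 mulr1.
have TM a b : T (a * b) = T a * T b by exact: rmorphM.
have xE : x = T g * J g * T x by rewrite -{1}xT TM.
rewrite TM [in RHS]xE -(mulrA (T g)) (central_comm (T x) cJg) -!mulrA.
by rewrite (central_comm g cJg) gJg mulr1 (central_comm (T x) cTg).
Qed.

(** Here y is the image of g. Symmetry of both M and w M, with w = y h, forces w(u) = w(1 - u);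
    together with w(u) w(1 - u) = 1 this makes w a square root of 1. *)
Lemma twisted_unitaryK M f h y : twisted_series t M -> M *m neg_mx M = f%:M ->
  central h -> h 0%N = 1 -> h * J h = 1 -> y 0%N = 1 -> y * J y = 1 ->
  fusion_mx (y *: (h *: M)) = sig%:A *: reflect_mx (y *: (h *: M)) -> y * h = 1.
Proof.
move=> [_ M0 DM] Mf ch h0 hJh y0 yJy; rewrite scalerA; set w := y * h => Dw.
have f0 := unitary_scalar0 M0 Mf.
have w0 : w 0%N = 1 by rewrite /w fpsM0 y0 h0 mulr1.
have wJ : w = J w.
  have Jf0 : J f 0%N = 1 by rewrite fps_reflect_coef0.
  apply: (mulr_unit0_inj Jf0).
  have sigC (r : E1) : sig%:A * r = r * sig%:A.
    by apply: central_comm; apply: central_alg.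
  (* Multiplication by M(u - 1) replaces M(1 - u) by the scalar f(1 - u), whose constant term is 1;
     sigma is cancelled through sigma(u) sigma(1 - u) = 4. *)
  have JMf : reflect_mx M *m reflect_mx (neg_mx M) = (J f)%:M.
    by rewrite -map_mxM Mf map_scalar_mx.
  have : sig%:A * (w * J f) = sig%:A * (J w * J f).
    apply: scalar_mx_inj.
    have e1 : (w *: (sig%:A *: reflect_mx M)) *m reflect_mx (neg_mx M) =
        (sig%:A * (w * J f))%:M.
      by rewrite -scalemxAl -scalemxAl JMf 2!scale_scalar_mx (mulrA w) -sigC -mulrA.
    have e2 : (sig%:A *: (J w *: reflect_mx M)) *m reflect_mx (neg_mx M) =
        (sig%:A * (J w * J f))%:M.
      by rewrite -scalemxAl -scalemxAl JMf 2!scale_scalar_mx.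
    have e12 : w *: (sig%:A *: reflect_mx M) = sig%:A *: (J w *: reflect_mx M).
      by rewrite -(map_mxZ J w M) -DM -[LHS]sklyanin_mxZ.
    exact: etrans (esym e1) (etrans (congr1 (mulmxr _) e12) e2).
  move=> /(congr1 (fun r => J (sig%:A) * r)).
  rewrite 2!(mulrA (J sig%:A) sig%:A) symmetry_scalarK.
  have fourE (r : E1) : 4%:R * r = (4%:R : {fps K}) *: r by rewrite -mulr_algl scaler_nat.
  rewrite 2!fourE.
  apply: scale_reg_eq; apply: scale_reg0.
  by rewrite -[(4%:R : {fps K}) 0%N]/(fps_coef 0 4%:R) raddfMn /= pnatr_eq0.
apply: sqrt1_unique => //; rewrite {2}wJ /w rmorphM /= -mulrA.
rewrite (mulrA h) (central_comm (J y) ch) -mulrA hJh mulr1; exact: yJy.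
Qed.

End SeriesInverse.

(** * The correspondence M(u) = S(u - 1/2) K *)

Section TwistedSeries.
Context (K : numFieldType) (t : twist) (A : algType K).
Local Notation E1 := {fps A}.
Local Notation k := (twist_diag E1 t).
Local Notation shift_mx c := (map_mx (@fps_shift K A c)).
Implicit Types M S : 'M[E1]_2.

Definition reflection_of_twisted S : 'M[E1]_2 := shift_mx 2^-1 S *m k.
Definition twisted_of_reflection M : 'M[E1]_2 := shift_mx (- 2^-1) (M *m k).

Lemma shift_mxK c M : shift_mx c (shift_mx (- c) M) = M.
Proof.
by apply/matrixP=> i j; rewrite !mxE /= fps_shift_shift addrN fps_shift0.
Qed.

Lemma shift_mx_diag c M : shift_mx c (M *m k) = shift_mx c M *m k.
Proof. by rewrite map_mxM map_twist_diag. Qed.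

Lemma twisted_of_reflectionK S : twisted_of_reflection (reflection_of_twisted S) = S.
Proof.
rewrite /twisted_of_reflection -mulmxA twist_diagK mulmx1.
by have := shift_mxK (- 2^-1) S; rewrite opprK.
Qed.

Lemma reflection_of_twistedK M : reflection_of_twisted (twisted_of_reflection M) = M.
Proof.
by rewrite /reflection_of_twisted shift_mxK -mulmxA twist_diagK mulmx1.
Qed.

Lemma diag_coef0 i j : k i j 0%N = (twist_diag K t i j)%:A.
Proof.
rewrite !mxE; case: (i == j); last by rewrite !mulr0n scale0r.
case: t => /=; last by rewrite !mulr1n scale1r.
by case: (i == i1); rewrite !mulr1n ?expr0 ?expr1 ?scale1r ?scaleN1r.
Qed.

Lemma mul_diag_coef0 M i j :
  (M *m k) i j 0%N = \sum_l twist_diag K t l j *: M i l 0%N.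
Proof.
by rewrite coefM0; apply: eq_bigr => l _; rewrite diag_coef0 mulr_algr.
Qed.

Lemma quaternary_twisted_series S :
  quaternary_lhs t S = quaternary_rhs t S -> symmetry_lhs t S = symmetry_rhs t S ->
  (forall i j, S i j 0%N = (1%:M i j)%:A) ->
  twisted_series t (reflection_of_twisted S).
Proof.
move=> qS sS S0; split.
- rewrite /reflection_of_twisted -shift_mx_diag.
  apply: reflection_series_shift ((quaternary_seriesP t S).1 qS).
  by rewrite addr0 -[2^-1]mul1r -splitr.
- move=> i j; rewrite mul_diag_coef0 (bigD1 i) //= big1 ?addr0 => [|l ne].
    by rewrite [map_mx _ S _ _]mxE /= fps_shift_coef0 S0 [1%:M _ _]mxE eqxx scale1r.
  by rewrite [map_mx _ S _ _]mxE /= fps_shift_coef0 S0 [1%:M _ _]mxE eq_sym (negPf ne)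
    scale0r scaler0.
exact: (symmetry_seriesP t S).1 sS.
Qed.

Lemma twisted_series_quaternary M : twisted_series t M ->
  let S := twisted_of_reflection M in
  [/\ quaternary_lhs t S = quaternary_rhs t S, symmetry_lhs t S = symmetry_rhs t S &
      forall i j, S i j 0%N = (1%:M i j)%:A].
Proof.
move=> [rM M0 DM] S; have SM : reflection_of_twisted S = M by apply: reflection_of_twistedK.
split.
- apply: (quaternary_seriesP t S).2; rewrite -shift_mx_diag -mulmxA twist_diagK mulmx1.
  apply: reflection_series_shift rM.
  by rewrite -opprD -[2^-1]mul1r -splitr addNr.
- by apply: (symmetry_seriesP t S).2; rewrite -/(reflection_of_twisted S) SM.
move=> i j; rewrite mxE /= fps_shift_coef0 mul_diag_coef0 -(twist_diagK K t).
rewrite [X in X%:A]mxE scaler_suml; apply: eq_bigr => l _.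
by rewrite M0 scalerA mulrC.
Qed.

Lemma coef_comm_twisted f S : coef_comm f (reflection_of_twisted S) -> coef_comm f S.
Proof.
move=> fM i j m n; rewrite -(twisted_of_reflectionK S).
set M := reflection_of_twisted S in fM *.
rewrite mxE /fps_shift fps_substE mulr_suml mulr_sumr; apply: eq_bigr => l _.
rewrite -scalerAr -scalerAl; congr (_ *: _).
have diagC (e : 'I_2) : k e j = (fpsC (twist_diag K t e j))%:A.
  rewrite fpsC_alg !mxE; case: (e == j); last by rewrite !mulr0n scale0r raddf0.
  case: t => /=; last by rewrite !mulr1n scale1r.
  by case: (e == i1); rewrite !mulr1n ?expr0 ?expr1 ?scale1r ?scaleN1r ?raddfN.
have -> : (M *m k) i j l = \sum_e twist_diag K t e j *: M i e l.
  rewrite mxE -[LHS]/(fps_coef l (\sum_e _)) raddf_sum; apply: eq_bigr => e _.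
  by rewrite diagC mulr_algr /= /fps_coef fpsC_scale.
rewrite mulr_suml mulr_sumr; apply: eq_bigr => e _.
by rewrite -scalerAr -scalerAl fM.
Qed.

End TwistedSeries.

(** * The two morphisms and their composites *)

Lemma map_fps_shift (K : comNzRingType) (A B : algType K) (phi : {lrmorphism A -> B}) c
  (f : {fps A}) : map_fps phi (fps_shift c f) = fps_shift c (map_fps phi f).
Proof. exact: map_fps_subst. Qed.

Lemma map_fps_neg (K : comNzRingType) (A B : algType K) (phi : {lrmorphism A -> B})
  (f : {fps A}) : map_fps phi (fps_neg f) = fps_neg (map_fps phi f).
Proof. by apply/funext=> n; rewrite /map_fps rmorphM rmorph_sign. Qed.

Section SeriesMorphism.
Context (K : numFieldType) (t : twist) (A B : algType K) (phi : {lrmorphism A -> B}).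
Local Notation phi1 := (map_fps phi).
Implicit Types (f : {fps A}) (M : 'M[{fps A}]_2).

Lemma map_fps_reflect c f : phi1 (fps_reflect c f) = fps_reflect c (phi1 f).
Proof. by rewrite /fps_reflect /= map_fps_shift map_fps_neg. Qed.

Lemma map_fps_alg (c : {fps K}) : phi1 (c%:A) = c%:A.
Proof. by rewrite [LHS]map_fps_scale rmorph1. Qed.

Lemma map_fusion_mx M : map_mx phi1 (fusion_mx M) = fusion_mx (map_mx phi1 M).
Proof. by apply: map_sklyanin_mx; apply: map_fps_alg. Qed.

Lemma map_reflection_of_twisted M :
  map_mx phi1 (reflection_of_twisted t M) = reflection_of_twisted t (map_mx phi1 M).
Proof.
rewrite map_mxM map_twist_diag; congr (_ *m _).
by apply/matrixP=> i j; rewrite !mxE; apply: map_fps_shift.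
Qed.

Lemma map_twisted_of_reflection M :
  map_mx phi1 (twisted_of_reflection t M) = twisted_of_reflection t (map_mx phi1 M).
Proof.
rewrite /twisted_of_reflection !shift_mx_diag map_mxM map_twist_diag; congr (_ *m _).
by apply/matrixP=> i j; rewrite !mxE; apply: map_fps_shift.
Qed.

Lemma map_reflect_mx M :
  map_mx phi1 (map_mx (@fps_reflect K A 1) M) = map_mx (@fps_reflect K B 1) (map_mx phi1 M).
Proof. by apply/matrixP=> i j; rewrite !mxE; apply: map_fps_reflect. Qed.

Lemma map_scale_reflect_mx (c : {fps K}) M :
  map_mx phi1 (c%:A *: map_mx (@fps_reflect K A 1) M) =
  c%:A *: map_mx (@fps_reflect K B 1) (map_mx phi1 M).
Proof.
rewrite [LHS](map_mxZ (map_fps phi)); congr (_ *: _); first exact: map_fps_alg.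
exact: map_reflect_mx.
Qed.

End SeriesMorphism.

(** The two algebras enter only through their universal properties and the centrality criterion, so
    quotients and relators stay out of the argument. *)
Lemma twisted_unitary_iso (K : numFieldType) (t : twist) (Y B : algType K)
    (SY : 'M[{fps Y}]_2) (BB : 'M[{fps B}]_2) :
  twisted_series t (reflection_of_twisted t SY) -> unitary_series t BB ->
  (forall f, coef_comm f SY -> central f) -> (forall f, coef_comm f BB -> central f) ->
  (forall u v : {lrmorphism Y -> Y},
    map_mx (map_fps u) SY = map_mx (map_fps v) SY -> u =1 v) ->
  (forall u v : {lrmorphism B -> B},
    map_mx (map_fps u) BB = map_mx (map_fps v) BB -> u =1 v) ->
  (forall M : 'M[{fps B}]_2, twisted_series t M -> exists f : {lrmorphism Y -> B},
    map_mx (map_fps f) SY = twisted_of_reflection t M) ->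
  (forall M : 'M[{fps Y}]_2, unitary_series t M -> exists f : {lrmorphism B -> Y},
    map_mx (map_fps f) BB = M) ->
  exists f : {lrmorphism Y -> B}, bijective f.
Proof.
set MY := reflection_of_twisted t SY => tM uB genY genB extY extB univY univB.
have [g [cg g0 gJg tgB]] := unitary_twisted uB genB.
have genM f : coef_comm f MY -> central f by move=> /coef_comm_twisted; apply: genY.
have [f [h [Mf hT [ch h0] hJh uhM]]] := twisted_unitary tM genM.
have [a aS] := univY _ tgB; have [b bB] := univB _ uhM.
have aM : map_mx (map_fps a) MY = g *: BB.
  by rewrite [LHS]map_reflection_of_twisted aS reflection_of_twistedK.
(* The composite [a \o b] multiplies BB by this scalar. *)
have ahg : map_fps a h * g = 1.
  have [_ _ BN] := uB.
  (* The image of M(u) M(-u) = f(u) under [a] is g(u) g(-u) B(u) B(-u). *)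
  have af : map_fps a f = g * fps_neg g.
    apply: scalar_mx_inj; rewrite -[LHS](map_scalar_mx (map_fps a)) -Mf map_mxM.
    rewrite [map_mx _ (neg_mx _)](_ : _ = fps_neg g *: neg_mx BB); last first.
      rewrite -(map_mxZ (@fps_neg B)) -aM; apply/matrixP=> i j.
      by rewrite !mxE; apply: map_fps_neg.
    rewrite [map_mx _ MY]aM -scalemxAl mulmx_centralr; last first.
      by move=> e; apply: central_comm; apply: central_neg.
    by rewrite BN scalerA scale_scalar_mx mulr1.
  apply: (unitary_twistedK cg g0 gJg); first by rewrite /map_fps h0 rmorph1.
  by rewrite -af -!map_fps_shift -[LHS]rmorphM hT.
(* The composite [b \o a] multiplies MY by this scalar. *)
have bgh : map_fps b g * h = 1.
  have [_ _ Dg] := tgB.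
  apply: (twisted_unitaryK tM Mf ch h0 hJh).
  - by rewrite /map_fps g0 rmorph1.
  - by rewrite -map_fps_reflect -[LHS]rmorphM gJg rmorph1.
  have gBE : map_mx (map_fps b) (g *: BB) = map_fps b g *: (h *: MY) by rewrite map_mxZ bB.
  have := congr1 (map_mx (map_fps b)) Dg.
  rewrite map_fusion_mx map_scale_reflect_mx gBE; exact.
have map_id (A : algType K) (M : 'M[{fps A}]_2) : map_mx (map_fps idfun) M = M.
  by apply/matrixP=> i j; rewrite mxE.
have map_comp (A1 A2 A3 : algType K) (u : {lrmorphism A1 -> A2}) (v : {lrmorphism A2 -> A3})
    (M : 'M[{fps A1}]_2) :
    map_mx (map_fps (v \o u)) M = map_mx (map_fps v) (map_mx (map_fps u) M).
  by apply/matrixP=> i j; rewrite !mxE.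
exists a; exists b => x.
  apply: (extY (b \o a) idfun); rewrite map_id map_comp aS map_twisted_of_reflection.
  by rewrite map_mxZ bB scalerA bgh scale1r twisted_of_reflectionK.
apply: (extB (a \o b) idfun); rewrite map_id map_comp bB map_mxZ [map_mx _ MY]aM.
by rewrite scalerA ahg scale1r.
Qed.

Section Isomorphism.
Context (K : numFieldType) (t : twist) (l : nat).
Hypothesis eps_twist : reflection_eps K l = twist_diag K t.
Local Notation Y := (twisted_yangian K t).
Local Notation B := (reflection_algebra K l).
Local Notation SY := (map_mx (map_fps (quot_proj (@twisted_proper K t))) (S_mx K)).
Local Notation BB := (map_mx (map_fps (quot_proj (@reflection_proper K l))) (B_mx K l)).
Local Notation sig := (symmetry_scalar t (fpsX : {fps K})).

Lemma twisted_generators :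
  [/\ quaternary_lhs t SY = quaternary_rhs t SY, symmetry_lhs t SY = symmetry_rhs t SY &
      forall i j, SY i j 0%N = (1%:M i j)%:A].
Proof.
have [|qS sS] := (twisted_relatorsP (quot_proj (@twisted_proper K t)) t).1.
  by move=> x relx; apply/quot_proj_eq0 => J _; apply.
split; [exact: qS | exact: sS | exact: gen_const].
Qed.

Lemma reflection_generators : unitary_series t BB.
Proof.
have [|rB uB] := (reflection_relatorsP (quot_proj (@reflection_proper K l)) l).1.
  by move=> x relx; apply/quot_proj_eq0 => J _; apply.
split; [exact: (reflection_seriesP _).1 rB | | exact: uB].
by move=> i j; rewrite -eps_twist; apply: gen_const.
Qed.

Lemma twisted_yangian_morph (A : algType K) (M : 'M[{fps A}]_2) : twisted_series t M ->
  exists f : {lrmorphism Y -> A}, map_mx (map_fps f) SY = twisted_of_reflection t M.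
Proof.
move=> /twisted_series_quaternary[qS sS S0].
apply: quot_morph_ex S0 _ => h hS; apply/twisted_relatorsP.
by rewrite /= [map_mx _ _]hS.
Qed.

Lemma reflection_algebra_morph (A : algType K) (M : 'M[{fps A}]_2) : unitary_series t M ->
  exists f : {lrmorphism B -> A}, map_mx (map_fps f) BB = M.
Proof.
move=> [rM M0 uM]; apply: quot_morph_ex => [i j|h hM]; first by rewrite M0 eps_twist.
apply/reflection_relatorsP; rewrite /= [map_mx _ _]hM.
by split; [exact: (reflection_seriesP _).2 rM | exact: uM].
Qed.

Lemma twisted_reflection_iso : exists f : {lrmorphism Y -> B}, bijective f.
Proof.
have [qS sS S0] := twisted_generators.
apply: (@twisted_unitary_iso K t Y B SY BB).
- exact: quaternary_twisted_series qS sS S0.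
- exact: reflection_generators.
- by move=> f; apply: coef_comm_central.
- by move=> f; apply: coef_comm_central.
- by move=> u v; apply: quot_morph_eq.
- by move=> u v; apply: quot_morph_eq.
- by move=> M; apply: twisted_yangian_morph.
- by move=> M; apply: reflection_algebra_morph.
Qed.

End Isomorphism.

Lemma reflection_eps_orthogonal (K : comNzRingType) :
  reflection_eps K 1 = twist_diag K Orthogonal.
Proof.
apply/matrixP; do 2!elim/I2_ind; rewrite !mxE /= ?mulr0n ?mul0r //.
  by rewrite !mulr1n mul1r.
by rewrite !mulr1n mul1r expr1.
Qed.

Lemma reflection_eps_symplectic (K : comNzRingType) :
  reflection_eps K 0 = twist_diag K Symplectic.
Proof.
by apply/matrixP; do 2!elim/I2_ind; rewrite !mxE /= ?mulr0n ?mul0r // !mulr1n mul1r.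
Qed.

Theorem mainTheorem6 (R : realType) :
  (exists f : {lrmorphism twisted_yangian R[i] Orthogonal ->
                           reflection_algebra R[i] 1},
     bijective f) /\
  (exists f : {lrmorphism twisted_yangian R[i] Symplectic ->
                           reflection_algebra R[i] 0},
     bijective f).
Proof.
split.
  exact: (@twisted_reflection_iso R[i] Orthogonal 1 (reflection_eps_orthogonal _)).
exact: (@twisted_reflection_iso R[i] Symplectic 0 (reflection_eps_symplectic _)).
Qed.
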